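(* Let $f(z)=z+z^2+z^3+o(z^3)$ be a germ of an analytic diffeomorphism of $(\mathbb{C},0)$, with attracting petal $V_+$ and repelling petal $V_-$, and let $H^f$ on $V_+$ and $H^{f^{-1}}$ on $V_-$ be its principal parts of complex measures. The functions $H^f-i\pi^2$ on $V_+$ and $\pi z-H^{f^{-1}}$ on $V_-$ glue to a global analytic function on a neighborhood of $z=0$ (after subtraction of the logarithmic term) if and only if $f$ is of the form $$f(z)=\varphi^{-1}\left(e^z\cdot\varphi(z)\right)$$ for some analytic germ $\varphi(z)\in z+z^2\mathbb{C}\{z\}$. The principal parts are then given by $$H^f(z)=-\pi\,\mathrm{Log}(\varphi(z))+i\pi^2-\frac\pi4,\quad z\in V_+,\qquad H^{f^{-1}}(z)=\pi z+\pi\,\mathrm{Log}(\varphi(z))+\frac\pi4,\quad z\in V_-,$$ where the branches of the complex logarithm are determined by the petals.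
   Context: $V_+$ and $V_-$ are the (maximal) Leau-Fatou petals: open sets of opening angle $2\pi$ at $0$, centered at the negative and the positive real axis respectively, with $f(V_+)\subset V_+$ and $f^{-1}(V_-)\subset V_-$, on which forward iterates of $f$, respectively of $f^{-1}$, converge to $0$. The branch of $\mathrm{Log}$ is the one with argument in $(0,2\pi)$ on $V_+$ and in $(-\pi,\pi)$ on $V_-$. Gluing to a global analytic function is meant in the sense that $H^f-i\pi^2+\pi\mathrm{Log}(z)$ on $V_+$ and $\pi z-H^{f^{-1}}+\pi\mathrm{Log}(z)$ on $V_-$, with these branches, are restrictions of one function analytic on a neighborhood of $0$. For $z\in V_+$ let $S^f(z)=\{f^{\circ n}(z):n\in\mathbb{N}_0\}$. $U_\varepsilon$ is the $\varepsilon$-neighborhood of $U\subset\mathbb{C}$. The complex measure of a measurable set $U$ is $\widetilde{A^{\mathbb{C}}}(U)=A(U)\cdot t(U)$, with $A(U)$ the area and $t(U)\in\mathbb{C}$ the center of mass. For fixed $z\in V_+$, as $\varepsilon\to0$, $\widetilde{A^{\mathbb{C}}}(S^f(z)_\varepsilon)=q_1\varepsilon^2\log\varepsilon+H^f(z)\varepsilon^2+q_2\varepsilon^{5/2}\log\varepsilon+O(\varepsilon^{5/2})$ with $q_1,q_2$ independent of $z$; the principal part $H^f(z)$ is the coefficient of $\varepsilon^2$. The principal part $H^{f^{-1}}(z)$, $z\in V_-$, is defined in the same way for the orbits $S^{f^{-1}}(z)=\{f^{\circ(-n)}(z):n\in\mathbb{N}_0\}$ of $f^{-1}$. *)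

(* Defs.v *)
From HB Require Import structures.
From mathcomp Require Import all_boot all_order all_algebra.
From mathcomp Require Import all_classical all_reals all_analysis.
From mathcomp Require Export complex.

Set Implicit Arguments.
Unset Strict Implicit.
Unset Printing Implicit Defensive.

Import Order.TTheory GRing.Theory Num.Theory.
Import numFieldNormedType.Exports.

Local Open Scope classical_set_scope.
Local Open Scope ring_scope.
Local Open Scope complex_scope.

(* The topology of R[i] is the one of its norm, which takes its values in the
   nonnegative reals of R[i] (and not in R). *)
#[warnings="-redundant-canonical-projection"]
HB.instance Definition _ (R : realType) := NormedModule.copy R[i] R[i]^o.

Section Complex.
Variable R : realType.
Implicit Types (z w : R[i]) (h phi : R[i] -> R[i]) (a t : R).

Definition cis t : R[i] := cos t +i* sin t.

Definition cexp z : R[i] := (expR (complex.Re z))%:C * cis (complex.Im z).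

(* The argument of z in the open interval ]a, a + 2 pi[, and the branch of the
   logarithm it defines; the cut is the ray of direction a. On that ray, and at
   0, the values are meaningless. *)
Definition arg a z : R :=
  xget 0 [set t | a < t < a + 2 * pi /\ z = `|z| * cis t].

Definition Log a z : R[i] := ln (complex.Re `|z|) +i* arg a z.

(* The branch of Log (phi z), for phi tangent to the identity, that is
   asymptotic to the branch Log a z as z -> 0: phi z / z tends to 1, and its
   logarithm is the principal one. *)
Definition Log_germ a phi z : R[i] := Log a z + Log (- pi) (phi z / z).

Definition analytic_at h z : Prop :=
  exists c : nat -> R[i], \forall w \near z,
    series (fun n => c n * (w - z) ^+ n) @ \oo --> h w.

Definition analytic_on h (D : set R[i]) : Prop :=
  forall z, D z -> analytic_at h z.

(* phi belongs to z + z^2 C{z} *)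
Definition tangent_to_id phi : Prop :=
  exists c : nat -> R[i], [/\ c 0%N = 0, c 1%N = 1 &
    \forall z \near (0 : R[i]), series (fun n => c n * z ^+ n) @ \oo --> phi z].

Definition inverse_germ phi (psi : R[i] -> R[i]) : Prop :=
  \forall z \near (0 : R[i]), psi (phi z) = z /\ phi (psi z) = z.

(* the germ at 0 of f is phi^-1 (e^z * phi z) *)
Definition exp_conjugate (f : R[i] -> R[i]) phi : Prop :=
  exists2 psi, inverse_germ phi psi &
    \forall z \near (0 : R[i]), f z = psi (cexp z * phi z).

End Complex.

Section ComplexMeasure.
Variable R : realType.
Implicit Types U S V : set R[i].

Let mu2 := (@lebesgue_measure R \x @lebesgue_measure R)%E.

Definition plane_set U : set (R * R) := [set p | U (p.1 +i* p.2)].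

Definition area U : R := fine (mu2 (plane_set U)).

Definition center_of_mass U : R[i] :=
  (Rintegral mu2 (plane_set U) fst / area U) +i*
  (Rintegral mu2 (plane_set U) snd / area U).

Definition complex_measure U : R[i] := (area U)%:C * center_of_mass U.

Definition eps_nbhd S (e : R) : set R[i] :=
  [set w | exists2 u, S u & `|w - u| < e%:C].

Definition forward_orbit (F : R[i] -> R[i]) (z : R[i]) : set R[i] :=
  range (fun n => iter n F z).

Definition principal_part (F : R[i] -> R[i]) V (H : R[i] -> R[i]) : Prop :=
  exists q1 q2 : R[i], forall z, V z ->
    (fun e : R => complex_measure (eps_nbhd (forward_orbit F z) e)
      - (q1 * (e ^+ 2 * ln e)%:C + H z * (e ^+ 2)%:C
         + q2 * (e `^ (5 / 2) * ln e)%:C))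
    =O_ (0^'+) (fun e : R => (e `^ (5 / 2))%:C).

End ComplexMeasure.

Section Petal.
Variable R : realType.

(* A petal V of opening angle 2 pi at 0 of the map F, centered at the direction
   a + pi. Every sector of smaller opening is in V near 0, and V does not meet
   the opposite ray, of direction a, so that Log a is defined on V. The last
   condition, that V is connected near 0, excludes further pieces of V close to
   the opposite ray, joined to the sectors only far from 0: the germ at 0 of V
   does not determine the values there of an analytic function on V. *)
Definition petal (F : R[i] -> R[i]) (a : R) (V : set R[i]) : Prop :=
  [/\ open V,
      forall z, V z -> V (F z),
      forall z, V z -> (fun n => iter n F z) @ \oo --> (0 : R[i]) &
   [/\ forall theta : R, 0 < theta < pi ->
        exists2 delta : R, 0 < delta &
          forall r t : R, 0 < r < delta -> `|t - (a + pi)| < theta ->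
            V (r%:C * cis t),
      forall z, V z -> exists r t : R,
        [/\ 0 < r, a < t < a + 2 * pi & z = r%:C * cis t] &
      forall W : set R[i], nbhs (0 : R[i]) W ->
        exists N : set R[i],
          [/\ nbhs (0 : R[i]) N, N `<=` W & connected (V `&` N)]]].

End Petal.

(* Main.v *)
Require Import Defs.
From HB Require Import structures.
From mathcomp Require Import all_boot all_order all_algebra.
From mathcomp Require Import all_classical all_reals all_analysis.
From mathcomp Require Import ring lra measurable_realfun.
Set Implicit Arguments.
Unset Strict Implicit.
Unset Printing Implicit Defensive.
Import Order.TTheory GRing.Theory Num.Theory.
Import numFieldNormedType.Exports.
Local Open Scope classical_set_scope.
Local Open Scope ring_scope.
Local Open Scope complex_scope.

(* Write F for f or its inverse, s = 1 or s = -1 accordingly, so that F z = z + s z^2 + z^3 + O(z^4), and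
   a = 0 or a = - pi for the direction of the cut. In the coordinate w = - s / z the map F is w + 1 + O(1 / w^2),
   so the orbit of z satisfies n z_n -> - s and z_(n+1) - z_n ~ s / n^2, and the sums of z_k for k < n, corrected
   by - s Log z_n, converge to some C1(z).

   For e_N = 1 / (2 N^2) the e_N-neighborhood of the orbit is, up to negligible terms, a disjoint union over n of
   the disc at z_n minus the disc at z_(n-1): whole discs for n < N, lunes whose area depends on the distance
   of the centers for N <= n < T N, and a remainder of relative size 1 / T^2. Comparing with integrals gives the
   coefficient of e^2, namely H(z) = pi C1(z) + i s pi (a + pi) - s pi / 4. Consequently H (F z) = H z - pi z, and
   H + s pi Log_a tends to a constant along every orbit.

   Let phi conjugate, that is phi (f z) = e^z phi z. The explicit function G built from Log phi satisfies the same
   two properties in a small horodisc, which every orbit enters; so H = G there, H - G being invariant and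
   tending to 0 along orbits. As H = G o F^n + pi (z + F z + ... + F^(n-1) z) is analytic, the identity spreads to
   the connected set where the petal meets a neighborhood of 0. Conversely, if h glues the two functions, then
   phi z = z exp (- (h z + pi / 4) / pi) satisfies phi (f z) = e^z phi z along an orbit in V_+, hence near 0 by
   isolation of zeros; h 0 = - pi / 4 makes phi tangent to the identity, hence locally invertible. *)

(** * Complex modulus and limits *)

(** The expansion of the complex measure is a hypothesis with unknown [q1] and [q2], so [H] has only
    to be read off along one sequence of radii. With [e_N = 1 / (2 N^2)] the distance [1 / n^2] of
    consecutive centers divided by the diameter is [(N / n)^2], and the lunes form a Riemann sum of
    mesh [1 / N]. Its limit is [pi / 4 + (pi / 2) ln 2]; the [ln 2] cancels against the one in
    [ln e_N], which leaves the constant [pi / 4], while [i pi^2] is [pi Log (-1)] for the branch on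
    [V_+]. The delicate point is that a disc may meet older discs only inside its immediate
    predecessor. The relative error eta of the increments could spoil this when [n] is large
    compared with [N], hence the cut at [T N]: [T] is chosen first, then eta at most of order
    [1 / T^2], then [N]; beyond the cut an upper bound is enough. The cubic coefficient 1 is shared
    by [f] and its inverse and removes the [1 / w] term from the Abel coordinate. For the inverse
    the germ [e^z phi] takes the place of [phi], which produces the summand [pi z]. *)

Notation cabs := (@Normc.normc _).

Section ComplexBasics.
Variable R : realType.
Implicit Types (z w : R[i]) (x y e : R).

Lemma normrE_cabs z : `|z| = (cabs z)%:C.
Proof. by []. Qed.

Lemma cabs_ge0 z : 0 <= cabs z.
Proof. by case: z => a b; exact: sqrtr_ge0. Qed.

Lemma cabs0 : cabs (0 : R[i]) = 0.
Proof. exact: Normc.normc0. Qed.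

Lemma cabs1 : cabs (1 : R[i]) = 1.
Proof. exact: Normc.normc1. Qed.

Lemma cabs_eq0 z : (cabs z == 0) = (z == 0).
Proof. by apply/eqP/eqP => [|->]; [exact: Normc.eq0_normc|exact: cabs0]. Qed.

Lemma cabs_gt0 z : (0 < cabs z) = (z != 0).
Proof. by rewrite lt_neqAle cabs_ge0 andbT eq_sym cabs_eq0. Qed.

Lemma cabsM z w : cabs (z * w) = cabs z * cabs w.
Proof. exact: Normc.normcM. Qed.

Lemma cabsV z : cabs z^-1 = (cabs z)^-1.
Proof. exact: Normc.normcV. Qed.

Lemma cabsN z : cabs (- z) = cabs z.
Proof. exact: normcN. Qed.

Lemma cabsX z (n : nat) : cabs (z ^+ n) = cabs z ^+ n.
Proof. by elim: n => [|n IH]; rewrite ?expr0 ?cabs1// !exprS cabsM IH. Qed.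

Lemma cabsD z w : cabs (z + w) <= cabs z + cabs w.
Proof. exact: le_normcD. Qed.

Lemma cabsB z w : cabs (z - w) <= cabs z + cabs w.
Proof. by rewrite -(cabsN w) cabsD. Qed.

Lemma cdistC z w : cabs (z - w) = cabs (w - z).
Proof. by rewrite -cabsN opprB. Qed.

Lemma cdist_triangle (u z w : R[i]) : cabs (z - w) <= cabs (z - u) + cabs (u - w).
Proof. by apply: le_trans (cabsD _ _); rewrite addrA subrK. Qed.

Lemma cabsB_ge z w : cabs z - cabs w <= cabs (z - w).
Proof. by rewrite lerBlDr; apply: le_trans (cabsD _ _); rewrite subrK. Qed.

Lemma cabs_real x : cabs x%:C = `|x|.
Proof. by rewrite /= expr0n addr0 sqrtr_sqr. Qed.

Lemma cabs_nat (n : nat) : cabs (n%:R : R[i]) = n%:R.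
Proof. by rewrite -[n%:R](rmorph_nat (real_complex R)) cabs_real normr_nat. Qed.

Lemma cabs_sum (I : Type) (r : seq I) (P : pred I) (F : I -> R[i]) :
  cabs (\sum_(i <- r | P i) F i) <= \sum_(i <- r | P i) cabs (F i).
Proof.
elim/big_rec2 : _ => [|i y z _ h]; first by rewrite cabs0.
by apply: le_trans (cabsD _ _) _; rewrite lerD2l.
Qed.

Lemma Re_le_cabs z : `|complex.Re z| <= cabs z.
Proof. by case: z => a b /=; rewrite -sqrtr_sqr ler_wsqrtr// lerDl sqr_ge0. Qed.

Lemma Im_le_cabs z : `|complex.Im z| <= cabs z.
Proof. by case: z => a b /=; rewrite -sqrtr_sqr ler_wsqrtr// lerDr sqr_ge0. Qed.

Lemma cabs_le_sum z : cabs z <= `|complex.Re z| + `|complex.Im z|.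
Proof.
case: z => a b /=; rewrite -[leRHS]ger0_norm ?addr_ge0// -sqrtr_sqr ler_wsqrtr//.
rewrite sqrrD !real_normK ?num_real//.
by have := mulr_ge0 (normr_ge0 a) (normr_ge0 b); lra.
Qed.

Lemma Re_mulr z x : complex.Re (z * x%:C) = complex.Re z * x.
Proof. by case: z => a b /=; rewrite mulr0 subr0. Qed.

Lemma Im_mulr z x : complex.Im (z * x%:C) = complex.Im z * x.
Proof. by case: z => a b /=; rewrite mulr0 add0r. Qed.

Lemma sqr_cabs z : cabs z ^+ 2 = complex.Re z ^+ 2 + complex.Im z ^+ 2.
Proof. by case: z => a b /=; rewrite sqr_sqrtr// addr_ge0// sqr_ge0. Qed.

Lemma cabs_lt_sqr z e : 0 < e -> (cabs z < e) = (complex.Re z ^+ 2 + complex.Im z ^+ 2 < e ^+ 2).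
Proof. by move=> e0; rewrite -sqr_cabs ltr_pXn2r// ?nnegrE ?cabs_ge0// ltW. Qed.

Lemma nbhs_cabsP (l : R[i]) (A : set R[i]) :
  nbhs l A <-> exists2 e : R, 0 < e & forall w, cabs (w - l) < e -> A w.
Proof.
split.
  move=> /nbhs_ballP[e /= e0 H].
  have eE : e = (complex.Re e)%:C by rewrite RRe_real// gtr0_real.
  exists (complex.Re e); first by move: e0; rewrite eE ltcR.
  by move=> w we; apply: H; rewrite -ball_normE /= distrC eE normrE_cabs ltcR.
move=> [e e0 H]; apply/nbhs_ballP; exists e%:C; first by rewrite /= ltcR.
by move=> w; rewrite -ball_normE /= distrC normrE_cabs ltcR => h; exact: H.
Qed.

Lemma nbhs_cdist (l : R[i]) e : 0 < e -> \forall w \near l, cabs (w - l) < e.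
Proof. by move=> e0; apply/nbhs_cabsP; exists e. Qed.

Lemma nbhs_cabs e : 0 < e -> \forall w \near (0 : R[i]), cabs w < e.
Proof. by move=> e0; apply/nbhs_cabsP; exists e => // w; rewrite subr0. Qed.

Section Filter.
Context {T : Type} {F : set_system T} {FF : Filter F}.
Implicit Types u v : T -> R[i].

(* Convergence with real epsilons: the norm of R[i] takes its values in R[i]. *)
Definition ccvg u (l : R[i]) := forall e, 0 < e -> \forall n \near F, cabs (u n - l) < e.

Lemma ccvgP u (l : R[i]) : u @ F --> l <-> ccvg u l.
Proof.
split=> [h e e0|H A /nbhs_cabsP[e e0 HA]]; first exact: h (nbhs_cdist l e0).
by apply: filterS (H e e0) => n; exact: HA.
Qed.

Lemma ccvgD u v (l m : R[i]) : ccvg u l -> ccvg v m -> ccvg (fun n => u n + v n) (l + m).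
Proof.
move=> /ccvgP h1 /ccvgP h2; apply/ccvgP.
exact (@cvgD R[i] R[i] T F _ u v l m h1 h2).
Qed.

Lemma ccvgN u (l : R[i]) : ccvg u l -> ccvg (fun n => - u n) (- l).
Proof. by move=> h e e0; apply: filterS (h e e0) => n; rewrite -opprD cabsN. Qed.

Lemma ccvgB u v (l m : R[i]) : ccvg u l -> ccvg v m -> ccvg (fun n => u n - v n) (l - m).
Proof. by move=> h1 h2; exact: ccvgD h1 (ccvgN h2). Qed.

Lemma ccvgM u v (l m : R[i]) : ccvg u l -> ccvg v m -> ccvg (fun n => u n * v n) (l * m).
Proof.
move=> /ccvgP h1 /ccvgP h2; apply/ccvgP.
exact (@cvgM R[i] T F _ u v l m h1 h2).
Qed.

Lemma ccvgV u (l : R[i]) : l != 0 -> ccvg u l -> ccvg (fun n => (u n)^-1) (l^-1).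
Proof.
move=> l0 /ccvgP h1; apply/ccvgP.
exact (@cvgV R[i] T F _ u l l0 h1).
Qed.

Lemma ccvg_cst (l : R[i]) : ccvg (fun=> l) l.
Proof. by move=> e e0; apply: nearW => n; rewrite subrr cabs0. Qed.

Lemma ccvg_cabs u (l : R[i]) : ccvg u l -> (fun n => cabs (u n)) @ F --> cabs l.
Proof.
move=> H; apply/cvgrPdist_lt => e e0; apply: filterS (H e e0) => n; apply: le_lt_trans.
rewrite ler_norml (cdistC _ l).
have := cabsB_ge l (u n); have := cabsB_ge (u n) l; rewrite (cdistC l); lra.
Qed.

Lemma ccvg_Re u (l : R[i]) : ccvg u l -> (fun n => complex.Re (u n)) @ F --> complex.Re l.
Proof.
move=> H; apply/cvgrPdist_lt => e e0; apply: filterS (H e e0) => n; apply: le_lt_trans.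
by rewrite distrC -raddfB; exact: Re_le_cabs.
Qed.

Lemma ccvg_Im u (l : R[i]) : ccvg u l -> (fun n => complex.Im (u n)) @ F --> complex.Im l.
Proof.
move=> H; apply/cvgrPdist_lt => e e0; apply: filterS (H e e0) => n; apply: le_lt_trans.
by rewrite distrC -raddfB; exact: Im_le_cabs.
Qed.

Lemma ccvg_ReIm u (l : R[i]) : (fun n => complex.Re (u n)) @ F --> complex.Re l ->
  (fun n => complex.Im (u n)) @ F --> complex.Im l -> ccvg u l.
Proof.
move=> /cvgrPdist_lt h1 /cvgrPdist_lt h2 e e0.
have e2 : 0 < e / 2 by rewrite divr_gt0.
apply: filterS2 (h1 _ e2) (h2 _ e2) => n g1 g2.
apply: le_lt_trans (cabs_le_sum _) _.
by rewrite !raddfB/= (distrC (complex.Re _)) (distrC (complex.Im _)); lra.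
Qed.

Lemma ccvg_real (f : T -> R) x : f @ F --> x -> ccvg (fun n => (f n)%:C) x%:C.
Proof. by move=> h; apply: ccvg_ReIm => //=; exact: cvg_cst. Qed.

Lemma ccvg_squeeze u (l : R[i]) (b : T -> R) : (\forall n \near F, cabs (u n - l) <= b n) ->
  b @ F --> (0 : R) -> ccvg u l.
Proof.
move=> h /cvgrPdist_lt hb e e0; apply: filterS2 h (hb _ e0) => n h1.
by rewrite sub0r normrN; apply: le_lt_trans; apply: le_trans h1 _; exact: ler_norm.
Qed.

Lemma ccvg_near_eq u v (l : R[i]) : (\forall n \near F, u n = v n) -> ccvg u l -> ccvg v l.
Proof. by move=> h H e e0; apply: filterS2 h (H e e0) => n ->. Qed.

End Filter.

Arguments ccvg {T} F u l.

Lemma ccvg_unique {T : Type} {F : set_system T} {FF : ProperFilter F} (u : T -> R[i]) (l m : R[i]) :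
  ccvg F u l -> ccvg F u m -> l = m.
Proof.
move=> h1 h2; apply/eqP; rewrite -subr_eq0 -cabs_eq0; apply/negP => /negP d0.
have d : 0 < cabs (l - m) / 2 by rewrite divr_gt0// lt_neqAle cabs_ge0 eq_sym d0.
have [n [g1 g2]] := filter_ex (filterI (h1 _ d) (h2 _ d)).
have := cdist_triangle (u n) l m; rewrite (cdistC l (u n)); lra.
Qed.

Lemma Re_sum (I : Type) (r : seq I) (P : pred I) (F : I -> R[i]) :
  complex.Re (\sum_(i <- r | P i) F i) = \sum_(i <- r | P i) complex.Re (F i).
Proof. exact: raddf_sum. Qed.

Lemma Im_sum (I : Type) (r : seq I) (P : pred I) (F : I -> R[i]) :
  complex.Im (\sum_(i <- r | P i) F i) = \sum_(i <- r | P i) complex.Im (F i).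
Proof. exact: raddf_sum. Qed.

Lemma realC_sum (I : Type) (r : seq I) (P : pred I) (F : I -> R) :
  (\sum_(i <- r | P i) F i)%:C = \sum_(i <- r | P i) (F i)%:C :> R[i].
Proof. exact: rmorph_sum. Qed.

Lemma normal_series_cvg (u : nat -> R[i]) (b : nat -> R) : (forall n, cabs (u n) <= b n) ->
  cvgn (series b) -> exists l, ccvg \oo (series u) l.
Proof.
move=> ub cb.
have cRe : cvgn (series (fun n => complex.Re (u n))).
  apply: normed_cvg; apply: series_le_cvg cb => [n|n|n] //=.
  - exact: le_trans (cabs_ge0 (u n)) (ub n).
  - exact: le_trans (Re_le_cabs _) (ub n).
have cIm : cvgn (series (fun n => complex.Im (u n))).
  apply: normed_cvg; apply: series_le_cvg cb => [n|n|n] //=.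
  - exact: le_trans (cabs_ge0 (u n)) (ub n).
  - exact: le_trans (Im_le_cabs _) (ub n).
exists (limn (series (fun n => complex.Re (u n))) +i* limn (series (fun n => complex.Im (u n)))).
apply: ccvg_ReIm => /=.
  suff -> : (fun n => complex.Re (series u n)) = series (fun n => complex.Re (u n)) by [].
  by apply/funext => n; rewrite /series/= Re_sum.
suff -> : (fun n => complex.Im (series u n)) = series (fun n => complex.Im (u n)) by [].
by apply/funext => n; rewrite /series/= Im_sum.
Qed.

End ComplexBasics.

Arguments ccvg {R T} F u l.

(** * The overlap of two discs and its logarithmic integral *)
Section RealCalculus.
Context {R : realType}.
Implicit Types (f g df : R -> R) (x u v s t : R).

Lemma is_derive_continuous f (x d : R) :
  is_derive x 1 f d -> {for x, continuous f}.
Proof. by move=> [df _]; apply/differentiable_continuous/derivable1_diffP. Qed.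

Lemma mvt_open f df (a b : R) : a < b ->
  (forall x, a < x < b -> is_derive x 1 f (df x)) ->
  (forall x, a <= x <= b -> {for x, continuous f}) ->
  exists2 c, a < c < b & f b - f a = df c * (b - a).
Proof.
move=> ab fd fc.
have H1 x : x \in `]a, b[%R -> is_derive x 1 f (df x) by rewrite in_itv/=; exact: fd.
have H2 : {within `[a, b], continuous f}.
  by apply: continuous_in_subspaceT => x; rewrite inE/= in_itv/=; exact: fc.
have [c cab E] := MVT ab H1 H2.
by exists c => //; move: cab; rewrite in_itv.
Qed.

Lemma mvt_closed f df (a b : R) : a <= b ->
  (forall x, a <= x <= b -> is_derive x 1 f (df x)) ->
  exists2 c, a <= c <= b & f b - f a = df c * (b - a).
Proof.
rewrite le_eqVlt => /orP[/eqP -> fd|ab fd].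
  by exists b; rewrite ?lexx// !subrr mulr0.
have [||c cab E] := @mvt_open f df a b ab.
- by move=> x /andP[ax xb]; apply: fd; rewrite !ltW.
- by move=> x xab; apply: is_derive_continuous; exact: fd.
by exists c => //; case/andP: cab => ? ?; rewrite !ltW.
Qed.

Lemma derive0_constant f (a b : R) : a < b ->
  (forall x, a < x < b -> is_derive x 1 f 0) ->
  (forall x, a <= x <= b -> {for x, continuous f}) -> f b = f a.
Proof.
move=> ab fd fc; have [c _ /eqP] := mvt_open ab fd fc.
by rewrite mul0r subr_eq0 => /eqP.
Qed.

(** Integrating from a base point [a < 0] keeps 0 interior to the domain, so that the primitive,
    normalized at 0, has a two-sided derivative there. *)
Lemma primitive_exists f (a : R) : continuous f -> a < 0 ->
  exists2 P : R -> R, P 0 = 0 & forall x, a < x -> is_derive x 1 P (f x).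
Proof.
move=> cf a0.
pose F x := (\int[lebesgue_measure]_(t in [set` `[a, x]]) f t)%R.
exists (fun x => F x - F 0); first by rewrite subrr.
move=> x ax.
have xx : x < x + 1 by rewrite ltrDl.
have intf : lebesgue_measure.-integrable `[a, (x + 1)] (EFin \o f).
  apply: continuous_compact_integrable; first exact: segment_compact.
  exact: continuous_subspaceT.
have [dF F'] := continuous_FTC1_closed xx intf ax (cf x).
have dFx : is_derive x 1 F (f x).
  by rewrite -F' derive1E; exact: derivableP.
have := @is_deriveB R _ _ F (cst (F 0)) x 1 _ _ dFx (is_derive_cst (F 0) x 1).
by rewrite subr0.
Qed.

(** Half the chord of the unit disc at distance [v] from its center. [Num.sqrt] vanishes on negative
    reals, hence the value 0 outside the disc and continuity everywhere. *)
Definition half_chord (v : R) : R := Num.sqrt (1 - v ^+ 2).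

Lemma half_chord_continuous : continuous half_chord.
Proof.
move=> x; rewrite /half_chord.
apply: (@continuous_comp _ _ _ (fun v : R => 1 - v ^+ 2) Num.sqrt); last exact: sqrt_continuous.
apply: continuousB; first exact: cvg_cst.
exact: exprn_continuous.
Qed.

Lemma half_chord_ge0 v : 0 <= half_chord v.
Proof. exact: sqrtr_ge0. Qed.

Lemma half_chord_le1 v : half_chord v <= 1.
Proof. by rewrite /half_chord -[leRHS]sqrtr1 ler_wsqrtr// gerBl sqr_ge0. Qed.

Lemma half_chord0 v : 1 <= `|v| -> half_chord v = 0.
Proof.
move=> v1; apply: ler0_sqrtr; rewrite subr_le0 -real_normK ?num_real//.
by rewrite -[1]mulr1 expr2 ler_pM.
Qed.

Lemma half_chordN v : half_chord (- v) = half_chord v.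
Proof. by rewrite /half_chord sqrrN. Qed.

Lemma half_chord_sin t : half_chord (sin t) = `|cos t|.
Proof. by rewrite /half_chord -cos2sin2 sqrtr_sqr. Qed.

(* [crescent (d / 2)] is the area of a unit disc minus its translate by d; only arguments > -10
   are meaningful. *)
Definition crescent : R -> R :=
  xget (fun=> 0) [set P : R -> R | P 0 = 0 /\ forall x : R, -10 < x -> is_derive x 1 P (4 * half_chord x)].

Lemma crescentP : crescent 0 = 0 /\ forall x : R, -10 < x -> is_derive x 1 crescent (4 * half_chord x).
Proof.
rewrite /crescent; case: xgetP => [P _ //|H]; exfalso.
have c4 : continuous (fun x => 4 * half_chord x).
  by move=> x; apply: cvgM; [exact: cvg_cst|exact: half_chord_continuous].
have a0 : -10 < 0 :> R by rewrite oppr_lt0.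
have [P P0 Pd] := primitive_exists c4 a0.
exact: (H P (conj P0 Pd)).
Qed.

Lemma crescent0 : crescent 0 = 0. Proof. by case: crescentP. Qed.

Lemma is_derive_crescent x : -10 < x -> is_derive x 1 crescent (4 * half_chord x).
Proof. by case: crescentP => _; apply. Qed.

Lemma crescent_continuous x : -10 < x -> {for x, continuous crescent}.
Proof. by move/is_derive_crescent; exact: is_derive_continuous. Qed.

(** In the angle [t] both sides have derivative [4 (cos t)^2], and both vanish at 0. *)
Lemma crescent_sin t : 0 <= t <= pi / 2 -> crescent (sin t) = 2 * (t + sin t * cos t).
Proof.
move=> /andP[]; rewrite le_eqVlt => /orP[/eqP <- _|t0 t2].
  by rewrite sin0 crescent0 mul0r addr0 mulr0.
pose f s := crescent (sin s) - 2 * (s + sin s * cos s).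
have sin10 s : -10 < sin s by apply: lt_le_trans (sin_geN1 s); lra.
suff : f t = f 0.
  by rewrite /f sin0 crescent0 mul0r addr0 mulr0 subrr => /eqP; rewrite subr_eq0 => /eqP.
have fd s : 0 <= s <= t -> is_derive s 1 f 0.
  move=> /andP[s0 st].
  have c0 : 0 <= cos s by apply: cos_ge0_pihalf; rewrite (le_trans st t2) andbT (le_trans _ s0)// oppr_le0 divr_ge0// pi_ge0.
  have d1 : is_derive s 1 (fun s => crescent (sin s)) (4 * half_chord (sin s) * cos s).
    exact: (is_derive1_comp (is_derive_crescent (sin10 s)) (is_derive_sin s)).
  rewrite /f; apply: is_derive_eq.
  rewrite half_chord_sin ger0_norm//= /GRing.scale/=.
  have := cos2Dsin2 s; nra.
apply: derive0_constant => //.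
  by move=> x /andP[x0 xt]; apply: fd; rewrite !ltW.
by move=> x xt; apply: is_derive_continuous; exact: fd.
Qed.

Lemma crescent1 : crescent 1 = pi.
Proof.
rewrite -sin_pihalf crescent_sin; last by rewrite lexx andbT divr_ge0// pi_ge0.
by rewrite cos_pihalf mulr0 addr0 mulrC divfK// pnatr_eq0.
Qed.

Lemma crescent_ge1 u : 1 <= u -> crescent u = pi.
Proof.
move=> u1; rewrite -crescent1.
have [|c /andP[c1 _] /eqP] := @mvt_closed crescent (fun x => 4 * half_chord x) 1 u u1.
  by move=> x /andP[x1 _]; apply: is_derive_crescent; lra.
by rewrite half_chord0 ?mulr0 ?mul0r ?subr_eq0 ?ger0_norm ?(le_trans _ c1)//; move=> /eqP.
Qed.

Lemma crescent_bounds u : 0 <= u -> 0 <= crescent u <= 4 * u.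
Proof.
move=> u0.
have [|c /andP[c1 _]] := @mvt_closed crescent (fun x => 4 * half_chord x) 0 u u0.
  by move=> x /andP[x1 _]; apply: is_derive_crescent; lra.
rewrite crescent0 !subr0 => ->.
rewrite !mulr_ge0 ?half_chord_ge0//= ler_wpM2r// ger_pMr//.
exact: half_chord_le1.
Qed.

Lemma crescent_nondecreasing u v : -10 < u -> u <= v -> crescent u <= crescent v.
Proof.
move=> u0 uv.
have [|c /andP[c1 _] E] := @mvt_closed crescent (fun x => 4 * half_chord x) u v uv.
  by move=> x /andP[x1 _]; apply: is_derive_crescent; lra.
by rewrite -subr_ge0 E !mulr_ge0 ?half_chord_ge0// subr_ge0.
Qed.

Lemma crescent_le_pi u : 0 <= u -> crescent u <= pi.
Proof.
move=> u0; have [u1|/ltW u1] := leP 1 u; first by rewrite crescent_ge1.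
by rewrite -crescent1 crescent_nondecreasing//; lra.
Qed.

Lemma crescentN u : -10 < u < 10 -> crescent (- u) = - crescent u.
Proof.
move=> /andP[u1 u2].
pose f x := crescent x + crescent (- x).
have fd x : -10 < x < 10 -> is_derive x 1 f 0.
  move=> /andP[x1 x2].
  have d1 := is_derive_crescent x1.
  have d2 : is_derive (- x) 1 crescent (4 * half_chord (- x)).
    by apply: is_derive_crescent; lra.
  have d3 := is_derive1_comp d2 (@is_deriveNid R R x 1).
  have := is_deriveD d1 d3.
  by rewrite half_chordN mulrN1 subrr.
suff : f u = 0 by rewrite /f => /eqP; rewrite addrC addr_eq0 => /eqP.
have f0 : f 0 = 0 by rewrite /f oppr0 crescent0 addr0.
have cst a b : -10 < a -> b < 10 -> a < b -> f b = f a.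
  move=> a1 b1 ab; apply: derive0_constant => //.
    by move=> x /andP[? ?]; apply: fd; lra.
  by move=> x /andP[? ?]; apply: is_derive_continuous; apply: fd; lra.
case: (ltgtP u 0) => [u0|u0|->//]; first by rewrite -f0; apply/esym/cst.
by rewrite -f0; apply: cst.
Qed.

(** The quotient is completed by its limit 4, the derivative of [crescent] at 0, and kept constant
    to the left, so that it is continuous on the whole line and has a primitive. *)
Definition crescent_ratio (v : R) : R := if v <= 0 then 4 else crescent v / v.

Lemma crescent_ratio_continuous : continuous crescent_ratio.
Proof.
move=> x; have [x0|x0|->] := ltgtP x 0.
- have E : crescent_ratio x = 4 by rewrite /crescent_ratio ltW.
  have : (4 : R) @[y --> x] --> crescent_ratio x by rewrite E; exact: cvg_cst.
  apply: cvg_trans; apply: near_eq_cvg; near=> y.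
  by rewrite /crescent_ratio ifT//; apply/ltW; near: y; exact: lt_nbhsl.
- have E : crescent_ratio x = crescent x / x by rewrite /crescent_ratio leNgt x0.
  have : crescent y / y @[y --> x] --> crescent_ratio x.
    rewrite E; apply: cvgM; first by apply: crescent_continuous; lra.
    by apply: cvgV; [rewrite gt_eqF|exact: cvg_id].
  apply: cvg_trans; apply: near_eq_cvg; near=> y.
  rewrite /crescent_ratio ifF//; apply/negbTE; rewrite -ltNge; near: y; exact: lt_nbhsr.
- have c0 : 4 * half_chord y @[y --> (0 : R)] --> 4 * half_chord 0.
    by apply: cvgM; [exact: cvg_cst|exact: half_chord_continuous].
  have h0 : half_chord (0 : R) = 1 by rewrite /half_chord expr0n subr0 sqrtr1.
  rewrite h0 mulr1 in c0.
  apply/cvgrPdist_lt => e e0.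
  move/cvgrPdist_lt: c0 => /(_ e e0) /nbhs_ballP[d d0 H].
  apply/nbhs_ballP; exists d => // y; rewrite /ball/= sub0r normrN => yd.
  rewrite {1}/crescent_ratio lexx /crescent_ratio; case: ifPn => [_|]; first by rewrite subrr normr0.
  rewrite -ltNge => y0.
  have [|c /andP[c1 c2]] := @mvt_closed crescent (fun x => 4 * half_chord x) 0 y (ltW y0).
    by move=> z /andP[z1 _]; apply: is_derive_crescent; lra.
  rewrite crescent0 !subr0 => ->; rewrite mulfK ?gt_eqF//.
  apply: H; rewrite /ball/= sub0r normrN ger0_norm// (le_lt_trans c2)//.
  by rewrite (le_lt_trans _ yd)// ler_norm.
Unshelve. all: by end_near.
Qed.

Lemma crescent_ratio_bounds v : 0 <= v -> 0 <= crescent_ratio v <= 4.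
Proof.
rewrite /crescent_ratio => v0; case: ifPn; first by rewrite ler0n lexx.
rewrite -ltNge => v1; have /andP[c1 c2] := crescent_bounds v0.
by rewrite divr_ge0// ler_pdivrMr.
Qed.

(** With [v = x^-2], [crescent_log 1] is the integral of [crescent (x^-2) / x] over [x > 1]: the
    continuous form of the sum, over the overlapping discs, of the new area times [1 / n]. *)
Definition crescent_log : R -> R :=
  xget (fun=> 0) [set P : R -> R | P 0 = 0 /\ forall x : R, -10 < x -> is_derive x 1 P (crescent_ratio x / 2)].

Lemma crescent_logP : crescent_log 0 = 0 /\
  forall x : R, -10 < x -> is_derive x 1 crescent_log (crescent_ratio x / 2).
Proof.
rewrite /crescent_log; case: xgetP => [P _ //|H]; exfalso.
have c4 : continuous (fun x => crescent_ratio x / 2).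
  by move=> x; apply: cvgM; [exact: crescent_ratio_continuous|exact: cvg_cst].
have a0 : -10 < 0 :> R by rewrite oppr_lt0.
have [P P0 Pd] := primitive_exists c4 a0.
exact: (H P (conj P0 Pd)).
Qed.

Lemma crescent_log_bounds u : 0 <= u -> 0 <= crescent_log u <= 2 * u.
Proof.
have [P0 Pd] := crescent_logP; move=> u0.
have [|c /andP[c1 _]] := @mvt_closed crescent_log (fun x => crescent_ratio x / 2) 0 u u0.
  by move=> x /andP[x1 _]; apply: Pd; lra.
rewrite P0 !subr0 => ->; have /andP[r0 r4] := crescent_ratio_bounds c1.
by rewrite !mulr_ge0//= ler_wpM2r// ler_pdivrMr// -natrM.
Qed.

(* [t |-> crescent_log (sin t) - (t + sin t * cos t) / 2] is the primitive of [t cot t] vanishing at 0,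
   and its value at pi / 2 follows from the duplication formula of the cotangent. *)
Lemma crescent_log1 : crescent_log 1 = pi / 4 + pi / 2 * ln 2.
Proof.
have [P0 Pd] := crescent_logP.
have pi0 : 0 < pi :> R := pi_gt0 R.
have sin10 s : -10 < sin s by apply: lt_le_trans (sin_geN1 s); lra.
pose Th t := crescent_log (sin t) - 2^-1 * (t + sin t * cos t).
have dTh0 t : is_derive t 1 Th (crescent_ratio (sin t) / 2 * cos t - 2^-1 * (1 + (cos t ^+ 2 - sin t ^+ 2))).
  have d1 : is_derive t 1 (fun s => crescent_log (sin s)) (crescent_ratio (sin t) / 2 * cos t).
    exact: (is_derive1_comp (Pd _ (sin10 t)) (is_derive_sin t)).
  rewrite /Th; apply: is_derive_eq; rewrite /GRing.scale/=; ring.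
have cTh t : {for t, continuous Th} by exact: is_derive_continuous (dTh0 t).
have dTh t : 0 < t <= pi / 2 -> is_derive t 1 Th (t * cos t / sin t).
  move=> /andP[t0 t1]; apply: is_derive_eq.
  have st : 0 < sin t by apply: sin_gt0_pi; rewrite t0/=; lra.
  rewrite /crescent_ratio ifF; last by apply/negbTE; rewrite -ltNge.
  rewrite crescent_sin; last by rewrite (ltW t0).
  rewrite (sin2cos2 t); field; by rewrite gt_eqF.
have cospos s : 0 <= s <= pi / 4 -> 0 < cos s.
  by move=> /andP[s0 s1]; apply: cos_gt0_pihalf; lra.
(* The identity [2 cot (2 s) = cot s - tan s] makes [Y] constant, the logarithm absorbing the
   [pi / 2] in the third argument. At [pi / 4] the two middle terms cancel, so comparison with 0
   gives [Th (pi / 2) = (pi / 2) ln 2]. *)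
pose Y s := Th (s *+ 2) - 2 * Th s + 2 * Th (pi / 2 - s) - pi * ln (cos s).
have cY s : 0 <= s <= pi / 4 -> {for s, continuous Y}.
  move=> hs; rewrite /Y; apply: cvgB; [apply: cvgD; [apply: cvgB|]|].
  - apply: (@continuous_comp _ _ _ (fun x => x *+ 2) Th); last exact: cTh.
    exact: cvgMn.
  - by apply: cvgM; [exact: cvg_cst|exact: cTh].
  - apply: cvgM; [exact: cvg_cst|].
    apply: (@continuous_comp _ _ _ (fun x => pi / 2 - x) Th); last exact: cTh.
    by apply: cvgB; [exact: cvg_cst|exact: cvg_id].
  - apply: cvgM; [exact: cvg_cst|].
    exact: (is_derive_continuous (is_derive1_comp (is_derive1_ln (cospos s hs)) (is_derive_cos s))).
have dY s : 0 < s < pi / 4 -> is_derive s 1 Y 0.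
  move=> /andP[s0 s1].
  have cs : 0 < cos s by apply: cospos; lra.
  have ss : 0 < sin s by apply: sin_gt0_pi; lra.
  have d0 : is_derive s 1 (fun x : R => x *+ 2) (2 : R).
    by apply: is_derive_eq.
  have d1 : is_derive s 1 (fun x => Th (x *+ 2)) (s *+ 2 * cos (s *+ 2) / sin (s *+ 2) * 2).
    by apply: (is_derive1_comp _ d0); apply: dTh; lra.
  have d2 : is_derive s 1 Th (s * cos s / sin s) by apply: dTh; lra.
  have d3' : is_derive s 1 (fun x => pi / 2 - x) (- 1 : R).
    have := @is_deriveB R _ _ (cst (pi / 2)) id s 1 _ _ (is_derive_cst (pi / 2) s 1) (is_derive_id s 1).
    by rewrite sub0r.
  have d3 : is_derive s 1 (fun x => Th (pi / 2 - x)) ((pi / 2 - s) * cos (pi / 2 - s) / sin (pi / 2 - s) * (-1)).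
    by apply: (is_derive1_comp _ d3'); apply: dTh; lra.
  have d4 : is_derive s 1 (fun x => ln (cos x)) ((cos s)^-1 * - sin s).
    exact: (is_derive1_comp (is_derive1_ln cs) (is_derive_cos s)).
  rewrite /Y; apply: is_derive_eq; rewrite /GRing.scale/=.
  rewrite cosB sinB cos_pihalf sin_pihalf sin_mulr2n cos_mulr2n.
  have -> : cos s ^+ 2 *+ 2 - 1 = cos s ^+ 2 - sin s ^+ 2 by rewrite sin2cos2; ring.
  field; by rewrite !gt_eqF.
have Y0 : Y 0 = 2 * Th (pi / 2).
  by rewrite /Y mul0rn subr0 cos0 ln1 /Th sin0 P0; ring.
have pi4 : 0 < pi / 4 :> R by rewrite divr_gt0.
have c4 : cos (pi / 4) = (Num.sqrt 2)^-1 :> R.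
  have c0 : 0 < cos (pi / 4 : R) by apply: cospos; rewrite lexx ltW.
  have : cos (pi / 4) ^+ 2 = ((Num.sqrt 2)^-1) ^+ 2 :> R.
    rewrite exprVn sqr_sqrtr//.
    have := cos_mulr2n (pi / 4 : R); have -> : (pi / 4) *+ 2 = pi / 2 :> R by field.
    rewrite cos_pihalf => /eqP; rewrite eq_sym subr_eq0 => /eqP E.
    by apply: (@mulIf _ 2); rewrite ?pnatr_eq0// mulr_natr E mulVf ?pnatr_eq0.
  move=> /eqP; rewrite eqrXn2 ?(ltW c0) ?invr_ge0 ?sqrtr_ge0// => /eqP; exact.
have Y4 : Y (pi / 4) = Th (pi / 2) + pi / 2 * ln 2.
  rewrite /Y c4 lnV ?posrE ?sqrtr_gt0//.
  have -> : (pi / 4) *+ 2 = pi / 2 :> R by field.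
  have -> : pi / 2 - pi / 4 = pi / 4 :> R by field.
  have -> : ln (Num.sqrt 2) = ln 2 / 2 :> R.
    have := lnXn 2 (_ : 0 < Num.sqrt 2 :> R); rewrite sqr_sqrtr// sqrtr_gt0 ltr0n => /(_ isT) ->.
    by field.
  by field.
have := derive0_constant pi4 dY cY; rewrite Y0 Y4.
rewrite /Th sin_pihalf cos_pihalf mulr0 addr0 => E.
lra.
Qed.

(** The summand is [g (n / N) / N] for the decreasing function [g x = crescent (x^-2) / x], whose
    primitive is [- crescent_log (x^-2)]. For a monotone function the error of a Riemann sum is at
    most its first term, here [pi / N]. *)
Lemma crescent_riemann_sum (N T : nat) : (0 < N)%N -> (0 < T)%N ->
  `|\sum_(N <= n < T * N) crescent ((N%:R / n%:R) ^+ 2) / n%:R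
    - (crescent_log 1 - crescent_log (T%:R ^- 2))| <= pi / N%:R.
Proof.
have [P0 Pd] := crescent_logP; move=> N0 T0.
have rN : 0 < N%:R :> R by rewrite ltr0n.
have rT : 0 < T%:R :> R by rewrite ltr0n.
pose a n : R := crescent ((N%:R / n%:R) ^+ 2) / n%:R.
pose G x := - crescent_log (x ^- 2).
pose g x := crescent (x ^- 2) / x.
have dG x : 0 < x -> is_derive x 1 G (g x).
  move=> x0.
  have d1 : is_derive x 1 (fun x => x ^- 2) (- 2 * x ^- 3).
    have d0 : is_derive x 1 (fun x => x * x) (x + x).
      by apply: is_derive_eq; rewrite /GRing.scale/= mulr1.
    have x2 : x * x != 0 by rewrite mulf_neq0// gt_eqF.
    have -> : (fun x => x ^- 2) = (fun x => (x * x)^-1) by apply/funext => y; rewrite expr2.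
    have := @is_deriveV R (fun x => x * x) x _ 1 x2 d0.
    by move/is_derive_eq; apply; rewrite /GRing.scale/=; field; rewrite gt_eqF.
  have xp : 0 < x ^- 2 by rewrite invr_gt0 exprn_gt0.
  have x10 : -10 < x ^- 2 by rewrite (lt_trans _ xp)// oppr_lt0.
  have d2 := is_deriveN (@is_derive1_comp R crescent_log (fun x => x ^- 2) x _ _ (Pd _ x10) d1).
  apply: is_derive_eq.
  rewrite /crescent_ratio ifF; last by apply/negbTE; rewrite -ltNge.
  rewrite /g; field; by rewrite gt_eqF.
have g_ninc x y : 0 < x -> x <= y -> g y <= g x.
  move=> x0 xy; have y0 := lt_le_trans x0 xy.
  rewrite /g; apply: ler_pM.
  - have /crescent_bounds/andP[]// : 0 <= y ^- 2 by rewrite invr_ge0 exprn_ge0// ltW.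
  - by rewrite invr_ge0 ltW.
  - apply: crescent_nondecreasing.
      by rewrite (@lt_trans _ _ 0)// ?oppr_lt0// invr_gt0 exprn_gt0.
    by rewrite lef_pV2 ?posrE ?exprn_gt0// lerXn2r// nnegrE ltW.
  - by rewrite lef_pV2.
have aE n : (0 < n)%N -> a n = g (n%:R / N%:R) / N%:R.
  move=> n0; rewrite /a /g; have rn : 0 < n%:R :> R by rewrite ltr0n.
  have -> : (n%:R / N%:R) ^- 2 = (N%:R / n%:R) ^+ 2 :> R by field; rewrite !gt_eqF.
  by field; rewrite !gt_eqF.
have step n : (0 < n)%N -> a n.+1 <= G (n.+1%:R / N%:R) - G (n%:R / N%:R) <= a n.
  move=> n0; rewrite !aE//.
  have rn : 0 < n%:R / N%:R :> R by rewrite divr_gt0// ltr0n.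
  have le : n%:R / N%:R <= n.+1%:R / N%:R :> R by rewrite ler_pM2r ?invr_gt0// ler_nat.
  have [|c /andP[c1 c2] ->] := @mvt_closed G g _ _ le.
    by move=> x /andP[x1 x2]; apply: dG; exact: lt_le_trans x1.
  have -> : n.+1%:R / N%:R - n%:R / N%:R = N%:R^-1 :> R by rewrite -mulrBl -natrB// subSnn mul1r.
  have c0 := lt_le_trans rn c1.
  by rewrite !ler_pM2r ?invr_gt0//; apply/andP; split; apply: g_ninc.
have GT m : (N <= m)%N -> 0 <= \sum_(N <= n < m) a n - (G (m%:R / N%:R) - G 1) <= a N - a m.
  elim: m => [|m IH]; first by rewrite leqn0 => /eqP NE; rewrite NE in N0.
  rewrite leq_eqVlt => /orP[/eqP <-|]; first by rewrite big_geq// divff ?gt_eqF// !subrr lexx.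
  rewrite ltnS => Nm; rewrite big_nat_recr//=.
  have /andP[h1 h2] := IH Nm; have /andP[s1 s2] := step m (leq_trans N0 Nm).
  lra.
have aN : a N = pi / N%:R by rewrite /a divff ?gt_eqF// expr1n crescent1.
have a0 m : 0 <= a m.
  have /crescent_bounds/andP[? _] : 0 <= (N%:R / m%:R : R) ^+ 2 by exact: sqr_ge0.
  by rewrite /a divr_ge0.
have := GT (T * N)%N; rewrite leq_pmull// => /(_ isT) /andP[].
rewrite natrM mulfK ?gt_eqF// /G expr1n invr1 opprK => h1 h2.
rewrite -/a -aN ger0_norm.
  by have := a0 (T * N)%N; lra.
lra.
Qed.

End RealCalculus.

(** * Areas and first moments of discs *)
Section DiscAreas.
Context {R : realType}.
Implicit Types (a b c d e x y : R) (A B : set (R * R)).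

Notation mu1 := (@lebesgue_measure R).

Definition plane_measure : {measure set (measurableTypeR R * measurableTypeR R) -> \bar R} := (@lebesgue_measure R \x @lebesgue_measure R)%E.

Notation mu2 := plane_measure.

Lemma plane_measureE A : mu2 A = (\int[mu1]_x (mu1 \o xsection A) x)%E.
Proof. by []. Qed.

Local Opaque plane_measure.

Definition disc a b e : set (R * R) :=
  [set p | (p.1 - a) ^+ 2 + (p.2 - b) ^+ 2 < e ^+ 2].

Lemma measurable_disc a b e : measurable (disc a b e).
Proof.
pose f (p : R * R) : R := (p.1 - a) ^+ 2 + (p.2 - b) ^+ 2.
have mf : measurable_fun setT f.
  apply: measurable_funD; apply: measurable_funX; apply: measurable_funB => //; exact: measurable_cst.
have -> : disc a b e = setT `&` f @^-1` `]-oo, e ^+ 2[.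
  by rewrite setTI; apply/seteqP; split => p /=; rewrite /disc /= in_itv/=.
exact: mf.
Qed.

Definition chord a e x : R := e * half_chord ((x - a) / e).

Lemma chord_ge0 a e x : 0 < e -> 0 <= chord a e x.
Proof. by move=> e0; rewrite mulr_ge0 ?half_chord_ge0// ltW. Qed.

Lemma chord_eq0 a e x : 0 < e -> e <= `|x - a| -> chord a e x = 0.
Proof.
move=> e0 h; rewrite /chord half_chord0 ?mulr0// normrM normfV (ger0_norm (ltW e0)).
by rewrite ler_pdivlMr// mul1r.
Qed.

Lemma chordE a e x : 0 < e -> chord a e x = Num.sqrt (e ^+ 2 - (x - a) ^+ 2).
Proof.
move=> e0; rewrite /chord /half_chord -[in LHS](ger0_norm (ltW e0)) -sqrtr_sqr -sqrtrM ?sqr_ge0//.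
rewrite sqrtr_sqr (ger0_norm (ltW e0)); congr Num.sqrt.
by field; rewrite gt_eqF.
Qed.

Lemma chord_le_chord a a' e x : 0 < e -> `|x - a| <= `|x - a'| -> chord a' e x <= chord a e x.
Proof.
move=> e0 h; rewrite !chordE// ler_wsqrtr// lerD2l lerN2.
by rewrite -[leLHS]real_normK ?num_real// -[leRHS]real_normK ?num_real// lerXn2r.
Qed.

Lemma xsection_disc a b e x : 0 < e ->
  xsection (disc a b e) x = `](b - chord a e x), (b + chord a e x)[%classic.
Proof.
move=> e0; apply/seteqP; split => y; rewrite /= in_itv/= /xsection/= inE /disc/=.
  move=> h; rewrite -ltr_distlC distrC chordE//.
  rewrite -sqrtr_sqr ltr_sqrt; first by lra.
  by have := sqr_ge0 (y - b); lra.
move=> h; have {h} : `|y - b| < chord a e x by rewrite distrC ltr_distlC.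
rewrite chordE// => h; have h0 : 0 < Num.sqrt (e ^+ 2 - (x - a) ^+ 2) by exact: le_lt_trans h.
rewrite sqrtr_gt0 in h0; rewrite -sqrtr_sqr ltr_sqrt// in h.
lra.
Qed.

Lemma mu1_itv c d : c <= d ->
  (mu1 `]c, d[%classic = (d - c)%:E)%E.
Proof.
move=> cd; rewrite lebesgue_measure_itv/= lte_fin.
by case: ltP => // dc; rewrite (@le_anti _ _ c d) ?subrr// cd.
Qed.

(** Cavalieri's principle: left of the midline [a + d / 2] the vertical section of the disc contains
    that of the translate and contributes the difference of the chords; right of it the inclusion is
    reversed and nothing remains. *)
Lemma mu2_disc_diff a b d e : 0 < e -> 0 <= d <= 2 * e ->
  mu2 (disc a b e `\` disc (a + d) b e) = (e ^+ 2 * crescent (d / (2 * e)))%:E.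
Proof.
move=> e0 /andP[d0 d2].
have m1 := measurable_disc a b e; have m2 := measurable_disc (a + d) b e.
pose psi x := 2 * (chord a e x - chord (a + d) e x).
have sec x : mu1 (xsection (disc a b e `\` disc (a + d) b e) x) =
    ((EFin \o psi) \_ `[(a - e), (a + d / 2)]) x.
  rewrite xsectionD !xsection_disc// patchE mem_setE in_itv/=.
  have h1 := chord_ge0 a x e0; have h2 := chord_ge0 (a + d) x e0.
  have [x1|x1] := leP (a - e) x => /=; last first.
    rewrite (@chord_eq0 a)//; last by rewrite ler0_norm; lra.
    by rewrite addr0 subr0 set_itvoo0 set0D measure0.
  have [x2|x2] := leP x (a + d / 2); last first.
    have h : chord a e x <= chord (a + d) e x.
      apply: chord_le_chord => //; have xa : 0 <= x - a by lra.
      rewrite (ger0_norm xa) ler_norml; lra.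
    rewrite (_ : _ `\` _ = set0) ?measure0//; apply/seteqP; split => // y /=.
    rewrite !in_itv/= => -[/andP[y1 y2]]; apply; lra.
  have h : chord (a + d) e x <= chord a e x.
    apply: chord_le_chord => //; have xa : x - (a + d) <= 0 by lra.
    rewrite (ler0_norm xa) ler_norml; lra.
  rewrite measureD//=; first last.
  - by rewrite -ge0_fin_numE//= lebesgue_measure_itv; case: ifP.
  rewrite setIidr; last by apply: subset_itv; rewrite bnd_simp; lra.
  rewrite !mu1_itv; [|lra|lra].
  by rewrite -EFinB /psi; congr EFin; ring.
rewrite plane_measureE; under eq_integral do rewrite /comp sec.
rewrite -integral_mkcond.
(* As [crescent] is a primitive of [4 * half_chord], the factor [e ^+ 2 / 2] gives twice the chord.
   Since [d <= 2 * e], the arguments stay at or above -3, inside the range where [crescent] is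
   meaningful. *)
pose F x := e ^+ 2 / 2 * (crescent ((x - a) / e) - crescent ((x - (a + d)) / e)).
have dF x : a - e <= x -> is_derive x 1 F (psi x).
  move=> ax.
  have lin c : is_derive x 1 (fun x => (x - c) / e) (e^-1).
    have := is_deriveB (is_derive_id x 1) (is_derive_cst c x 1) => hB.
    apply: is_derive_eq; rewrite /GRing.scale/=; field; by rewrite gt_eqF.
  have g c : c <= a + d -> is_derive x 1 (fun x => crescent ((x - c) / e)) (4 * half_chord ((x - c) / e) / e).
    move=> ca; have x10 : -10 < (x - c) / e by rewrite ltr_pdivlMr//; lra.
    exact: (@is_derive1_comp R crescent (fun x => (x - c) / e) x _ _ (is_derive_crescent x10) (lin c)).
  have g1 := g a; have g2 := g (a + d).
  have {}g1 : is_derive x 1 (fun x => crescent ((x - a) / e)) (4 * half_chord ((x - a) / e) / e) by apply: g1; lra.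
  have {}g2 : is_derive x 1 (fun x => crescent ((x - (a + d)) / e)) (4 * half_chord ((x - (a + d)) / e) / e) by apply: g2.
  rewrite /F; apply: is_derive_eq; rewrite /psi /chord /GRing.scale/=.
  by field; rewrite gt_eqF.
have cF x : a - e <= x -> {for x, continuous F} by move=> /dF; exact: is_derive_continuous.
rewrite (@continuous_FTC2 _ psi F); first last.
- by move=> x; rewrite in_itv/= => /andP[x1 _]; rewrite derive1E; have [_] := dF x (ltW x1).
- split.
  + by move=> x; rewrite in_itv/= => /andP[x1 _]; have [] := dF x (ltW x1).
  + by apply: cvg_at_right_filter; apply: cF; lra.
  + by apply: cvg_at_left_filter; apply: cF; lra.
- have cc c x : {for x, continuous (chord c e)}.
    apply: cvgM; first exact: cvg_cst.
    apply: (@continuous_comp _ _ _ (fun x => (x - c) / e) half_chord); last exact: half_chord_continuous.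
    by apply: cvgM; [apply: cvgB; [exact: cvg_id|exact: cvg_cst]|exact: cvg_cst].
  apply: continuous_subspaceT => x.
  by apply: cvgM; [exact: cvg_cst|apply: cvgB; exact: cc].
- lra.
rewrite -EFinB /F; congr EFin.
have -> : (a + d / 2 - a) / e = d / (2 * e) by field; rewrite gt_eqF.
have -> : (a + d / 2 - (a + d)) / e = - (d / (2 * e)) by field; rewrite gt_eqF.
have -> : (a - e - a) / e = - 1 by field; rewrite gt_eqF.
have -> : (a - e - (a + d)) / e = - (1 + d / e) by field; rewrite gt_eqF.
have de : 0 <= d / e <= 2 by rewrite divr_ge0 ?(ltW e0)//= ler_pdivrMr.
have d2e : 0 <= d / (2 * e) <= 1.
  by rewrite divr_ge0 ?mulr_ge0 ?(ltW e0)//= ler_pdivrMr ?mul1r ?mulr_gt0.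
rewrite !crescentN; [|lra|lra|lra].
rewrite (@crescent_ge1 _ (1 + d / e)) ?crescent1; last lra.
by field.
Qed.

(** A translate by the diameter is disjoint from the disc, so the lune of width [2 * e] is the whole
    disc. *)
Lemma mu2_disc a b e : 0 < e -> mu2 (disc a b e) = (pi * e ^+ 2)%:E.
Proof.
move=> e0; have := @mu2_disc_diff a b (2 * e) e e0.
rewrite divff ?gt_eqF ?mulr_gt0// crescent1 (mulrC pi) => <-; last lra.
congr (mu2 _); apply/seteqP; split => [p hp|p []//]; split => //; move: hp.
rewrite /disc/= => h1 h2.
have /ltr_pM2r : 0 < e by [].
have s1 : (p.1 - a) ^+ 2 < e ^+ 2 by have := sqr_ge0 (p.2 - b); lra.
have s2 : (p.1 - (a + 2 * e)) ^+ 2 < e ^+ 2 by have := sqr_ge0 (p.2 - b); lra.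
rewrite -ltr_sqrt ?exprn_gt0// !sqrtr_sqr (gtr0_norm e0) in s1.
rewrite -ltr_sqrt ?exprn_gt0// !sqrtr_sqr (gtr0_norm e0) in s2.
by move: s1 s2; rewrite !ltr_norml; lra.
Qed.

Lemma mu2_disc_diffC a b a' b' e : 0 < e ->
  mu2 (disc a b e `\` disc a' b' e) = mu2 (disc a' b' e `\` disc a b e).
Proof.
move=> e0; have m1 := measurable_disc a b e; have m2 := measurable_disc a' b' e.
have f1 : (mu2 (disc a b e) < +oo)%E by rewrite mu2_disc// ltry.
have f2 : (mu2 (disc a' b' e) < +oo)%E by rewrite mu2_disc// ltry.
rewrite [LHS](@measureD _ _ _ mu2 _ _ m1 m2 f1) [RHS](@measureD _ _ _ mu2 _ _ m2 m1 f2).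
by congr (_ - _)%E; [exact: etrans (mu2_disc a b e0) (esym (mu2_disc a' b' e0))|rewrite setIC].
Qed.

(** At each abscissa the two sections are intervals of equal length shifted by [b' - b], and the
    abscissas range over a segment of length [2 * e]. *)
Lemma mu2_disc_diff_vert a b b' e : 0 < e ->
  (mu2 (disc a b e `\` disc a b' e) <= (2 * e * `|b - b'|)%:E)%E.
Proof.
move=> e0.
have m1 := measurable_disc a b e; have m2 := measurable_disc a b' e.
rewrite plane_measureE.
apply: (@le_trans _ _ (\int[mu1]_x ((cst (`|b - b'|%:E) \_ `[(a - e)%R, (a + e)%R]) x))%E).
  apply: ge0_le_integral => //.
  - by apply: measurable_fun_xsection; exact: measurableD.
  - have mc : measurable_fun `[(a - e)%R, (a + e)%R] (cst (`|b - b'|%:E) : measurableTypeR R -> \bar R).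
      exact: measurable_cst.
    exact: (measurable_restrictT _ (measurable_itv _)).1 mc.
  move=> x _ /=; rewrite xsectionD !xsection_disc// patchE mem_setE in_itv/=.
  have h1 := chord_ge0 a x e0.
  have [xa|xa] := leP `|x - a| e; last first.
    rewrite chord_eq0 ?(ltW xa)// addr0 subr0 set_itvoo0 set0D measure0.
    by case: ifP.
  rewrite ifT; last by move: xa; rewrite ler_norml; lra.
  set h := chord a e x.
  have [bb|bb] := leP b b'.
    apply: (@le_trans _ _ (mu1 `](b - h), (b' - h)]%classic)).
      apply: le_measure; rewrite ?inE//; first exact: measurableD.
      move=> y /=; rewrite !in_itv/= => -[/andP[y1 y2] y3].
      rewrite y1/= leNgt; apply/negP => y4; apply: y3; lra.
    rewrite lebesgue_measure_itv/= lte_fin; case: ifP => _.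
      by rewrite -EFinB lee_fin ler0_norm; lra.
    by rewrite lee_fin.
  apply: (@le_trans _ _ (mu1 `[(b' + h), (b + h)[%classic)).
    apply: le_measure; rewrite ?inE//; first exact: measurableD.
    move=> y /=; rewrite !in_itv/= => -[/andP[y1 y2] y3].
    rewrite y2 andbT leNgt; apply/negP => y4; apply: y3; lra.
  rewrite lebesgue_measure_itv/= lte_fin; case: ifP => _.
    by rewrite -EFinB lee_fin ger0_norm; lra.
  by rewrite lee_fin.
have mI : (mu1 `[(a - e)%R, (a + e)%R]%classic = (2 * e)%:E)%E.
  rewrite lebesgue_measure_itv/= lte_fin ifT; last lra.
  by rewrite -EFinB; congr EFin; ring.
rewrite -integral_mkcond integral_cst// [X in (_ * X <= _)%E]mI.
by rewrite -EFinM lee_fin mulrC.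
Qed.

Lemma mu2_disc_diff_horiz a a' b e : 0 < e ->
  (mu2 (disc a b e `\` disc a' b e) <= (2 * e * `|a - a'|)%:E)%E.
Proof.
move=> e0.
wlog aa : a a' / a <= a'.
  move=> H; have [/H//|/ltW/H] := leP a a'.
  by rewrite mu2_disc_diffC// distrC.
have [d2|d2] := leP (a' - a) (2 * e).
  have -> : a' = a + (a' - a) by ring.
  rewrite mu2_disc_diff//; last lra.
  have d0 : 0 <= (a' - a) / (2 * e) by rewrite divr_ge0; lra.
  have /andP[_ c2] := crescent_bounds d0.
  rewrite lee_fin (le_trans (ler_wpM2l (sqr_ge0 _) c2))//.
  rewrite ler0_norm; last lra.
  by rewrite le_eqVlt; apply/orP; left; apply/eqP; field; rewrite gt_eqF.
apply: (@le_trans _ _ (mu2 (disc a b e))).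
  by apply: le_measure; rewrite ?inE//; [apply: measurableD|]; exact: measurable_disc.
rewrite mu2_disc// lee_fin ler0_norm; last lra.
have := @pihalf_lt2 R; have := @pi_ge0 R; nra.
Qed.

Lemma mu2_disc_diff_le a b a' b' e : 0 < e ->
  (mu2 (disc a b e `\` disc a' b' e) <= (2 * e * (`|a - a'| + `|b - b'|))%:E)%E.
Proof.
move=> e0.
have mD x y x' y' : measurable (disc x y e `\` disc x' y' e).
  by apply: measurableD; exact: measurable_disc.
have m1 := mD a b a' b'; have m2 := mD a b a' b; have m3 := mD a' b a' b'.
apply: (@le_trans _ _ (mu2 ((disc a b e `\` disc a' b e) `|` (disc a' b e `\` disc a' b' e)))).
  apply: le_measure; [by rewrite inE|by rewrite inE; exact: measurableU|].
  by move=> p [p1 p2]; have [p3|p3] := pselect (disc a' b e p); [right|left].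
apply: (@le_trans _ _ (mu2 (disc a b e `\` disc a' b e) + mu2 (disc a' b e `\` disc a' b' e))%E).
  exact: measureU2.
rewrite mulrDr EFinD; apply: leeD; [exact: mu2_disc_diff_horiz|exact: mu2_disc_diff_vert].
Qed.

End DiscAreas.

(** * First moments of bounded plane sets *)

Section Moments.
Context {R : realType}.
Notation plane := (measurableTypeR R * measurableTypeR R)%type.
Implicit Types (a b c d e x y : R) (A B : set plane).

Notation mu2 := (@plane_measure R).

Definition bounded_plane A := exists M : R, forall p, A p -> `|p.1| <= M /\ `|p.2| <= M.

Lemma measurable_plane_disc a b e : measurable (disc a b e : set plane).
Proof. exact: measurable_disc. Qed.

Lemma disc_norm_lt a b e (p : plane) : 0 < e -> disc a b e p -> `|p.1 - a| < e /\ `|p.2 - b| < e.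
Proof.
move=> e0; rewrite /disc/= => h.
have s1 : (p.1 - a) ^+ 2 < e ^+ 2 by have := sqr_ge0 (p.2 - b); lra.
have s2 : (p.2 - b) ^+ 2 < e ^+ 2 by have := sqr_ge0 (p.1 - a); lra.
by rewrite -!sqrtr_sqr -{1 2}(ger0_norm (ltW e0)) -sqrtr_sqr !ltr_sqrt ?exprn_gt0.
Qed.

Lemma bounded_plane_disc a b e : 0 < e -> bounded_plane (disc a b e).
Proof.
move=> e0; exists (`|a| + `|b| + e) => p /(disc_norm_lt e0)[h1 h2].
have := ler_normD (p.1 - a) a; have := ler_normD (p.2 - b) b.
rewrite !subrK => g1 g2; have := normr_ge0 a; have := normr_ge0 b; lra.
Qed.

Lemma bounded_plane_sub A B : A `<=` B -> bounded_plane B -> bounded_plane A.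
Proof. by move=> AB [M H]; exists M => p /AB; exact: H. Qed.

Lemma bounded_planeU A B : bounded_plane A -> bounded_plane B -> bounded_plane (A `|` B).
Proof.
move=> [M H] [N K]; exists (Num.max M N) => p [/H|/K] [h1 h2]; rewrite !le_max h1 h2 ?orbT//.
Qed.

Lemma bounded_plane_lty A : measurable A -> bounded_plane A -> (mu2 A < +oo)%E.
Proof.
move=> mA [M H]; pose N := 2 * `|M| + 1.
have N0 : 0 < N by rewrite /N; have := normr_ge0 M; lra.
apply: (@le_lt_trans _ _ (mu2 (disc 0 0 N))); last by rewrite mu2_disc// ltry.
apply: le_measure; rewrite ?inE//; first exact: measurable_plane_disc.
move=> p /H[h1 h2]; rewrite /disc/= !subr0 -[p.1 ^+ 2]real_normK ?num_real// -[p.2 ^+ 2]real_normK ?num_real//.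
have h3 := ler_norm M; have g1 := normr_ge0 p.1; have g2 := normr_ge0 p.2; rewrite /N.
nra.
Qed.

Lemma bounded_integrable A (f : plane -> R) M : measurable A -> bounded_plane A -> measurable_fun setT f ->
  (forall p, A p -> `|f p| <= M) -> mu2.-integrable A (EFin \o f).
Proof.
move=> mA bA mf H; apply: measurable_bounded_integrable => //.
- exact: bounded_plane_lty.
- exact: measurable_funTS.
- exists M; split; first exact: num_real.
  by move=> N /ltW MN p Ap; exact: le_trans (H p Ap) MN.
Qed.

Definition plane_area A : R := fine (mu2 A).

Lemma plane_area_ge0 A : 0 <= plane_area A.
Proof. exact: fine_ge0. Qed.

Lemma plane_areaE A : measurable A -> bounded_plane A -> mu2 A = (plane_area A)%:E.
Proof. by move=> mA bA; rewrite fineK// ge0_fin_numE//; exact: bounded_plane_lty. Qed.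

Lemma plane_area_sub A B : measurable A -> measurable B -> bounded_plane B -> A `<=` B ->
  plane_area A <= plane_area B.
Proof.
move=> mA mB bB AB; rewrite -lee_fin -!plane_areaE//; last exact: bounded_plane_sub bB.
by apply: le_measure; rewrite ?inE.
Qed.

Lemma plane_areaU_le A B : measurable A -> measurable B -> bounded_plane A -> bounded_plane B ->
  plane_area (A `|` B) <= plane_area A + plane_area B.
Proof.
move=> mA mB bA bB; rewrite -lee_fin EFinD -!plane_areaE//; first exact: measureU2.
- exact: measurableU.
- exact: bounded_planeU.
Qed.

Lemma plane_area_disc a b e : 0 < e -> plane_area (disc a b e) = pi * e ^+ 2.
Proof. by move=> e0; rewrite /plane_area mu2_disc. Qed.

Lemma plane_area_disc_diff a b d e : 0 < e -> 0 <= d <= 2 * e ->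
  plane_area (disc a b e `\` disc (a + d) b e) = e ^+ 2 * crescent (d / (2 * e)).
Proof. by move=> e0 d0; rewrite /plane_area mu2_disc_diff. Qed.

Lemma plane_area_disc_diffC a b a' b' e : 0 < e ->
  plane_area (disc a b e `\` disc a' b' e) = plane_area (disc a' b' e `\` disc a b e).
Proof. by move=> e0; rewrite /plane_area mu2_disc_diffC. Qed.

Lemma plane_area_disc_diff_le a b a' b' e : 0 < e ->
  plane_area (disc a b e `\` disc a' b' e) <= 2 * e * (`|a - a'| + `|b - b'|).
Proof.
move=> e0; rewrite -lee_fin -plane_areaE; first exact: mu2_disc_diff_le.
- by apply: measurableD; exact: measurable_disc.
- by apply: bounded_plane_sub (bounded_plane_disc a b e0) => p [].
Qed.

Lemma plane_area_bigcup_le A (B : nat -> set plane) (u : nat -> R) M :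
  measurable A -> bounded_plane A -> (forall n, measurable (B n)) ->
  A `<=` \bigcup_n B n -> (forall n, (mu2 (B n) <= (u n)%:E)%E) ->
  (forall n, \sum_(0 <= i < n) u i <= M) -> plane_area A <= M.
Proof.
move=> mA bA mB AB Bu uM; rewrite -lee_fin -plane_areaE//.
apply: le_trans (measure_sigma_subadditive mu2 mB mA AB) _.
apply: lime_le; first by apply: is_cvg_nneseries => n _ _.
apply: nearW => n; apply: (@le_trans _ _ (\sum_(0 <= i < n) u i)%:E); last by rewrite lee_fin.
by rewrite -sumEFin; apply: lee_sum => i _.
Qed.

Definition first_moment A : R[i] := Rintegral mu2 A fst +i* Rintegral mu2 A snd.

Lemma Rintegral_near A (f : plane -> R) c M : measurable A -> bounded_plane A -> measurable_fun setT f ->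
  (forall p, A p -> `|f p - c| <= M) -> `|Rintegral mu2 A f - c * plane_area A| <= M * plane_area A.
Proof.
move=> mA bA mf H.
have fi : mu2.-integrable A (EFin \o f).
  apply: (@bounded_integrable _ _ (M + `|c|)) => // p /H h.
  by have := ler_normD (f p - c) c; rewrite subrK; lra.
have ci r : mu2.-integrable A (EFin \o (fun _ : plane => r)).
  by apply: (@bounded_integrable _ _ `|r|) => //; exact: measurable_cst.
rewrite /plane_area -(Rintegral_cst mu2 mA c) -(Rintegral_cst mu2 mA M) -(RintegralB mA fi (ci c)).
have fci : mu2.-integrable A (EFin \o (fun p => f p - c)).
  by apply: (@bounded_integrable _ _ M) => //; apply: measurable_funB => //; exact: measurable_cst.
apply: le_trans (le_normr_Rintegral mA fci) _.
apply: le_Rintegral => //.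
apply: (@bounded_integrable _ _ M) => //; last by move=> p /H; rewrite normr_id.
by apply: measurableT_comp => //; apply: measurable_funB => //; exact: measurable_cst.
Qed.

Lemma first_moment_near A (z : R[i]) M : measurable A -> bounded_plane A ->
  (forall p, A p -> `|p.1 - complex.Re z| <= M /\ `|p.2 - complex.Im z| <= M) ->
  cabs (first_moment A - z * (plane_area A)%:C) <= 2 * M * plane_area A.
Proof.
move=> mA bA H; apply: le_trans (cabs_le_sum _) _.
rewrite !raddfB/= Re_mulr Im_mulr.
have h1 := Rintegral_near mA bA measurable_fst (fun p Ap => (H p Ap).1).
have h2 := Rintegral_near mA bA measurable_snd (fun p Ap => (H p Ap).2).
lra.
Qed.

Lemma first_momentU A B : measurable A -> measurable B -> bounded_plane A -> bounded_plane B ->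
  A `&` B = set0 -> first_moment (A `|` B) = first_moment A + first_moment B.
Proof.
move=> mA mB bA bB AB; have mAB := measurableU _ _ mA mB; have bAB := bounded_planeU bA bB.
have dAB : [disjoint A & B] by apply/disj_setPS; rewrite AB.
have [M HM] := bAB.
have i1 : mu2.-integrable (A `|` B) (EFin \o fst).
  by apply: (bounded_integrable mAB bAB measurable_fst) => p /HM[h _]; exact: h.
have i2 : mu2.-integrable (A `|` B) (EFin \o snd).
  by apply: (bounded_integrable mAB bAB measurable_snd) => p /HM[_ h]; exact: h.
have E1 := Rintegral_setU mA mB i1 dAB; have E2 := Rintegral_setU mA mB i2 dAB.
by rewrite /first_moment E1 E2.
Qed.

(** The area cancels the denominator of the center of mass. When the area is 0 that denominator
    vanishes, but then so does the moment. *)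
Lemma complex_measureE (U : set R[i]) : measurable (plane_set U) -> bounded_plane (plane_set U) ->
  complex_measure U = first_moment (plane_set U).
Proof.
move=> mU bU; rewrite /complex_measure /center_of_mass.
have -> : area U = plane_area (plane_set U) by [].
have [a0|a0] := eqVneq (plane_area (plane_set U)) 0.
  rewrite a0 mul0r; have [M HM] := bU.
  have H : forall p, plane_set U p -> `|p.1 - complex.Re (0 : R[i])| <= M /\ `|p.2 - complex.Im (0 : R[i])| <= M.
    by move=> p /HM; rewrite /= !subr0.
  have := first_moment_near mU bU H; rewrite a0 !mulr0 subr0 => h.
  by apply/esym/eqP; rewrite -cabs_eq0 eq_le h cabs_ge0.
rewrite /first_moment.
apply/eqP; rewrite eq_complex /= !mul0r subr0 addr0.
by rewrite !(mulrC (plane_area _)) !divfK// !eqxx.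
Qed.

End Moments.

(** * Neighborhoods of a sequence asymptotic to 1 / n *)
Section DiscCrescents.
Context {R : realType}.
Implicit Types (z w u : R[i]) (e : R).

Notation plane := (measurableTypeR R * measurableTypeR R)%type.

Definition cdisc z e : set plane := disc (complex.Re z) (complex.Im z) e.

Lemma cdiscE z e (p : plane) : 0 < e -> cdisc z e p <-> cabs ((p.1 +i* p.2) - z) < e.
Proof. by move=> e0; rewrite cabs_lt_sqr// !raddfB. Qed.

Lemma measurable_cdisc z e : measurable (cdisc z e).
Proof. exact: measurable_plane_disc. Qed.

Lemma bounded_plane_cdisc z e : 0 < e -> bounded_plane (cdisc z e).
Proof. exact: bounded_plane_disc. Qed.

Lemma measurable_cdiscD z w e : measurable (cdisc z e `\` cdisc w e).
Proof. by apply: measurableD; exact: measurable_cdisc. Qed.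

Lemma bounded_plane_cdiscD z w e : 0 < e -> bounded_plane (cdisc z e `\` cdisc w e).
Proof. by move=> e0; apply: bounded_plane_sub (bounded_plane_cdisc z e0) => p []. Qed.

Lemma cdisc_disjoint z w e (p : plane) : 0 < e -> 2 * e <= cabs (z - w) ->
  cdisc z e p -> cdisc w e p -> False.
Proof.
move=> e0 zw; rewrite !cdiscE// => h1 h2.
have := cdist_triangle (p.1 +i* p.2) z w; rewrite (cdistC z (_ +i* _)); lra.
Qed.

Lemma plane_area_cdisc z e : 0 < e -> plane_area (cdisc z e) = pi * e ^+ 2.
Proof. exact: plane_area_disc. Qed.

Lemma plane_area_cdiscD_disjoint z w e : 0 < e -> 2 * e <= cabs (z - w) ->
  plane_area (cdisc z e `\` cdisc w e) = pi * e ^+ 2.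
Proof.
move=> e0 zw; rewrite -(plane_area_cdisc z e0); congr plane_area.
apply/seteqP; split => [p []//|p hp]; split => // hq.
exact: cdisc_disjoint e0 zw hp hq.
Qed.

Lemma plane_area_cdiscD_le z w e : 0 < e ->
  plane_area (cdisc z e `\` cdisc w e) <= 4 * e * cabs (z - w).
Proof.
move=> e0; apply: le_trans (plane_area_disc_diff_le _ _ _ _ e0) _.
have := Re_le_cabs (z - w); have := Im_le_cabs (z - w); rewrite !raddfB/= => h1 h2.
nra.
Qed.

(** For [s = 1] the removed disc lies to the left, and the symmetry of the area of a difference
    reduces this to a translate to the right. Past the diameter both sides are [pi * e ^+ 2],
    because [crescent] is constant from 1 on. *)
Lemma plane_area_cdiscD_real z (s d e : R) : 0 < e -> 0 <= d -> s = 1 \/ s = -1 ->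
  plane_area (cdisc z e `\` cdisc (z - (s * d)%:C) e) = e ^+ 2 * crescent (d / (2 * e)).
Proof.
move=> e0 d0 hs; have [d2|d2] := leP d (2 * e); last first.
  rewrite plane_area_cdiscD_disjoint//; last first.
    rewrite opprB addrC subrK cabs_real normrM (ger0_norm d0).
    by case: hs => ->; rewrite ?normrN normr1 mul1r ltW.
  by rewrite crescent_ge1 ?(mulrC pi)// ler_pdivlMr ?mulr_gt0// mul1r ltW.
have hd : 0 <= d <= 2 * e by rewrite d0.
case: hs => ->; rewrite ?mulN1r ?mul1r /cdisc.
  rewrite plane_area_disc_diffC// !raddfB/= subr0.
  rewrite -{2}(subrK d (complex.Re z)).
  exact: plane_area_disc_diff.
rewrite !raddfB/= oppr0 opprK addr0.
exact: plane_area_disc_diff.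
Qed.

Lemma plane_area_cdiscD_lipschitz z w u e : 0 < e ->
  `|plane_area (cdisc z e `\` cdisc w e) - plane_area (cdisc z e `\` cdisc u e)| <= 4 * e * cabs (w - u).
Proof.
move=> e0; have mD := measurable_cdiscD; have bD a b := @bounded_plane_cdiscD a b e e0.
suff H a b : plane_area (cdisc z e `\` cdisc a e) - plane_area (cdisc z e `\` cdisc b e) <= 4 * e * cabs (a - b).
  have h1 := H w u; have h2 := H u w; rewrite (cdistC u w) in h2.
  by rewrite ler_norml lerNl opprB h1 h2.
have /le_trans h : plane_area (cdisc z e `\` cdisc a e) <=
    plane_area ((cdisc z e `\` cdisc b e) `|` (cdisc b e `\` cdisc a e)).
  apply: plane_area_sub; [exact: mD|by apply: measurableU; exact: mD|by apply: bounded_planeU; exact: bD|].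
  by move=> p [p1 p2]; have [p3|p3] := pselect (cdisc b e p); [right|left].
have h2 := plane_area_cdiscD_le b a e0; rewrite (cdistC b a) in h2.
rewrite lerBlDl; apply: h; apply: le_trans (plane_areaU_le (mD _ _ _) (mD _ _ _) (bD _ _) (bD _ _)) _.
by rewrite lerD2l.
Qed.

Definition cdot z w : R := complex.Re z * complex.Re w + complex.Im z * complex.Im w.

Lemma cdot_le z w : cdot z w <= cabs z * cabs w.
Proof.
apply: le_trans (ler_norm _) _.
rewrite -[leRHS]ger0_norm ?mulr_ge0 ?cabs_ge0// -!sqrtr_sqr ler_wsqrtr// exprMn !sqr_cabs /cdot.
case: z w => a b [c d] /=; rewrite -subr_ge0.
rewrite (_ : _ - _ = (a * d - b * c) ^+ 2) ?sqr_ge0//; ring.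
Qed.

Lemma cdotDr z w u : cdot z (w + u) = cdot z w + cdot z u.
Proof. by rewrite /cdot !raddfD/=; ring. Qed.

Lemma cdot_bisector z w : cabs (z - w) < cabs z -> cabs w ^+ 2 < 2 * cdot z w.
Proof.
move=> h; have : cabs (z - w) ^+ 2 < cabs z ^+ 2 by rewrite ltr_pXn2r// nnegrE cabs_ge0.
by rewrite !sqr_cabs /cdot !raddfB/=; lra.
Qed.

(* A point nearer to [a] and to [b] than to [0] lies in the intersection of two half-planes bounded by
   bisectors; when [a] and [b] point in almost opposite real directions this wedge is far away. *)
Lemma bisector_wedge (v a b : R[i]) (s alpha beta eta e : R) :
  s = 1 \/ s = -1 -> 0 < alpha -> alpha <= beta -> 0 < eta <= 16^-1 -> 4 * eta * e <= beta / 4 ->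
  cabs (a - (s * alpha)%:C) <= eta * alpha -> cabs (b + (s * beta)%:C) <= eta * beta ->
  e <= cabs v -> cabs (v - a) < e -> cabs (v - b) < e -> False.
Proof.
move=> hs al be /andP[et0 et1] small ha hb ev va vb.
have s2 : s ^+ 2 = 1 by case: hs => ->; rewrite ?sqrrN expr1n.
have as_ : `|s| = 1 by case: hs => ->; rewrite ?normrN normr1.
have A1 : (1 - eta) * alpha <= cabs a.
  have := cabsB_ge (s * alpha)%:C a; rewrite cdistC cabs_real normrM as_ mul1r gtr0_norm//; lra.
have A2 : cabs a <= (1 + eta) * alpha.
  have := cabsB_ge a (s * alpha)%:C; rewrite cabs_real normrM as_ mul1r gtr0_norm//; lra.
have b0 : 0 < beta by exact: lt_le_trans be.
have B1 : (1 - eta) * beta <= cabs b.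
  have := cabsB_ge (- (s * beta)%:C) b; rewrite cdistC opprK cabsN cabs_real normrM as_ mul1r gtr0_norm//; lra.
have V : cabs v < e + cabs a.
  have := cabsD (v - a) a; rewrite subrK; lra.
have a2 := cdot_bisector (lt_le_trans va ev); have b2 := cdot_bisector (lt_le_trans vb ev).
have c1 : cdot v a <= s * alpha * complex.Re v + cabs v * (eta * alpha).
  rewrite -[a in cdot v a](subrK (s * alpha)%:C) cdotDr addrC lerD//; last first.
    by apply: le_trans (cdot_le _ _) _; rewrite ler_wpM2l ?cabs_ge0.
  by rewrite /cdot /= mulr0 addr0 mulrC.
have c2 : cdot v b <= - (s * beta * complex.Re v) + cabs v * (eta * beta).
  rewrite -[b in cdot v b](addrK (s * beta)%:C) cdotDr addrC lerD//; last first.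
    by apply: le_trans (cdot_le _ _) _; rewrite ler_wpM2l ?cabs_ge0.
  by rewrite /cdot /= oppr0 mulr0 addr0 mulrN mulrC.
have A3 : ((1 - eta) * alpha) ^+ 2 <= cabs a ^+ 2.
  by rewrite lerXn2r// nnegrE ?cabs_ge0// mulr_ge0//; lra.
have B3 : ((1 - eta) * beta) ^+ 2 <= cabs b ^+ 2.
  by rewrite lerXn2r// nnegrE ?cabs_ge0// mulr_ge0//; lra.
set x := s * complex.Re v.
have d1 : (1 - eta) ^+ 2 * alpha < 2 * (x + cabs v * eta).
  rewrite -(ltr_pM2r al).
  have -> : (1 - eta) ^+ 2 * alpha * alpha = ((1 - eta) * alpha) ^+ 2 by ring.
  have -> : 2 * (x + cabs v * eta) * alpha = 2 * (s * alpha * complex.Re v + cabs v * (eta * alpha)).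
    by rewrite /x; ring.
  lra.
have d2 : (1 - eta) ^+ 2 * beta < 2 * (- x + cabs v * eta).
  rewrite -(ltr_pM2r b0).
  have -> : (1 - eta) ^+ 2 * beta * beta = ((1 - eta) * beta) ^+ 2 by ring.
  have -> : 2 * (- x + cabs v * eta) * beta = 2 * (- (s * beta * complex.Re v) + cabs v * (eta * beta)).
    by rewrite /x; ring.
  lra.
(* Adding the two bisector inequalities cancels [x], the coordinate of [v] along the direction of
   [a]. With [eta <= 1 / 16] the left side is at least [(15 / 16)^2 (alpha + beta)] and the right
   side at most [beta / 4 + (17 / 64) alpha]. *)
have d3 : (1 - eta) ^+ 2 * (alpha + beta) < 4 * eta * (e + (1 + eta) * alpha).
  have : 4 * (eta * cabs v) <= 4 * (eta * (e + (1 + eta) * alpha)).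
    by rewrite ler_wpM2l// ler_wpM2l ?(ltW et0)//; lra.
  lra.
have q1 : (15 / 16) ^+ 2 <= (1 - eta) ^+ 2 by rewrite lerXn2r// ?nnegrE; lra.
have q2 : 4 * eta * (1 + eta) <= 17 / 64 by nra.
have q3 : 4 * eta * (1 + eta) * alpha <= 17 / 64 * alpha by rewrite ler_wpM2r// ltW.
have q4 : (15 / 16) ^+ 2 * (alpha + beta) <= (1 - eta) ^+ 2 * (alpha + beta).
  by rewrite ler_wpM2r// addr_ge0// ltW.
have : 4 * eta * (e + (1 + eta) * alpha) = 4 * eta * e + 4 * eta * (1 + eta) * alpha by ring.
lra.
Qed.

End DiscCrescents.

(** * The union of the discs centered on an orbit *)

Section OrbitNeighbourhood.
Context {R : realType}.
Variables (z : nat -> R[i]) (s : R).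
Hypothesis hs : s = 1 \/ s = -1.
Implicit Types (e eta : R).

Notation plane := (measurableTypeR R * measurableTypeR R)%type.

Definition first_discs (K : nat) e : set plane := [set p | exists2 n, (n < K)%N & cdisc (z n) e p].

Definition all_discs e : set plane := [set p | exists n, cdisc (z n) e p].

Lemma first_discs0 e : first_discs 0 e = set0.
Proof. by apply/seteqP; split => p // [n]. Qed.

Lemma first_discsS K e : first_discs K.+1 e = first_discs K e `|` (cdisc (z K) e `\` first_discs K e).
Proof.
apply/seteqP; split => p /=.
  move=> [n nK hn]; have [h|h] := pselect (first_discs K e p); first by left.
  right; split => //; move: nK; rewrite ltnS leq_eqVlt => /orP[/eqP <-//|nK].
  by exfalso; apply: h; exists n.
by move=> [[n nK hn]|[hK _]]; [exists n => //; exact: ltnW|exists K].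
Qed.

Lemma measurable_first_discs K e : measurable (first_discs K e).
Proof.
elim: K => [|K IH]; first by rewrite first_discs0; exact: measurable0.
rewrite first_discsS; apply: measurableU => //; apply: measurableD => //; exact: measurable_cdisc.
Qed.

Lemma bounded_first_discs K e : 0 < e -> bounded_plane (first_discs K e).
Proof.
move=> e0; elim: K => [|K IH]; first by rewrite first_discs0; exists 0 => p [].
rewrite first_discsS; apply: bounded_planeU => //.
by apply: bounded_plane_sub (bounded_plane_cdisc (z K) e0) => p [].
Qed.

Lemma measurable_all_discs e : measurable (all_discs e).
Proof.
rewrite (_ : all_discs e = \bigcup_n cdisc (z n) e).
  by apply: bigcupT_measurable => n; exact: measurable_cdisc.
by apply/seteqP; split => p [n]; [exists n|move=> _; exists n].
Qed.

(** Expected area, in units of [e^2], of the part of the [n]-th disc not covered before: the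
    predecessor is at distance about [1 / n^2] and the diameter is [1 / N^2]. The index 0 is set
    apart, having no predecessor; there [N / 0 = 0] would give weight 0 instead of a whole disc. *)
Definition crescent_weight (N n : nat) : R :=
  if n == 0 then pi else crescent ((N%:R / n%:R) ^+ 2).

Lemma crescent_weight_bounds N n : 0 <= crescent_weight N n <= pi.
Proof.
rewrite /crescent_weight; case: eqP => _; first by rewrite pi_ge0 lexx.
have h : 0 <= (N%:R / n%:R : R) ^+ 2 by exact: sqr_ge0.
by rewrite crescent_le_pi// andbT; have /andP[] := crescent_bounds h.
Qed.

Lemma crescent_weight_pi N n : (n <= N)%N -> crescent_weight N n = pi.
Proof.
rewrite /crescent_weight; case: eqP => // /eqP n0 nN.
rewrite crescent_ge1// exprn_ege1// ler_pdivlMr ?ltr0n ?lt0n// mul1r ler_nat//.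
Qed.

(* With [e = 1 / (2 N^2)], consecutive discs start to overlap at index about [N]. *)
Definition critical_radius (N : nat) : R := (2 * N%:R ^+ 2)^-1.

Lemma critical_radius_gt0 N : (0 < N)%N -> 0 < critical_radius N.
Proof. by move=> N0; rewrite invr_gt0 mulr_gt0// exprn_gt0// ltr0n. Qed.

Lemma critical_radiusE N : (0 < N)%N -> 2 * critical_radius N * N%:R ^+ 2 = 1.
Proof. by move=> N0; rewrite /critical_radius; field; rewrite pnatr_eq0 -lt0n. Qed.

(** From [n1] on the asymptotics hold with relative error [eta]; the finitely many earlier discs are
    isolated by [early]. Discs are computed individually up to the index [T * N]; the bound on [eta]
    in terms of [T] keeps the orbit straight enough on that range. *)
Variables (eta : R) (n1 T N : nat).
Hypothesis eta01 : 0 < eta <= 16^-1.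
Hypothesis n1_gt0 : (0 < n1)%N.
Hypothesis z_near : forall n, (n1 <= n)%N -> cabs (z n + (s / n%:R)%:C) <= eta / n%:R.
Hypothesis dz_near : forall n, (n1 <= n)%N ->
  cabs (z n.+1 - z n - (s / n.+1%:R ^+ 2)%:C) <= eta / n.+1%:R ^+ 2.
Hypothesis T_gt0 : (0 < T)%N.
Hypothesis eta_T : eta <= (16 * T%:R ^+ 2)^-1.
Hypothesis n1N : (2 * n1 + 2 <= N)%N.
Hypothesis TN : (T <= N)%N.
Hypothesis early : forall m k, (m < n1)%N -> k != m -> 2 * critical_radius N <= cabs (z m - z k).

Let e := critical_radius N.
Let K := (T * N)%N.
Let N_gt0 : (0 < N)%N. Proof. by apply: leq_trans n1N; rewrite addn2. Qed.
Let e0 : 0 < e. Proof. exact: critical_radius_gt0. Qed.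
Let as1 : `|s| = 1. Proof. by case: hs => ->; rewrite ?normrN normr1. Qed.

Lemma early_disjoint m k (p : plane) : (m < n1)%N -> k != m -> cdisc (z m) e p -> cdisc (z k) e p -> False.
Proof. by move=> h1 h2; apply: cdisc_disjoint => //; exact: early. Qed.

Lemma cabs_dz n : (n1 <= n)%N ->
  (1 - eta) / n.+1%:R ^+ 2 <= cabs (z n.+1 - z n) <= (1 + eta) / n.+1%:R ^+ 2.
Proof.
move=> nn; have h := dz_near nn; set d := z n.+1 - z n in h *.
have n0 : 0 < (n.+1%:R : R) ^+ 2 by rewrite exprn_gt0.
have E : cabs ((s / n.+1%:R ^+ 2)%:C : R[i]) = n.+1%:R ^- 2.
  by rewrite cabs_real normrM as1 mul1r ger0_norm// invr_ge0 ltW.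
have g1 := cabsB_ge (s / n.+1%:R ^+ 2)%:C d; have g2 := cabsB_ge d (s / n.+1%:R ^+ 2)%:C.
rewrite (cdistC _ d) in g1; rewrite E in g1 g2.
set X : R := n.+1%:R ^- 2 in g1 g2 h *.
have -> : (1 - eta) * X = X - eta * X by ring.
have -> : (1 + eta) * X = X + eta * X by ring.
by apply/andP; split; lra.
Qed.

(** Stopping at [N / 2] leaves a factor 4 which absorbs [eta]. Between [N / 2] and [N] consecutive
    discs may already overlap slightly, and the area is controlled by its Lipschitz dependence on
    the centers. *)
Lemma late_disjoint n : (n1 <= n)%N -> (2 * n.+1 <= N)%N -> 2 * e <= cabs (z n.+1 - z n).
Proof.
move=> nn nN; have /andP[h _] := cabs_dz nn; apply: le_trans h.
have n0 : 0 < n.+1%:R :> R by [].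
rewrite ler_pdivlMr ?exprn_gt0//.
have h1 : (2 * n.+1%:R) ^+ 2 <= N%:R ^+ 2 :> R.
  by rewrite lerXn2r ?nnegrE ?mulr_ge0 ?ler0n// -natrM ler_nat.
have /andP[_ h2] := eta01.
have h3 : 2 * e * (2 * n.+1%:R) ^+ 2 <= 2 * e * N%:R ^+ 2 by rewrite ler_wpM2l// mulr_ge0// ltW.
rewrite (critical_radiusE N_gt0) in h3.
have -> : 2 * e * n.+1%:R ^+ 2 = 2 * e * (2 * n.+1%:R) ^+ 2 / 4 by field.
lra.
Qed.

Lemma partial_displacement m j : (n1 <= m)%N ->
  cabs (z (m + j)%N - z m - (s * \sum_(m <= k < m + j) k.+1%:R ^- 2)%:C)
    <= eta * \sum_(m <= k < m + j) k.+1%:R ^- 2.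
Proof.
move=> mn; elim: j => [|j IH]; first by rewrite addn0 big_geq// !mulr0 subrr subr0 cabs0.
rewrite addnS big_nat_recr ?leq_addr//=.
set S := \sum_(m <= k < m + j) _ in IH *.
have h := dz_near (leq_trans mn (leq_addr j m)).
have -> : z (m + j).+1 - z m - (s * (S + (m + j).+1%:R ^- 2))%:C =
   (z (m + j)%N - z m - (s * S)%:C) + (z (m + j).+1 - z (m + j)%N - (s / (m + j).+1%:R ^+ 2)%:C).
  by rewrite mulrDr raddfD/=; ring.
by apply: le_trans (cabsD _ _) _; rewrite mulrDr; exact: lerD.
Qed.

(** Seen from [z n], the next point and the older point [z m] lie in almost opposite real
    directions. A point close to both but outside the disc at [z n] would lie in the wedge excluded
    by [bisector_wedge]. Hence only the immediate predecessor has to be removed from a disc. *)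
Lemma no_skipped_overlap n m (p : plane) : (n.+1 < K)%N -> (m < n)%N ->
  cdisc (z n.+1) e p -> cdisc (z m) e p -> cdisc (z n) e p.
Proof.
move=> nK mn h1 h2; have [mn1|mn1] := ltnP m n1.
  exfalso; apply: (early_disjoint mn1 _ h2 h1).
  by rewrite gtn_eqF// ltnS ltnW.
apply: contrapT => h3; have nn1 : (n1 <= n)%N by exact: leq_trans (ltnW mn).
pose P : R[i] := p.1 +i* p.2.
pose beta : R := \sum_(m <= k < n) k.+1%:R ^- 2.
have n0 : (0 < n)%N by exact: leq_trans n1_gt0 nn1.
have bn : n%:R ^- 2 <= beta.
  rewrite /beta -(prednK n0) big_nat_recr/=; last by rewrite -ltnS prednK.
  by rewrite lerDr sumr_ge0// => k _; rewrite invr_ge0 exprn_ge0.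
have pn : 0 < n%:R :> R by rewrite ltr0n.
apply: (@bisector_wedge R (P - z n) (z n.+1 - z n) (z m - z n) s (n.+1%:R ^- 2) beta eta e) => //.
- apply: le_trans bn; rewrite lef_pV2 ?posrE ?exprn_gt0// lerXn2r ?nnegrE// ler_nat//.
(* Here [beta >= 1 / (T N)^2], while [eta <= 1 / (16 T^2)] and [e = 1 / (2 N^2)] give
   [4 eta e <= 1 / (8 (T N)^2)]. *)
- have /andP[et0 _] := eta01; have T0 : 0 < T%:R :> R by rewrite ltr0n.
  have N0 : 0 < N%:R :> R by rewrite ltr0n.
  have h4 : 4 * eta * e <= 4 * (16 * T%:R ^+ 2)^-1 * e by rewrite ler_pM2r// ler_pM2l.
  have h5 : n%:R <= T%:R * N%:R :> R by rewrite -natrM ler_nat; exact: ltnW (ltnW nK).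
  have h6 : (T%:R * N%:R) ^- 2 <= n%:R ^- 2 :> R.
    by rewrite lef_pV2 ?posrE ?exprn_gt0 ?mulr_gt0// lerXn2r ?nnegrE ?mulr_ge0.
  have h7 : 4 * (16 * T%:R ^+ 2)^-1 * e = (T%:R * N%:R) ^- 2 / 8.
    by rewrite /e /critical_radius; field; rewrite !gt_eqF.
  have h8 : 0 < (T%:R * N%:R : R) ^- 2 by rewrite invr_gt0 exprn_gt0 ?mulr_gt0.
  lra.
- exact: dz_near.
- have := @partial_displacement m (n - m) mn1; rewrite subnKC ?(ltnW mn)// -/beta.
  by rewrite (_ : z m - z n + _ = - (z n - z m - (s * beta)%:C)) ?cabsN//; ring.
- by rewrite leNgt; apply/negP => h; apply: h3; apply/cdiscE.
- by rewrite opprB addrA subrK; apply/cdiscE.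
- by rewrite opprB addrA subrK; apply/cdiscE.
Qed.

Lemma new_part n : (n.+1 < K)%N ->
  cdisc (z n.+1) e `\` first_discs n.+1 e = cdisc (z n.+1) e `\` cdisc (z n) e.
Proof.
move=> nK; apply/seteqP; split => p [h1 h2]; split => // h3.
  by apply: h2; exists n.
case: h3 => m; rewrite ltnS leq_eqVlt => /orP[/eqP -> //|mn h3].
by apply: h2; exact: no_skipped_overlap nK mn h1 h3.
Qed.

Lemma new_part_area n : (n < K)%N ->
  `|plane_area (cdisc (z n) e `\` first_discs n e) - e ^+ 2 * crescent_weight N n|
     <= if (2 * n <= N)%N then 0 else 4 * e * (eta / n%:R ^+ 2).
Proof.
case: n => [|n] nK.
  by rewrite first_discs0 setD0 muln0 plane_area_cdisc// /crescent_weight mulrC subrr normr0.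
rewrite new_part//; case: ifPn => [nN|nN].
  rewrite crescent_weight_pi; last by apply: leq_trans nN; rewrite mul2n -addnn leq_addr.
  rewrite plane_area_cdiscD_disjoint//; first by rewrite mulrC subrr normr0.
  have [nn1|nn1] := ltnP n n1; last exact: late_disjoint.
  by rewrite cdistC; apply: early => //; rewrite gtn_eqF.
have nn1 : (n1 <= n)%N.
  rewrite leqNgt; apply/negP => h; move/negP: nN; apply; apply: leq_trans n1N.
  by rewrite -[(2 * n1 + 2)%N]/(2 * n1 + 2 * 1)%N -mulnDr leq_mul2l/= addn1 ltnS ltnW.
have h := dz_near nn1.
(* The ideal predecessor, at exact distance [1 / (n+1)^2] in the real direction: for it the area is
   the weight exactly, and moving it to [z n] costs a Lipschitz error. *)
set w := z n.+1 - (s * n.+1%:R ^- 2)%:C.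
have -> : e ^+ 2 * crescent_weight N n.+1 = plane_area (cdisc (z n.+1) e `\` cdisc w e).
  rewrite plane_area_cdiscD_real ?invr_ge0 ?exprn_ge0// /crescent_weight/=.
  congr (_ * crescent _); rewrite /e /critical_radius; field.
  by rewrite pnatr_eq0 -lt0n N_gt0/= addrC natr1 pnatr_eq0.
apply: le_trans (plane_area_cdiscD_lipschitz _ _ _ e0) _.
rewrite ler_pM2l ?mulr_gt0// /w opprB addrCA addrC -addrA addrC -cabsN.
by apply: le_trans h; rewrite le_eqVlt; apply/orP; left; apply/eqP; congr cabs; ring.
Qed.

Lemma first_moment_first_discs (M : nat) :
  first_moment (first_discs M e) = \sum_(0 <= n < M) first_moment (cdisc (z n) e `\` first_discs n e).
Proof.
have mF k := measurable_first_discs k e; have bF k := bounded_first_discs k e0.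
have mC k : measurable (cdisc (z k) e `\` first_discs k e) by apply: measurableD => //; exact: measurable_cdisc.
have bC k : bounded_plane (cdisc (z k) e `\` first_discs k e).
  by apply: bounded_plane_sub (bounded_plane_cdisc (z k) e0) => p [].
elim: M => [|M IH].
  rewrite first_discs0 big_geq// /first_moment !Rintegral_set0//.
rewrite first_discsS first_momentU// ?big_nat_recr//= ?IH//.
by apply/seteqP; split => p // [h1 [_ h2]].
Qed.

Lemma sum_inv_sqr_le (L M : nat) : (0 < L)%N ->
  \sum_(0 <= i < M) (L.+1 + i)%:R ^- 2 <= L%:R^-1 - (L + M)%:R^-1 :> R.
Proof.
move=> L0; elim: M => [|M IH]; first by rewrite big_geq// addn0 subrr.
rewrite big_nat_recr//= addSn addnS.
have a0 : 0 < (L + M)%:R :> R by rewrite ltr0n addn_gt0 L0.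
have a1 : 0 < (L + M).+1%:R :> R by [].
have h : (L + M).+1%:R ^- 2 <= (L + M)%:R^-1 - (L + M).+1%:R^-1 :> R.
  have -> : (L + M)%:R^-1 - (L + M).+1%:R^-1 = ((L + M)%:R * (L + M).+1%:R)^-1 :> R.
    move: a0 a1; rewrite -(@natr1 R (L + M)); move: ((L + M)%:R : R) => x x0 x1.
    by field; rewrite !gt_eqF.
  rewrite lef_pV2 ?posrE ?exprn_gt0 ?mulr_gt0// expr2 ler_wpM2r ?(ltW a1)// ler_nat//.
by apply: le_trans (lerD IH h) _; rewrite addrA subrK.
Qed.

Lemma cabs_z_le n : (n1 <= n)%N -> cabs (z n) <= 2 / n%:R.
Proof.
move=> nn; have n0 : 0 < n%:R :> R by rewrite ltr0n (leq_trans n1_gt0).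
have h := z_near nn; have := cabsB_ge (z n) (- (s / n%:R)%:C).
have ni : 0 <= n%:R^-1 :> R by rewrite invr_ge0 ltW.
rewrite opprK cabsN cabs_real normrM as1 mul1r ger0_norm// => g.
have /andP[_ et1] := eta01.
have : eta / n%:R <= 1 / n%:R by rewrite ler_pM2r ?invr_gt0//; lra.
lra.
Qed.

Let K_ge : (n1.+1 <= K)%N.
Proof.
apply: (@leq_trans N); last by rewrite leq_pmull.
by apply: leq_trans n1N; rewrite mul2n -addnn -addnA -[n1.+1]addn1 leq_add2l addn2.
Qed.

Let K_gt1 : (1 < K)%N. Proof. exact: leq_trans K_ge. Qed.

Let KE : K%:R = T%:R * N%:R :> R. Proof. by rewrite /K natrM. Qed.

Let pi4 : pi <= 4 :> R. Proof. by have := @pihalf_lt2 R; lra. Qed.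

(** For a point of the remainder let [m] be the least index of a disc containing it; the point lies
    in the [m]-th disc minus its predecessor. These lunes have area [O(e / m^2)], and the sum over
    [m >= K] telescopes. *)
Lemma rest_area : plane_area (all_discs e `\` first_discs K e) <= 16 * e / K%:R.
Proof.
have K0 : 0 < K%:R :> R by rewrite ltr0n ltnW.
pose B i : set plane := cdisc (z (K + i)%N) e `\` cdisc (z (K + i).-1) e.
pose u i : R := 8 * e * (K + i)%:R ^- 2.
have [n0 n0E] : {L | K = L.+1} by exists K.-1; rewrite prednK// ltnW.
have L0 : (0 < n0)%N by move: K_gt1; rewrite n0E.
have mrest : measurable (all_discs e `\` first_discs K e).
  by apply: measurableD; [exact: measurable_all_discs|exact: measurable_first_discs].
have Karea i : plane_area (B i) <= u i.
  apply: le_trans (plane_area_cdiscD_le _ _ e0) _.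
  have j0 : (K + i)%N = (n0 + i).+1 by rewrite n0E addSn.
  rewrite /u j0/=.
  have /cabs_dz/andP[_ h] : (n1 <= n0 + i)%N.
    by apply: leq_trans (leq_addr _ _); rewrite -ltnS -n0E.
  have p0 : 0 < (n0 + i).+1%:R ^- 2 :> R by rewrite invr_gt0 exprn_gt0.
  have h2 : (1 + eta) / (n0 + i).+1%:R ^+ 2 <= 2 / (n0 + i).+1%:R ^+ 2.
    by have /andP[_ et1] := eta01; rewrite ler_pM2r//; lra.
  have e40 : 0 <= 4 * e by rewrite mulr_ge0// ltW.
  have -> : 8 * e / (n0 + i).+1%:R ^+ 2 = 4 * e * (2 / (n0 + i).+1%:R ^+ 2) by ring.
  exact: ler_wpM2l e40 _ _ (le_trans h h2).
apply: (@plane_area_bigcup_le _ _ B u) => //.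
- have bnd : bounded_plane (all_discs e `\` first_discs K e).
    exists (2 / K%:R + e) => p [[n hn] hp].
    have Kn : (K <= n)%N by rewrite leqNgt; apply/negP => nK; apply: hp; exists n.
    have nn1 : (n1 <= n)%N by exact: leq_trans (ltnW K_ge) Kn.
    have h1 := cabs_z_le nn1.
    have h2 : 2 / n%:R <= 2 / K%:R :> R by rewrite ler_pM2l// lef_pV2 ?posrE ?ler_nat// ltr0n (leq_trans n1_gt0).
    move/cdiscE: hn => /(_ e0) hn.
    have h3 : cabs (p.1 +i* p.2 : R[i]) <= 2 / K%:R + e.
      have := cabsB_ge (p.1 +i* p.2 : R[i]) (z n); lra.
    by split; [have := Re_le_cabs (p.1 +i* p.2 : R[i])|have := Im_le_cabs (p.1 +i* p.2 : R[i])] => /=; move=> h; exact: le_trans h h3.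
  exact: bnd.
- by move=> i; exact: measurable_cdiscD.
- move=> p [[n hn] hp].
  have [m hm mmin] := ex_minnP (ex_intro (fun n => `[< cdisc (z n) e p >]) n (asboolT hn)).
  have Km : (K <= m)%N by rewrite leqNgt; apply/negP => mK; apply: hp; exists m => //; exact/asboolP.
  exists (m - K)%N => //; rewrite /B subnKC//; split; first exact/asboolP.
  move=> /asboolT/mmin; have m0 : (0 < m)%N by exact: leq_trans (ltnW K_gt1) Km.
  by rewrite leqNgt prednK ?leqnn.
- move=> i; rewrite plane_areaE ?lee_fin; [exact: Karea|exact: measurable_cdiscD|exact: bounded_plane_cdiscD].
- move=> M; rewrite /u -mulr_sumr.
  have h := @sum_inv_sqr_le n0 M L0; rewrite -n0E in h.
  have h1 : 0 <= (n0 + M)%:R^-1 :> R by rewrite invr_ge0.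
  have h2 : n0%:R^-1 <= 2 / K%:R :> R.
    have n00 : 0 < n0%:R :> R by rewrite ltr0n.
    rewrite -[leLHS]mul1r ler_pdivrMr// mulrAC ler_pdivlMr// mul1r n0E -natrM ler_nat.
    by rewrite mul2n -addnn -addn1 leq_add2l.
  have -> : 16 * e / K%:R = 8 * e * (2 / K%:R) by ring.
  by rewrite ler_wpM2l ?mulr_ge0 ?(ltW e0)//; lra.
Qed.

(** One factor [1 / K] comes from the area and another from the distance of the remainder to 0; then
    [1 / K^2 = 2 e / T^2]. *)
Lemma rest_moment : cabs (first_moment (all_discs e `\` first_discs K e)) <= e ^+ 2 * (192 / T%:R ^+ 2).
Proof.
have K0 : 0 < K%:R :> R by rewrite ltr0n ltnW.
have T0 : 0 < T%:R :> R by rewrite ltr0n.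
have N0 : 0 < N%:R :> R by rewrite ltr0n.
have mrest : measurable (all_discs e `\` first_discs K e).
  by apply: measurableD; [exact: measurable_all_discs|exact: measurable_first_discs].
have bnd (p : plane) : (all_discs e `\` first_discs K e) p -> `|p.1 - complex.Re (0 : R[i])| <= 2 / K%:R + e /\ `|p.2 - complex.Im (0 : R[i])| <= 2 / K%:R + e.
  move=> [[n hn] hp] /=; rewrite !subr0.
  have Kn : (K <= n)%N by rewrite leqNgt; apply/negP => nK; apply: hp; exists n.
  have nn1 : (n1 <= n)%N by exact: leq_trans (ltnW K_ge) Kn.
  have h1 := cabs_z_le nn1.
  have h2 : 2 / n%:R <= 2 / K%:R :> R by rewrite ler_pM2l// lef_pV2 ?posrE ?ler_nat// ltr0n (leq_trans n1_gt0).
  move/cdiscE: hn => /(_ e0) hn.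
  have h3 : cabs (p.1 +i* p.2 : R[i]) <= 2 / K%:R + e.
    have := cabsB_ge (p.1 +i* p.2 : R[i]) (z n); lra.
  by split; [have := Re_le_cabs (p.1 +i* p.2 : R[i])|have := Im_le_cabs (p.1 +i* p.2 : R[i])] => /=; move=> h; exact: le_trans h h3.
have brest : bounded_plane (all_discs e `\` first_discs K e).
  by exists (2 / K%:R + e) => p /bnd; rewrite /= !subr0.
have := first_moment_near mrest brest bnd; rewrite mul0r subr0 => /le_trans; apply.
have eK : e <= K%:R^-1.
  rewrite /e /critical_radius lef_pV2 ?posrE ?mulr_gt0 ?exprn_gt0//.
  rewrite /K natrM expr2 mulrA ler_pM2r// -natrM ler_nat (leq_trans TN)// leq_pmull//.
have h := rest_area; have a0 := plane_area_ge0 (all_discs e `\` first_discs K e).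
have h1 : 2 * (2 / K%:R + e) <= 6 / K%:R by lra.
apply: le_trans (ler_pM _ a0 h1 h) _.
  by rewrite mulr_ge0// addr_ge0 ?divr_ge0 ?ltW.
rewrite le_eqVlt; apply/orP; left; apply/eqP.
by rewrite /e /critical_radius /K natrM; field; rewrite !gt_eqF.
Qed.

Lemma new_moment n : (n < K)%N ->
  cabs (first_moment (cdisc (z n) e `\` first_discs n e) - z n * (plane_area (cdisc (z n) e `\` first_discs n e))%:C)
    <= 2 * e * (pi * e ^+ 2).
Proof.
move=> nK; set A := _ `\` _.
have mA : measurable A by apply: measurableD; [exact: measurable_cdisc|exact: measurable_first_discs].
have bA : bounded_plane A by apply: bounded_plane_sub (bounded_plane_cdisc (z n) e0) => p [].
have bnd p : A p -> `|p.1 - complex.Re (z n)| <= e /\ `|p.2 - complex.Im (z n)| <= e.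
  by move=> [/(disc_norm_lt e0)[h1 h2] _]; rewrite !ltW.
apply: le_trans (first_moment_near mA bA bnd) _.
rewrite ler_wpM2l ?mulr_ge0 ?(ltW e0)// -(plane_area_cdisc (z n) e0).
by apply: plane_area_sub => //; [exact: measurable_cdisc|exact: bounded_plane_cdisc|move=> p []].
Qed.

(** The error in the area occurs only for [n > N / 2], where [8 e eta / n^3 <= 64 e eta / N^3]; the
    bound is uniform in [n] so that it can be summed over [T N] terms. *)
Lemma weighted_area n : (n < K)%N ->
  cabs (z n * (plane_area (cdisc (z n) e `\` first_discs n e) - e ^+ 2 * crescent_weight N n)%:C)
    <= 64 * e * eta / N%:R ^+ 3.
Proof.
move=> nK; have N0 : 0 < N%:R :> R by rewrite ltr0n.
have /andP[et0 _] := eta01.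
have r0 : 0 <= 64 * e * eta / N%:R ^+ 3 by rewrite divr_ge0 ?mulr_ge0 ?exprn_ge0 ?ltW.
rewrite cabsM cabs_real; have := new_part_area nK; case: ifPn => nN h.
  have -> : `|plane_area (cdisc (z n) e `\` first_discs n e) - e ^+ 2 * crescent_weight N n| = 0.
    by apply/eqP; rewrite eq_le h normr_ge0.
  by rewrite mulr0.
have nn1 : (n1 <= n)%N.
  rewrite leqNgt; apply/negP => g; move/negP: nN; apply; apply: leq_trans n1N.
  by apply: leq_trans (leq_addr _ _); rewrite leq_mul2l/= ltnW.
have n0 : 0 < n%:R :> R by rewrite ltr0n (leq_trans n1_gt0).
have h1 := cabs_z_le nn1.
apply: le_trans (ler_pM (cabs_ge0 _) (normr_ge0 _) h1 h) _.
have -> : 2 / n%:R * (4 * e * (eta / n%:R ^+ 2)) = 8 * e * eta / n%:R ^+ 3 by field; rewrite gt_eqF.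
have -> : 64 * e * eta / N%:R ^+ 3 = 8 * e * eta * (N%:R / 2) ^- 3 by field; rewrite gt_eqF.
rewrite ler_wpM2l ?mulr_ge0 ?(ltW e0) ?(ltW et0)//.
rewrite lef_pV2 ?posrE ?exprn_gt0 ?divr_gt0// lerXn2r ?nnegrE ?divr_ge0 ?(ltW N0) ?(ltW n0)//.
by rewrite ler_pdivrMr// -natrM ler_nat mulnC ltnW// ltnNge.
Qed.

(** Below [N] all weights are [pi]. From [N] on, [z n] is replaced by [- s / n], which turns the sum
    into the Riemann sum of [crescent_log]; stopping it at [T] loses
    [crescent_log (T^-2) <= 2 / T^2]. *)
Lemma weighted_sum : cabs (\sum_(0 <= n < K) z n * (crescent_weight N n)%:C -
   (pi%:C * \sum_(0 <= n < N) z n - (s * crescent_log 1)%:C)) <= 4 * eta * T%:R + 4 / N%:R + 2 / T%:R ^+ 2.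
Proof.
have N0 : 0 < N%:R :> R by rewrite ltr0n.
have T0 : 0 < T%:R :> R by rewrite ltr0n.
have /andP[et0 _] := eta01.
have NK : (N <= K)%N by rewrite leq_pmull.
rewrite (big_cat_nat (leq0n N) NK)/=.
have -> : \sum_(0 <= n < N) z n * (crescent_weight N n)%:C = pi%:C * \sum_(0 <= n < N) z n.
  rewrite mulr_sumr; apply: eq_big_nat => n /andP[_ nN].
  by rewrite crescent_weight_pi 1?mulrC// ltnW.
pose W := \sum_(N <= n < K) crescent_weight N n / n%:R.
have -> : \sum_(N <= n < K) z n * (crescent_weight N n)%:C =
    \sum_(N <= n < K) (z n + (s / n%:R)%:C) * (crescent_weight N n)%:C - (s * W)%:C.
  rewrite /W mulr_sumr realC_sum -sumrB; apply: eq_bigr => n _.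
  rewrite mulrDl -!rmorphM/= -addrA -rmorphB/= (_ : _ - _ = 0) ?addr0//.
  by rewrite mulrAC mulrA subrr.
have hW : `|W - crescent_log 1| <= 4 / N%:R + 2 / T%:R ^+ 2.
  have := @crescent_riemann_sum R N T N_gt0 T_gt0.
  have -> : \sum_(N <= n < T * N) crescent ((N%:R / n%:R) ^+ 2) / n%:R = W.
    apply: eq_big_nat => n /andP[nN _]; rewrite /crescent_weight gtn_eqF//.
    exact: leq_trans N_gt0 nN.
  have /crescent_log_bounds/andP[l1 l2] : 0 <= T%:R ^- 2 :> R by rewrite invr_ge0 exprn_ge0.
  have : pi / N%:R <= 4 / N%:R :> R by rewrite ler_pM2r ?invr_gt0.
  move=> g; rewrite !ler_norml => /andP[g1 g2]; apply/andP; split; lra.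
have hS : cabs (\sum_(N <= n < K) (z n + (s / n%:R)%:C) * (crescent_weight N n)%:C) <= 4 * eta * T%:R.
  apply: le_trans (cabs_sum _ _ _) _.
  have -> : 4 * eta * T%:R = \sum_(0 <= n < K) (4 * eta / N%:R).
    by rewrite sumr_const_nat subn0 -[RHS]mulr_natr KE; field; rewrite gt_eqF.
  rewrite (big_cat_nat (leq0n N) NK)/= ler_wpDl ?sumr_ge0//.
    by move=> i _; rewrite divr_ge0 ?mulr_ge0 ?ltW.
  rewrite big_nat_cond [leRHS]big_nat_cond; apply: ler_sum => n /andP[/andP[Nn nK] _].
  have nn1 : (n1 <= n)%N.
    by apply: leq_trans Nn; apply: leq_trans n1N; rewrite mul2n -addnn -addnA leq_addr.
  have n0 : 0 < n%:R :> R by rewrite ltr0n (leq_trans n1_gt0).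
  have /andP[w0 w1] := crescent_weight_bounds N n.
  rewrite cabsM cabs_real ger0_norm//.
  have -> : 4 * eta / N%:R = eta / N%:R * 4 by ring.
  apply: ler_pM; rewrite ?cabs_ge0//; last exact: le_trans w1 pi4.
  apply: le_trans (z_near nn1) _; rewrite ler_pM2l// lef_pV2 ?posrE ?ler_nat//.
set S1 := \sum_(N <= n < K) (z n + _) * _ in hS *.
rewrite (_ : _ - _ = S1 - (s * (W - crescent_log 1))%:C); last by rewrite mulrBr rmorphB/=; ring.
apply: le_trans (cabsB _ _) _; rewrite cabs_real normrM as1 mul1r; lra.
Qed.

Lemma moment_estimate : cabs (first_moment (all_discs e) -
    (e ^+ 2)%:C * (pi%:C * \sum_(0 <= n < N) z n - (s * crescent_log 1)%:C))
  <= e ^+ 2 * (194 / T%:R ^+ 2 + 132 * eta * T%:R + 8 * T%:R / N%:R).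
Proof.
have N0 : 0 < N%:R :> R by rewrite ltr0n.
have T0 : 0 < T%:R :> R by rewrite ltr0n.
have /andP[et0 _] := eta01.
have mF := measurable_first_discs K e; have bF := bounded_first_discs K e0.
have mA := measurable_all_discs e.
have mrest : measurable (all_discs e `\` first_discs K e) by exact: measurableD.
have FA : first_discs K e `<=` all_discs e by move=> p [n _ h]; exists n.
have brest : bounded_plane (all_discs e `\` first_discs K e).
  exists (2 / K%:R + e) => p [[n hn] hp].
  have K0 : 0 < K%:R :> R by rewrite ltr0n ltnW.
  have Kn : (K <= n)%N by rewrite leqNgt; apply/negP => nK; apply: hp; exists n.
  have nn1 : (n1 <= n)%N by exact: leq_trans (ltnW K_ge) Kn.
  have h1 := cabs_z_le nn1.
  have h2 : 2 / n%:R <= 2 / K%:R :> R by rewrite ler_pM2l// lef_pV2 ?posrE ?ler_nat// ltr0n (leq_trans n1_gt0).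
  move/cdiscE: hn => /(_ e0) hn.
  have h3 : cabs (p.1 +i* p.2 : R[i]) <= 2 / K%:R + e.
    have := cabsB_ge (p.1 +i* p.2 : R[i]) (z n); lra.
  by split; [have := Re_le_cabs (p.1 +i* p.2 : R[i])|have := Im_le_cabs (p.1 +i* p.2 : R[i])] => /=; move=> h; exact: le_trans h h3.
have -> : all_discs e = first_discs K e `|` (all_discs e `\` first_discs K e) by rewrite setDUK.
rewrite first_momentU//; last by apply/seteqP; split => p // [h1 [_ h2]].
rewrite first_moment_first_discs.
pose a n := plane_area (cdisc (z n) e `\` first_discs n e).
(* The four errors: concentrating each new part at its center, replacing its area by the weight,
   evaluating the weighted sum, and dropping the discs from [K] on. *)
pose X1 := \sum_(0 <= n < K) (first_moment (cdisc (z n) e `\` first_discs n e) - z n * (a n)%:C).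
pose X2 := \sum_(0 <= n < K) z n * (a n - e ^+ 2 * crescent_weight N n)%:C.
pose X3 := \sum_(0 <= n < K) z n * (crescent_weight N n)%:C - (pi%:C * \sum_(0 <= n < N) z n - (s * crescent_log 1)%:C).
pose X4 := first_moment (all_discs e `\` first_discs K e).
rewrite (_ : _ - _ = X1 + X2 + (e ^+ 2)%:C * X3 + X4); last first.
  have -> : \sum_(0 <= n < K) first_moment (cdisc (z n) e `\` first_discs n e) =
     X1 + X2 + (e ^+ 2)%:C * \sum_(0 <= n < K) z n * (crescent_weight N n)%:C.
    rewrite /X1 /X2 mulr_sumr -!big_split/=; apply: eq_bigr => n _.
    by rewrite rmorphB rmorphM/=; ring.
  by rewrite /X3 -/X4 mulrBr; ring.
have c1 (c : R) : \sum_(0 <= n < K) c = c * (T%:R * N%:R).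
  by rewrite sumr_const_nat subn0 -[LHS]mulr_natr KE.
have h1 : cabs X1 <= e ^+ 2 * (4 * T%:R / N%:R).
  apply: le_trans (cabs_sum _ _ _) _.
  apply: (@le_trans _ _ (\sum_(0 <= n < K) 2 * e * (4 * e ^+ 2))).
    rewrite big_nat_cond [leRHS]big_nat_cond; apply: ler_sum => n /andP[/andP[_ nK] _].
    apply: le_trans (new_moment nK) _; rewrite ler_wpM2l ?mulr_ge0 ?(ltW e0)//.
    by rewrite ler_wpM2r// sqr_ge0.
  rewrite c1 le_eqVlt; apply/orP; left; apply/eqP.
  by rewrite /e /critical_radius; field; rewrite gt_eqF.
have h2 : cabs X2 <= e ^+ 2 * (128 * eta * T%:R).
  apply: le_trans (cabs_sum _ _ _) _.
  apply: (@le_trans _ _ (\sum_(0 <= n < K) (64 * e * eta / N%:R ^+ 3))).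
    rewrite big_nat_cond [leRHS]big_nat_cond; apply: ler_sum => n /andP[/andP[_ nK] _].
    exact: weighted_area.
  rewrite c1 le_eqVlt; apply/orP; left; apply/eqP.
  by rewrite /e /critical_radius; field; rewrite gt_eqF.
have h3 : cabs ((e ^+ 2)%:C * X3) <= e ^+ 2 * (4 * eta * T%:R + 4 / N%:R + 2 / T%:R ^+ 2).
  by rewrite cabsM cabs_real ger0_norm ?sqr_ge0// ler_wpM2l ?sqr_ge0//; exact: weighted_sum.
have h4 : cabs X4 <= e ^+ 2 * (192 / T%:R ^+ 2) := rest_moment.
have h5 := cabsD (X1 + X2 + (e ^+ 2)%:C * X3) X4.
have h6 := cabsD (X1 + X2) ((e ^+ 2)%:C * X3).
have h7 := cabsD X1 X2.
have h8 : e ^+ 2 * (4 / N%:R) <= e ^+ 2 * (4 * T%:R / N%:R).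
  by rewrite ler_wpM2l ?sqr_ge0// ler_pM2r ?invr_gt0// ler_pMr// ler1n.
apply: le_trans h5 _; lra.
Qed.

End OrbitNeighbourhood.

(** * Limit of the first moment along the critical radii *)

Section MomentLimit.
Context {R : realType}.
Variables (z : nat -> R[i]) (s : R).
Hypothesis hs : s = 1 \/ s = -1.
Hypothesis z_inj : forall m k, k != m -> z k != z m.
Hypothesis z_neq0 : forall m, z m != 0.
Hypothesis z_asymp : ccvg \oo (fun n => n%:R * z n) (- s)%:C.
Hypothesis dz_asymp : ccvg \oo (fun n => n.+1%:R ^+ 2 * (z n.+1 - z n)) s%:C.

Lemma near_infty_ge (P : set nat) : (\forall n \near \oo, P n) <-> exists N, forall n, (N <= n)%N -> P n.
Proof. by split=> [[N _ H]|[N H]]; exists N. Qed.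

Lemma z_near_asymp eta : 0 < eta -> exists N, forall n, (N <= n)%N ->
  cabs (z n + (s / n%:R)%:C) <= eta / n%:R.
Proof.
move=> e0; have /near_infty_ge[N H] := z_asymp e0.
exists N.+1 => n Nn; have {}H := H n (ltnW Nn).
have n0 : 0 < n%:R :> R by rewrite ltr0n (leq_trans _ Nn).
rewrite ler_pdivlMr//; have -> (x : R[i]) : cabs x * n%:R = cabs (x * n%:R%:C) by rewrite cabsM cabs_real normr_nat.
apply/ltW; apply: le_lt_trans H.
rewrite le_eqVlt; apply/orP; left; apply/eqP; congr cabs.
rewrite mulrDl -rmorphM/= divfK ?gt_eqF// rmorphN opprK mulrC.
by rewrite (rmorph_nat (real_complex R)).
Qed.

Lemma dz_near_asymp eta : 0 < eta -> exists N, forall n, (N <= n)%N ->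
  cabs (z n.+1 - z n - (s / n.+1%:R ^+ 2)%:C) <= eta / n.+1%:R ^+ 2.
Proof.
move=> e0; have /near_infty_ge[N H] := dz_asymp e0.
exists N => n Nn; have {}H := H n Nn.
have n0 : 0 < n.+1%:R ^+ 2 :> R by rewrite exprn_gt0.
rewrite ler_pdivlMr//.
have -> (x : R[i]) : cabs x * n.+1%:R ^+ 2 = cabs (x * (n.+1%:R ^+ 2)%:C) by rewrite cabsM cabs_real (gtr0_norm n0).
apply/ltW; apply: le_lt_trans H.
rewrite le_eqVlt; apply/orP; left; apply/eqP; congr cabs.
rewrite mulrBl -rmorphM/= divfK ?gt_eqF// mulrC.
by rewrite rmorphXn/= (rmorph_nat (real_complex R)).
Qed.

Lemma nat_gt (x : R) : exists b : nat, x < b%:R.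
Proof.
exists (Num.bound `|x|); apply: le_lt_trans (ler_norm x) _.
exact: archi_boundP (normr_ge0 x).
Qed.

(** Since [z] tends to 0 and [z m] is not 0, all but finitely many terms are at distance at least
    half of [cabs (z m)]; the others are distinct from [z m]. *)
Lemma z_isolated m : exists2 rho : R, 0 < rho & forall k, k != m -> rho <= cabs (z m - z k).
Proof.
have zm : 0 < cabs (z m) by rewrite cabs_gt0.
have [N HN] : exists N, forall n, (N <= n)%N -> cabs (z n) <= cabs (z m) / 2.
  have [N H] := z_near_asymp (@ltr01 R).
  have as1 : `|s| = 1 by case: hs => ->; rewrite ?normrN normr1.
  have [b hb] := nat_gt (4 / cabs (z m)).
  exists (N + b).+1%N => n hn.
  have n0 : 0 < n%:R :> R by rewrite ltr0n (leq_trans _ hn).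
  have {}H := H n (leq_trans (leq_addr _ _) (ltnW hn)).
  have g := cabsB_ge (z n) (- (s / n%:R)%:C).
  have ni : 0 <= n%:R^-1 :> R by rewrite invr_ge0 ltW.
  rewrite opprK cabsN cabs_real normrM as1 mul1r ger0_norm// in g.
  have : 4 / cabs (z m) <= n%:R.
    apply: le_trans (ltW hb) _.
    by rewrite ler_nat; apply: leq_trans (leq_addl _ _) (ltnW hn).
  rewrite ler_pdivrMr// -ler_pdivrMl// => h.
  have : 4 * n%:R^-1 <= cabs (z m) by rewrite mulrC.
  lra.
suff [rho r0 H] : exists2 rho : R, 0 < rho & forall k, (k < N)%N -> k != m -> rho <= cabs (z m - z k).
  exists (Num.min rho (cabs (z m) / 2)); first by rewrite lt_min r0 divr_gt0.
  move=> k km; rewrite ge_min; have [kN|kN] := ltnP k N; first by rewrite H.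
  by apply/orP; right; have := cabsB_ge (z m) (z k); have := HN k kN; lra.
elim: (N) => [|M [rho r0 H]]; first by exists 1.
have [ME|Mm] := eqVneq M m.
  exists rho => // k; rewrite ltnS leq_eqVlt => /orP[/eqP ->|kM]; first by rewrite ME eqxx.
  exact: H.
exists (Num.min rho (cabs (z m - z M))).
  by rewrite lt_min r0 cabs_gt0 subr_eq0 eq_sym z_inj.
move=> k; rewrite ltnS leq_eqVlt ge_min => /orP[/eqP -> _|kM km]; first by rewrite lexx orbT.
by rewrite H.
Qed.

Lemma z_isolated_first (n : nat) : exists2 rho : R, 0 < rho &
  forall m k, (m < n)%N -> k != m -> rho <= cabs (z m - z k).
Proof.
elim: n => [|n [rho r0 H]]; first by exists 1.
have [rho' r0' H'] := z_isolated n.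
exists (Num.min rho rho'); first by rewrite lt_min r0.
move=> m k; rewrite ltnS leq_eqVlt ge_min => /orP[/eqP -> km|mn km]; first by rewrite H' ?orbT.
by rewrite H.
Qed.

(** The error of [moment_estimate] tends to 0 only in a prescribed order: [T] large makes
    [194 / T^2] small, then [eta] small makes [132 eta T] small, which fixes [n1] and the separation
    [rho] of the early points, and finally [N] is large. *)
Lemma first_moment_limit : ccvg \oo
  (fun N => first_moment (all_discs z (critical_radius N)) / (critical_radius N ^+ 2)%:C - pi%:C * \sum_(0 <= n < N) z n)
  (- (s * crescent_log 1)%:C).
Proof.
move=> d d0; apply/near_infty_ge.
have [b1 hb1] := nat_gt (600 / d).
pose T := b1.+1.
have T0 : 0 < T%:R :> R by [].
have hT : 194 / T%:R ^+ 2 < d / 3.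
  have h1 : 600 / d < T%:R by apply: lt_trans hb1 _; rewrite ltr_nat.
  rewrite ltr_pdivrMr ?exprn_gt0//; rewrite ltr_pdivrMr// in h1.
  have h2 : T%:R <= T%:R ^+ 2 :> R by rewrite expr2 ler_pMr// ler1n.
  have : d * T%:R <= d * T%:R ^+ 2 by rewrite ler_pM2l.
  lra.
(* The first bound is the one required by the wedge argument; the second gives
   [132 eta T <= 132 d / 400 < d / 3]. *)
pose eta := Num.min (16 * T%:R ^+ 2)^-1 (d / (20 * (20 * T%:R))) : R.
have c0 : 0 < 20 * (20 * T%:R) :> R by rewrite mulr_gt0 ?mulr_gt0 ?ltr0n.
have eta0 : 0 < eta by rewrite lt_min invr_gt0 mulr_gt0 ?exprn_gt0 ?ltr0n//= divr_gt0.
have eta1 : eta <= (16 * T%:R ^+ 2)^-1 by rewrite ge_min lexx.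
have eta16 : 0 < eta <= 16^-1.
  rewrite eta0/=; apply: le_trans eta1 _.
  rewrite lef_pV2 ?posrE ?mulr_gt0 ?exprn_gt0// ler_pMr// exprn_ege1// ler1n//.
have eta2 : 132 * eta * T%:R < d / 3.
  have : eta <= d / (20 * (20 * T%:R)) by rewrite ge_min lexx orbT.
  rewrite (ler_pdivlMr _ _ c0); lra.
have [M1 H1] := z_near_asymp eta0; have [M2 H2] := dz_near_asymp eta0.
pose n1 := (maxn M1 M2).+1.
have [rho rho0 Hrho] := z_isolated_first n1.
have [b2 hb2] := nat_gt (30 * T%:R / d); have [b3 hb3] := nat_gt rho^-1.
exists (2 * n1 + 2 + T + b2 + b3)%N => N hN.
have N1 : (2 * n1 + 2 <= N)%N by apply: leq_trans hN; rewrite -addnA -addnA; exact: leq_addr.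
have TN : (T <= N)%N by apply: leq_trans hN; rewrite -addnA; apply: leq_trans (leq_addr _ _); exact: leq_addl.
have N0 : (0 < N)%N by exact: leq_trans TN.
have rN0 : 0 < N%:R :> R by rewrite ltr0n.
have hN3 : 8 * T%:R / N%:R < d / 3.
  have h1 : 30 * T%:R / d < N%:R.
    apply: lt_le_trans hb2 _.
    by rewrite ler_nat; apply: leq_trans hN; rewrite addnAC leq_addl.
  by rewrite ltr_pdivrMr// in h1; rewrite ltr_pdivrMr//; lra.
have e0 : 0 < critical_radius N :> R by exact: critical_radius_gt0.
have erho : 2 * critical_radius N <= rho.
  have h1 : rho^-1 < N%:R.
    apply: lt_le_trans hb3 _.
    by rewrite ler_nat; apply: leq_trans hN; rewrite leq_addl.
  have -> : 2 * critical_radius N = N%:R ^- 2 :> R by rewrite /critical_radius; field; rewrite gt_eqF.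
  have h2 : N%:R^-1 < rho by rewrite -[rho]invrK ltf_pV2 ?posrE ?invr_gt0.
  apply: le_trans (ltW h2); rewrite lef_pV2 ?posrE ?exprn_gt0// expr2 ler_pMr// ler1n//.
have Mn1 : (maxn M1 M2 <= n1)%N by [].
have := @moment_estimate R z s hs eta n1 T N eta16 isT.
move=> /(_ (fun n h => H1 n (leq_trans (leq_trans (leq_maxl M1 M2) Mn1) h))).
move=> /(_ (fun n h => H2 n (leq_trans (leq_trans (leq_maxr M1 M2) Mn1) h))).
move=> /(_ isT eta1 N1 TN (fun m k h1 h2 => le_trans erho (Hrho m k h1 h2))).
set e := critical_radius N in e0 *; set A := first_moment _; set S := \sum_(0 <= n < N) z n.
have e20 : 0 < e ^+ 2 by rewrite exprn_gt0.
have eC : (e ^+ 2)%:C != 0 :> R[i] by rewrite -cabs_eq0 cabs_real normr_eq0 gt_eqF.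
have -> : A - (e ^+ 2)%:C * (pi%:C * S - (s * crescent_log 1)%:C) =
    (e ^+ 2)%:C * (A / (e ^+ 2)%:C - pi%:C * S - - (s * crescent_log 1)%:C).
  by move: eC; move: ((e ^+ 2)%:C : R[i]) => E E0; field.
rewrite cabsM cabs_real (gtr0_norm e20) ler_pM2l// => /le_lt_trans; apply; lra.
Qed.

End MomentLimit.

(** * Reading off the coefficient of [e^2] *)

Section PrincipalValue.
Context {R : realType}.
Implicit Types (z : nat -> R[i]) (s : R).

Lemma critical_radius_lt (d : R) : 0 < d -> exists N0, forall N, (N0 <= N)%N -> 0 < (critical_radius N : R) < d.
Proof.
move=> d0; have [b hb] := nat_gt d^-1.
exists b.+1 => N bN; have N0 : (0 < N)%N by exact: leq_trans bN.
have rN0 : 0 < N%:R :> R by rewrite ltr0n.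
rewrite critical_radius_gt0//=.
have h : d^-1 < N%:R by apply: lt_trans hb _; rewrite ltr_nat.
have h2 : N%:R^-1 < d by rewrite -[d]invrK ltf_pV2 ?posrE ?invr_gt0.
apply: le_lt_trans h2; rewrite /critical_radius lef_pV2 ?posrE ?mulr_gt0 ?exprn_gt0//.
have : 1 <= N%:R :> R by rewrite ler1n.
nra.
Qed.

Lemma ln_critical_radius N : (0 < N)%N -> ln (critical_radius N) = - ln 2 - 2 * ln N%:R :> R.
Proof.
move=> N0; have rN0 : 0 < N%:R :> R by rewrite ltr0n.
rewrite /critical_radius lnV ?posrE ?mulr_gt0 ?exprn_gt0// lnM ?posrE ?exprn_gt0//.
by rewrite lnXn// mulr_natl opprD.
Qed.

Lemma sqrt_critical_radius_le N : (0 < N)%N -> Num.sqrt (critical_radius N) <= N%:R^-1 :> R.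
Proof.
move=> N0; have rN0 : 0 < N%:R :> R by rewrite ltr0n.
rewrite -[leRHS]ger0_norm ?invr_ge0 ?(ltW rN0)// -sqrtr_sqr ler_wsqrtr// exprVn /critical_radius.
rewrite lef_pV2 ?posrE ?mulr_gt0 ?exprn_gt0// ler_peMl ?exprn_ge0// ?ler1n//.
Qed.

Lemma ln_le_sqrt (x : R) : 0 < x -> ln x <= 2 * Num.sqrt x.
Proof.
move=> x0; have s0 : 0 < Num.sqrt x by rewrite sqrtr_gt0.
rewrite -[in leLHS](sqr_sqrtr (ltW x0)) lnXn// -[leLHS]mulr_natl ler_pM2l//.
have := @le_ln1Dx R (Num.sqrt x - 1); rewrite (addrC 1) subrK => h.
apply: le_trans (h _) _; lra.
Qed.

Lemma cvg_nat_inv : (fun n : nat => (n%:R : R)^-1) @ \oo --> 0.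
Proof.
apply/cvgrPdist_lt => e e0; apply/near_infty_ge; have [b hb] := nat_gt e^-1.
exists b.+1 => n bn; have n0 : 0 < n%:R :> R by rewrite ltr0n (leq_trans _ bn).
rewrite sub0r normrN ger0_norm ?invr_ge0 ?ltW//.
rewrite -[e]invrK ltf_pV2 ?posrE ?invr_gt0//; apply: lt_trans hb _; rewrite ltr_nat//.
Qed.

Lemma cvg_sqrt_radius : (fun n : nat => Num.sqrt (critical_radius n) : R) @ \oo --> 0.
Proof.
apply: squeeze_cvgr (cvg_cst 0) cvg_nat_inv; apply/near_infty_ge; exists 1%N => n n0.
by rewrite sqrtr_ge0 sqrt_critical_radius_le.
Qed.

Lemma cvg_sqrt_radius_ln : (fun n : nat => Num.sqrt (critical_radius n) * ln (critical_radius n) : R) @ \oo --> 0.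
Proof.
have c1 : (fun n : nat => 6 * Num.sqrt (n%:R : R)^-1) @ \oo --> (0 : R).
  have h : (fun n : nat => Num.sqrt (n%:R : R)^-1) @ \oo --> Num.sqrt (0 : R).
    apply: (@cvg_comp _ _ _ (fun n : nat => (n%:R : R)^-1) Num.sqrt); first exact: cvg_nat_inv.
    exact: sqrt_continuous.
  have := cvgM (cvg_cst (6 : R)) h; rewrite sqrtr0 mulr0; exact.
have c2 : (fun n : nat => - (6 * Num.sqrt (n%:R : R)^-1)) @ \oo --> (0 : R).
  by have := cvgN c1; rewrite oppr0; exact.
apply: squeeze_cvgr c2 c1; apply/near_infty_ge; exists 1%N => n n0.
have rn0 : 0 < n%:R :> R by rewrite ltr0n.
rewrite -ler_norml normrM (ger0_norm (sqrtr_ge0 _)).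
have l0 : 0 <= ln n%:R :> R by rewrite ln_ge0// ler1n.
have l2 : 0 <= ln (2 : R) <= 1.
  rewrite ln_ge0 ?ler1n//=; have := @le_ln1Dx R 1; rewrite (_ : 1 + 1 = 2 :> R)//; apply; lra.
have l3 := ln_le_sqrt rn0.
have s1 : 1 <= Num.sqrt n%:R :> R by rewrite -[leLHS]sqrtr1 ler_wsqrtr// ler1n.
rewrite ln_critical_radius//.
have -> : `|- ln 2 - 2 * ln n%:R| = ln 2 + 2 * ln n%:R :> R.
  by rewrite -opprD normrN ger0_norm//; lra.
have h : ln 2 + 2 * ln n%:R <= 6 * Num.sqrt n%:R :> R by lra.
apply: le_trans (ler_pM (sqrtr_ge0 _) _ (sqrt_critical_radius_le n0) h) _; first lra.
rewrite mulrCA ler_pM2l// -[X in X^-1 * _](sqr_sqrtr (ltW rn0)) sqrtrV ?(ltW rn0)//.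
rewrite le_eqVlt; apply/orP; left; apply/eqP; field; rewrite sqrtr_eq0 -ltNge//.
Qed.

Lemma powR52 (e : R) : 0 < e -> e `^ (5 / 2) = e ^+ 2 * Num.sqrt e.
Proof.
move=> e0; have -> : 5 / 2 = 2%:R + 2^-1 :> R by field.
rewrite powRD; last by rewrite gt_eqF ?implybT// ltW.
by rewrite powR_mulrn ?powR12_sqrt// ltW.
Qed.

Lemma plane_set_orbit z e : 0 < e -> plane_set (eps_nbhd (range z) e) = all_discs z e.
Proof.
move=> e0; apply/seteqP; split => p.
  move=> [_ [n _ <-]]; rewrite normrE_cabs ltcR => h; exists n; exact/cdiscE.
move=> [n /cdiscE h]; exists (z n); first by exists n.
by rewrite normrE_cabs ltcR; exact: h.
Qed.

Lemma bounded_all_discs z s e : s = 1 \/ s = -1 -> 0 < e -> ccvg \oo (fun n => n%:R * z n) (- s)%:C -> bounded_plane (all_discs z e).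
Proof.
move=> hs e0 hz; have [N H] := z_near_asymp hz (@ltr01 R).
have as1 : `|s| = 1 by case: hs => ->; rewrite ?normrN normr1.
pose M := 2 + \sum_(0 <= n < N) cabs (z n).
have HM n : cabs (z n) <= M.
  have [nN|Nn] := ltnP n N.
    rewrite /M (bigD1_seq n) ?mem_index_iota ?iota_uniq//=.
    have : 0 <= \sum_(0 <= i < N | i != n) cabs (z i) by rewrite sumr_ge0// => i _; exact: cabs_ge0.
    lra.
  have h := H n Nn; have g := cabsB_ge (z n) (- (s / n%:R)%:C).
  rewrite opprK cabsN cabs_real normrM as1 mul1r normfV normr_nat in g.
  have S0 : 0 <= \sum_(0 <= i < N) cabs (z i) by rewrite sumr_ge0// => i _; exact: cabs_ge0.
  have : n%:R^-1 <= 1 :> R.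
    case: n {h g Nn} => [|n]; first by rewrite invr0.
    by rewrite invf_le1// ler1n.
  rewrite /M; lra.
exists (M + e) => p [n /cdiscE hn].
have {}hn := hn e0.
have h : cabs (p.1 +i* p.2 : R[i]) <= M + e.
  by have := cabsB_ge (p.1 +i* p.2 : R[i]) (z n); have := HM n; lra.
by split; [have := Re_le_cabs (p.1 +i* p.2 : R[i])|have := Im_le_cabs (p.1 +i* p.2 : R[i])] => /= g; exact: le_trans g h.
Qed.

(* Along the radii [critical_radius N] the expansion determines both [q1] and [H]. *)
Lemma principal_value z s (C0 q1 q2 H : R[i]) : s = 1 \/ s = -1 ->
  (forall m k, k != m -> z k != z m) -> (forall m, z m != 0) ->
  ccvg \oo (fun n => n%:R * z n) (- s)%:C ->
  ccvg \oo (fun n => n.+1%:R ^+ 2 * (z n.+1 - z n)) s%:C ->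
  ccvg \oo (fun N => \sum_(0 <= n < N) z n + (s * ln N%:R)%:C) C0 ->
  (fun e : R => complex_measure (eps_nbhd (range z) e)
      - (q1 * (e ^+ 2 * ln e)%:C + H * (e ^+ 2)%:C + q2 * (e `^ (5 / 2) * ln e)%:C))
    =O_ (0^'+) (fun e : R => (e `^ (5 / 2))%:C) ->
  H = pi%:C * C0 - (s * (pi / 4))%:C.
Proof.
move=> hs z_inj z0 hz hdz hC /eqO_exP[k k0 hO].
have kE : k = (complex.Re k)%:C by rewrite RRe_real// gtr0_real.
have [d /= d0 hd] := hO.
pose e N : R := critical_radius N.
have [N1 hN1] := critical_radius_lt d0.
pose X N := first_moment (all_discs z (e N)) / (e N ^+ 2)%:C.
have e_gt0 N : (N1.+1 <= N)%N -> 0 < e N < d by move=> h; apply: hN1; exact: ltnW.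
have hX : ccvg \oo (fun N => X N - (q1 * (ln (e N))%:C + H + q2 * (Num.sqrt (e N) * ln (e N))%:C)) 0.
  apply: (@ccvg_squeeze _ _ _ _ _ _ (fun N => complex.Re k * Num.sqrt (e N))); last first.
    by have := cvgM (cvg_cst (complex.Re k)) cvg_sqrt_radius; rewrite mulr0; exact.
  apply/near_infty_ge; exists N1.+1 => N hN; have /andP[eN0 eNd] := e_gt0 N hN.
  have := hd (e N); rewrite /ball/= sub0r normrN (gtr0_norm eN0) => /(_ eNd eN0).
  rewrite complex_measureE plane_set_orbit//; first last.
  - exact: bounded_all_discs hs eN0 hz.
  - exact: measurable_all_discs.
  rewrite kE !normrE_cabs -rmorphM lecR cabs_real powR52//.
  have e20 : 0 < e N ^+ 2 by rewrite exprn_gt0.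
  rewrite normrM (gtr0_norm e20) (ger0_norm (sqrtr_ge0 _)).
  set A := first_moment _ => h.
  rewrite subr0 -(ler_pM2l e20) mulrCA; apply: le_trans h.
  rewrite -{1}(gtr0_norm e20) -cabs_real -cabsM le_eqVlt; apply/orP; left; apply/eqP; congr cabs.
  have eC : (e N ^+ 2)%:C != 0 :> R[i] by rewrite -cabs_eq0 cabs_real normr_eq0 gt_eqF.
  rewrite /X -/A !rmorphM/=; move: eC; rewrite !rmorphM/=.
  by move: ((e N)%:C : R[i]) => E E0; field; move: E0; rewrite mulf_eq0 orbb.
have hM := first_moment_limit hs z_inj z0 hz hdz.
rewrite -/e in hM.
have c2 : ccvg \oo (fun N => q2 * (Num.sqrt (e N) * ln (e N))%:C) 0.
  have := ccvgM (ccvg_cst q2) (ccvg_real cvg_sqrt_radius_ln); rewrite rmorph0 mulr0; exact.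
(* Because [ln e_N = - ln 2 - 2 ln N], the difference of the two expansions leaves [q * ln N]. It
   converges while [ln N] is unbounded, so [q = 0] and then its limit [L] is 0 as well. *)
pose q := (pi * s)%:C - 2 * q1.
pose L := - (s * crescent_log 1)%:C + pi%:C * C0 + q1 * (ln 2)%:C - H.
have hq : ccvg \oo (fun N => q * (ln N%:R)%:C) L.
  rewrite (_ : L = - (s * crescent_log 1)%:C + pi%:C * C0 + (q1 * (ln 2)%:C - H) - (0 + 0)); last first.
    by rewrite /L addr0 subr0 addrA.
  apply: (ccvg_near_eq _ (ccvgB (ccvgD (ccvgD hM (ccvgM (ccvg_cst pi%:C) hC)) (ccvg_cst (q1 * (ln 2)%:C - H))) (ccvgD hX c2))).
  apply/near_infty_ge; exists 1%N => N N0.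
  rewrite /X /e ln_critical_radius// /q; set A := first_moment _ / _; set S := \sum_(0 <= n < N) z n.
  by ring.
have q0 : q = 0.
  apply/eqP; rewrite -cabs_eq0; apply/negP => /negP qn; have q_gt0 : 0 < cabs q by rewrite lt_neqAle cabs_ge0 eq_sym qn.
  have /near_infty_ge[N2 h2] := hq 1 ltr01.
  have [b hb] := nat_gt (expR ((cabs L + 1) / cabs q)).
  have := h2 (N2 + b).+1 (leqW (leq_addr _ _)).
  set N := (N2 + b).+1; have N0 : 0 < N%:R :> R by [].
  have hl : (cabs L + 1) / cabs q < ln N%:R.
    rewrite -ltr_expR lnK ?posrE//; apply: lt_le_trans hb _.
    by rewrite ler_nat /N; apply: leq_trans (leq_addl N2 b) _.
  have l0 : 0 < ln N%:R :> R by apply: le_lt_trans hl; rewrite divr_ge0 ?addr_ge0 ?cabs_ge0.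
  have g := cabsB_ge (q * (ln N%:R)%:C) L.
  rewrite cabsM cabs_real (gtr0_norm l0) in g.
  rewrite ltr_pdivrMr// in hl; rewrite mulrC in hl.
  by move=> h3; lra.
have L0 : L = 0.
  have h0 : ccvg \oo (fun N : nat => q * (ln N%:R)%:C) 0.
    by apply: (ccvg_near_eq _ (ccvg_cst 0)); apply: nearW => n; rewrite q0 mul0r.
  exact: ccvg_unique hq h0.
move: q0 L0; rewrite /q /L crescent_log1 => /eqP; rewrite subr_eq0 => /eqP q0.
have q1E : q1 = (pi * s / 2)%:C.
  have p2 : pi * s = 2 * (pi * s / 2) :> R by field.
  apply: (@mulfI _ (2 : R[i])); first by rewrite pnatr_eq0.
  by rewrite -q0 [in LHS]p2 rmorphM rmorph_nat.
rewrite q1E => /eqP; rewrite subr_eq0 => /eqP <-.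
(* With [q1 = pi s / 2], the [ln 2] coming from the radii cancels the one in [crescent_log 1]. *)
have p2 : (pi * s / 2)%:C * (ln 2)%:C = (s * (pi / 2 * ln 2))%:C :> R[i].
  by rewrite -rmorphM; congr (_%:C); ring.
by rewrite p2 mulrDr rmorphD; ring.
Qed.

End PrincipalValue.

(** * Power series *)
Section PowerSeries.
Context {R : realType}.
Implicit Types (c d : nat -> R[i]) (w l : R[i]) (r B : R) (n k K : nat).

Definition power_sum c w l := ccvg \oo (series (fun n => c n * w ^+ n)) l.

(** Absolute convergence on the closed disc of radius [r], with an explicit bound on all partial
    sums: such bounds add, multiply, compose and pass to coefficientwise limits. *)
Definition majorized c B r := forall K, \sum_(0 <= k < K) cabs (c k) * r ^+ k <= B.

Lemma majorized_ge0 c B r : majorized c B r -> 0 <= B.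
Proof. by move=> /(_ 0%N); rewrite big_geq. Qed.

Lemma majorized_mono c B r B' r' : 0 <= r' <= r -> B <= B' -> majorized c B r -> majorized c B' r'.
Proof.
move=> /andP[r0 rr] BB H K; apply: le_trans BB; apply: le_trans (H K).
by apply: ler_sum => k _; rewrite ler_wpM2l ?cabs_ge0// lerXn2r// nnegrE (le_trans r0).
Qed.

Lemma majorized_partial c B r w K : majorized c B r -> cabs w <= r ->
  cabs (\sum_(0 <= k < K) c k * w ^+ k) <= B.
Proof.
move=> H wr; apply: le_trans (cabs_sum _ _ _) _; apply: le_trans (H K).
apply: ler_sum => k _; rewrite cabsM cabsX ler_wpM2l ?cabs_ge0//.
by rewrite lerXn2r// nnegrE ?cabs_ge0// (le_trans (cabs_ge0 w)).
Qed.

Lemma majorized_tail c B r w K N : 0 < r -> majorized c B r -> cabs w <= r ->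
  cabs (\sum_(K <= k < N) c k * w ^+ k) <= B * (cabs w / r) ^+ K.
Proof.
move=> r0 H wr; have B0 := majorized_ge0 H.
have q0 : 0 <= cabs w / r by rewrite divr_ge0 ?cabs_ge0// ltW.
have q1 : cabs w / r <= 1 by rewrite ler_pdivrMr// mul1r.
have [NK|KN] := leqP N K; first by rewrite big_geq// cabs0 mulr_ge0// exprn_ge0.
apply: le_trans (cabs_sum _ _ _) _.
apply: (@le_trans _ _ (\sum_(K <= k < N) cabs (c k) * r ^+ k * (cabs w / r) ^+ K)).
  rewrite big_nat_cond [leRHS]big_nat_cond; apply: ler_sum => k /andP[/andP[Kk _] _].
  rewrite cabsM cabsX -mulrA ler_wpM2l ?cabs_ge0//.
  have -> : cabs w ^+ k = r ^+ k * (cabs w / r) ^+ k.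
    by rewrite -exprMn mulrCA divff ?gt_eqF// mulr1.
  by rewrite ler_wpM2l ?exprn_ge0 ?(ltW r0)// ler_wiXn2l.
rewrite -mulr_suml ler_wpM2r ?exprn_ge0//; apply: le_trans (H N).
rewrite (big_cat_nat (leq0n K) (ltnW KN))/= ler_wpDl// sumr_ge0// => k _.
by rewrite mulr_ge0 ?cabs_ge0// exprn_ge0// ltW.
Qed.

Lemma seriesE (u : nat -> R[i]) : series u = fun n => \sum_(0 <= k < n) u k.
Proof. by []. Qed.

Lemma power_sum_exists c B r w : 0 < r -> majorized c B r -> cabs w <= r -> exists l, power_sum c w l.
Proof.
move=> r0 H wr; apply: (@normal_series_cvg _ _ (fun k => cabs (c k) * r ^+ k)).
  move=> k; rewrite cabsM cabsX ler_wpM2l ?cabs_ge0// lerXn2r// nnegrE ?cabs_ge0//.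
  exact: ltW.
apply: nondecreasing_is_cvgn.
  by apply: nondecreasing_series => k _ _; rewrite mulr_ge0 ?cabs_ge0// exprn_ge0// ltW.
by exists B => _ [K _ <-]; exact: H.
Qed.

Lemma ccvg_le (u : nat -> R[i]) l (B : R) : ccvg \oo u l -> (\forall n \near \oo, cabs (u n) <= B) -> cabs l <= B.
Proof.
move=> h1 h2; rewrite leNgt; apply/negP => h3.
have e0 : 0 < cabs l - B by rewrite subr_gt0.
have [n [g1 g2]] := filter_ex (filterI h2 (h1 _ e0)).
by have := cabsB_ge l (u n); rewrite (cdistC l); lra.
Qed.

Lemma power_sum_le c B r w l : majorized c B r -> cabs w <= r -> power_sum c w l -> cabs l <= B.
Proof.
move=> H wr hl; apply: (ccvg_le hl); apply: nearW => K; exact: majorized_partial.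
Qed.

Lemma power_sum_tail c B r w l K : 0 < r -> majorized c B r -> cabs w <= r -> power_sum c w l ->
  cabs (l - \sum_(0 <= k < K) c k * w ^+ k) <= B * (cabs w / r) ^+ K.
Proof.
move=> r0 H wr hl.
apply: (ccvg_le (ccvgB hl (ccvg_cst (\sum_(0 <= k < K) c k * w ^+ k)))); exists K => // N /= KN.
rewrite seriesE (big_cat_nat (leq0n K) KN)/= addrAC subrr add0r.
exact: majorized_tail.
Qed.

Lemma power_sum_unique c w l l' : power_sum c w l -> power_sum c w l' -> l = l'.
Proof. exact: ccvg_unique. Qed.

Lemma expr_small (q B e : R) : 0 <= q < 1 -> 0 < e -> exists K, B * q ^+ K < e.
Proof.
move=> /andP[q0 q1] e0.
have := @cvg_expr R q; rewrite ger0_norm// => /(_ q1) h.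
have {}h : (fun n => B * q ^+ n) @ \oo --> (0 : R).
  by rewrite -(mulr0 B); apply: cvgM => //; exact: cvg_cst.
move/cvgrPdist_lt : h => /(_ e e0)[N _ hN].
exists N; have := hN N (leqnn N); rewrite /= sub0r normrN; apply: le_lt_trans.
exact: ler_norm.
Qed.

(* Tannery's theorem. *)
Lemma power_sum_limit (D : nat -> nat -> R[i]) d B r w (L : nat -> R[i]) l : 0 < r ->
  (forall N, majorized (D N) B r) -> (forall k, ccvg \oo (D ^~ k) (d k)) -> cabs w < r ->
  (forall N, power_sum (D N) w (L N)) -> ccvg \oo L l ->
  majorized d B r /\ power_sum d w l.
Proof.
move=> r0 HD Hd wr HL Hl.
have fin (f : nat -> nat -> R[i]) (g : nat -> R[i]) K : (forall k, ccvg \oo (f ^~ k) (g k)) ->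
    ccvg \oo (fun N => \sum_(0 <= k < K) f N k) (\sum_(0 <= k < K) g k).
  move=> fg; elim: K => [|K IH].
    apply: (ccvg_near_eq _ (ccvg_cst (\sum_(0 <= k < 0) g k))); apply: nearW => N.
    by rewrite !big_geq.
  rewrite big_nat_recr//=; apply: (ccvg_near_eq _ (ccvgD IH (fg K))); apply: nearW => N.
  by rewrite big_nat_recr.
have md : majorized d B r.
  move=> K; apply/ler_addgt0Pr => e e0.
  have cK : (fun N => \sum_(0 <= k < K) cabs (D N k) * r ^+ k) @ \oo --> \sum_(0 <= k < K) cabs (d k) * r ^+ k.
    elim: K => [|K IH].
      by rewrite big_geq//; apply: cvg_near_cst; apply: nearW => N; rewrite big_geq.
    rewrite big_nat_recr//=.
    rewrite (_ : (fun N => _) = (fun N => \sum_(0 <= k < K) cabs (D N k) * r ^+ k + cabs (D N K) * r ^+ K)).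
      by apply: cvgD => //; apply: cvgM; [exact: ccvg_cabs|exact: cvg_cst].
    by apply/funext => N; rewrite big_nat_recr.
  move/cvgrPdist_lt : cK => /(_ e e0)[N _ hN].
  have := hN N (leqnn N) => /=; have := HD N K => h1 h2.
  have := ler_norm (\sum_(0 <= k < K) cabs (d k) * r ^+ k - \sum_(0 <= k < K) cabs (D N k) * r ^+ k).
  lra.
split => //.
have [l' hl'] := power_sum_exists r0 md (ltW wr).
suff <- : l' = l by [].
apply: ccvg_unique Hl => /= e e0.
have B0 := majorized_ge0 md.
have q01 : 0 <= cabs w / r < 1.
  by rewrite divr_ge0 ?cabs_ge0 ?(ltW r0)//= ltr_pdivrMr// mul1r.
have e3 : 0 < e / 3 by rewrite divr_gt0.
have [K hK] := expr_small B q01 e3.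
have h : ccvg \oo (fun N => \sum_(0 <= k < K) D N k * w ^+ k) (\sum_(0 <= k < K) d k * w ^+ k).
  apply: (fin (fun N k => D N k * w ^+ k) (fun k => d k * w ^+ k)) => k.
  exact: ccvgM (Hd k) (ccvg_cst (w ^+ k)).
apply: filterS (h _ e3) => N hN.
have t1 := power_sum_tail K r0 (HD N) (ltW wr) (HL N).
have t2 := power_sum_tail K r0 md (ltW wr) hl'.
set S1 := \sum_(0 <= k < K) _ in hN t1; set S2 := \sum_(0 <= k < K) _ in hN t2.
have := cdist_triangle S1 (L N) l'; have := cdist_triangle S2 S1 l'.
rewrite (cdistC S2 l'); lra.
Qed.

Lemma power_sumD c d w l l' : power_sum c w l -> power_sum d w l' ->
  power_sum (fun n => c n + d n) w (l + l').
Proof.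
move=> h1 h2; apply: (ccvg_near_eq _ (ccvgD h1 h2)); apply: nearW => N.
by rewrite !seriesE -big_split/=; apply: eq_bigr => k _; rewrite mulrDl.
Qed.

Lemma power_sumZ a c w l : power_sum c w l -> power_sum (fun n => a * c n) w (a * l).
Proof.
move=> h; apply: (ccvg_near_eq _ (ccvgM (ccvg_cst a) h)); apply: nearW => N.
by rewrite !seriesE mulr_sumr; apply: eq_bigr => k _; rewrite mulrA.
Qed.

Lemma majorizedD c d B B' r : majorized c B r -> majorized d B' r -> 0 <= r ->
  majorized (fun n => c n + d n) (B + B') r.
Proof.
move=> h1 h2 r0 K; apply: le_trans (lerD (h1 K) (h2 K)); rewrite -big_split/=.
by apply: ler_sum => k _; rewrite -mulrDl ler_wpM2r ?exprn_ge0// cabsD.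
Qed.

Lemma majorizedZ a c B r : majorized c B r -> majorized (fun n => a * c n) (cabs a * B) r.
Proof.
move=> h K; apply: le_trans (ler_wpM2l (cabs_ge0 a) (h K)); rewrite mulr_sumr.
by apply: ler_sum => k _; rewrite cabsM mulrA.
Qed.

Definition cauchy_product c d n : R[i] := \sum_(k < n.+1) c k * d (n - k)%N.

(** Partial sums are values of polynomials, so the product of two of them is governed by the
    coefficients of a polynomial product; the ring is generic in order to apply this to moduli in
    [R] too. *)
Definition trunc (T : nzRingType) (c : nat -> T) K : {poly T} := \poly_(k < K) c k.

Lemma horner_trunc (T : comNzRingType) (c : nat -> T) K (x : T) :
  (trunc c K).[x] = \sum_(0 <= k < K) c k * x ^+ k.
Proof. by rewrite horner_poly big_mkord. Qed.

Lemma coef_trunc_mul (T : comNzRingType) (c d : nat -> T) K n : (n < K)%N ->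
  (trunc c K * trunc d K)`_n = \sum_(k < n.+1) c k * d (n - k)%N.
Proof.
move=> nK; rewrite coefM; apply: eq_bigr => k _; rewrite !coef_poly.
have kK : (k < K)%N by apply: leq_ltn_trans nK; rewrite -ltnS.
by rewrite kK (leq_ltn_trans (leq_subr _ _) nK).
Qed.

Lemma horner_trunc_mul (T : comNzRingType) (c d : nat -> T) K (x : T) :
  (\sum_(0 <= k < K) c k * x ^+ k) * (\sum_(0 <= k < K) d k * x ^+ k) =
  \sum_(0 <= n < K + K) (trunc c K * trunc d K)`_n * x ^+ n.
Proof.
rewrite -(horner_trunc c) -(horner_trunc d) -hornerM (@horner_coef_wide _ (K + K)); first by rewrite big_mkord.
apply: leq_trans (size_polyMleq _ _) _; apply: leq_trans (leq_pred _) _ => /=.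
by apply: leq_add; exact: size_poly.
Qed.

Lemma coef_trunc_cabs c d K n :
  cabs (trunc c K * trunc d K)`_n <= (trunc (fun k => cabs (c k)) K * trunc (fun k => cabs (d k)) K)`_n.
Proof.
rewrite !coefM; apply: le_trans (cabs_sum _ _ _) _; apply: ler_sum => k _.
rewrite cabsM !coef_poly; do 2 case: ifP => _; rewrite ?cabs0//.
Qed.

Lemma trunc_product_majorized c d B B' r K : majorized c B r -> majorized d B' r -> 0 <= r ->
  \sum_(0 <= n < K + K) cabs (trunc c K * trunc d K)`_n * r ^+ n <= B * B'.
Proof.
move=> h1 h2 r0.
apply: (@le_trans _ _ (\sum_(0 <= n < K + K) (trunc (fun k => cabs (c k)) K * trunc (fun k => cabs (d k)) K)`_n * r ^+ n)).
  by apply: ler_sum => n _; rewrite ler_wpM2r ?exprn_ge0// coef_trunc_cabs.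
rewrite -horner_trunc_mul ler_pM// sumr_ge0// => k _; by rewrite mulr_ge0 ?cabs_ge0 ?exprn_ge0.
Qed.

Lemma majorizedM c d B B' r : majorized c B r -> majorized d B' r -> 0 <= r ->
  majorized (cauchy_product c d) (B * B') r.
Proof.
move=> h1 h2 r0 K; apply: le_trans (trunc_product_majorized K h1 h2 r0).
rewrite (big_cat_nat (leq0n K) (leq_addr K K))/= ler_wpDr//.
  by rewrite sumr_ge0// => k _; rewrite mulr_ge0 ?cabs_ge0 ?exprn_ge0.
rewrite big_nat_cond [leRHS]big_nat_cond; apply: ler_sum => n /andP[/andP[_ nK] _].
by rewrite coef_trunc_mul.
Qed.

(** The product of the two partial sums of length [K] has [2 K] coefficients. The first [K] are
    those of the Cauchy product; the others form a tail bounded by [B B' (cabs w / r)^K]. *)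
Lemma power_sumM c d B B' r w l l' : 0 < r -> majorized c B r -> majorized d B' r -> cabs w < r ->
  power_sum c w l -> power_sum d w l' -> power_sum (cauchy_product c d) w (l * l').
Proof.
move=> r0 h1 h2 wr hl hl'.
have q01 : 0 <= cabs w / r < 1.
  by rewrite divr_ge0 ?cabs_ge0 ?(ltW r0)//= ltr_pdivrMr// mul1r.
have E K : series (fun n => c n * w ^+ n) K * series (fun n => d n * w ^+ n) K =
   series (fun n => cauchy_product c d n * w ^+ n) K + \sum_(K <= n < K + K) (trunc c K * trunc d K)`_n * w ^+ n.
  rewrite !seriesE horner_trunc_mul (big_cat_nat (leq0n K) (leq_addr K K))/=; congr (_ + _).
  by apply: eq_big_nat => n /andP[_ nK]; rewrite coef_trunc_mul.
have tail : ccvg \oo (fun K => \sum_(K <= n < K + K) (trunc c K * trunc d K)`_n * w ^+ n) 0.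
  apply: (@ccvg_squeeze _ _ _ _ _ _ (fun K => B * B' * (cabs w / r) ^+ K)); last first.
    have := @cvg_expr R (cabs w / r); case/andP: q01 => q0 q1; rewrite ger0_norm// => /(_ q1) h.
    by have := cvgM (cvg_cst (B * B')) h; rewrite mulr0; exact.
  apply: nearW => K; rewrite subr0.
  (* Cutting at [K + K] gives one sequence majorized for sums of every length, to which the tail
     estimate applies. *)
  pose f n : R[i] := if (n < K + K)%N then (trunc c K * trunc d K)`_n else 0.
  have mf : majorized f (B * B') r.
    move=> N; apply: le_trans (trunc_product_majorized K h1 h2 (ltW r0)).
    have [NK|KN] := leqP N (K + K).
      rewrite [leRHS](big_cat_nat (leq0n N) NK)/= ler_wpDr//.
        by rewrite sumr_ge0// => k _; rewrite mulr_ge0 ?cabs_ge0 ?exprn_ge0 ?(ltW r0).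
      rewrite big_nat_cond [leRHS]big_nat_cond; apply: ler_sum => n /andP[/andP[_ nN] _].
      by rewrite /f (leq_trans nN NK).
    rewrite (big_cat_nat (leq0n (K + K)) (ltnW KN))/= [X in _ + X]big_nat_cond [X in _ + X]big1 ?addr0.
      by rewrite big_nat_cond [leRHS]big_nat_cond; apply: ler_sum => n /andP[/andP[_ nN] _]; rewrite /f nN.
    by move=> n /andP[/andP[nK _] _]; rewrite /f ltnNge nK cabs0 mul0r.
  have := majorized_tail K (K + K) r0 mf (ltW wr); apply: le_trans.
  rewrite le_eqVlt; apply/orP; left; apply/eqP; congr cabs.
  by apply: eq_big_nat => n /andP[_ nN]; rewrite /f nN.
rewrite -[l * l']subr0; apply: (ccvg_near_eq _ (ccvgB (ccvgM hl hl') tail)); apply: nearW => K.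
by rewrite E addrK.
Qed.

End PowerSeries.

(** * Composition of power series and analytic functions *)

Section Composition.
Context {R : realType}.
Implicit Types (a b c d : nat -> R[i]) (w l v : R[i]) (r A B rho : R) (n k K : nat)
  (h g : R[i] -> R[i]) (z : R[i]).

Definition const_coef v : nat -> R[i] := fun k => if k == 0 then v else 0.

Lemma sum_const_coef (T : nmodType) (f : nat -> T) K : (forall k, (0 < k)%N -> f k = 0) -> (0 < K)%N ->
  \sum_(0 <= k < K) f k = f 0%N.
Proof.
move=> f0; case: K => // K _; rewrite big_nat_recl// big_nat_cond big1 ?addr0//.
by move=> k _; rewrite f0.
Qed.

Lemma majorized_const v r : 0 <= r -> majorized (const_coef v) (cabs v) r.
Proof.
move=> r0 [|K]; first by rewrite big_geq// cabs_ge0.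
rewrite sum_const_coef ?expr0 ?mulr1// => k k0.
by rewrite /const_coef gtn_eqF// cabs0 mul0r.
Qed.

Lemma power_sum_const v w : power_sum (const_coef v) w v.
Proof.
apply: (ccvg_near_eq _ (ccvg_cst v)); exists 1%N => // K /= K0.
rewrite seriesE sum_const_coef ?expr0 ?mulr1// => k k0.
by rewrite /const_coef gtn_eqF// mul0r.
Qed.

Fixpoint cauchy_power b n : nat -> R[i] :=
  if n is m.+1 then cauchy_product b (cauchy_power b m) else const_coef 1.

Lemma majorized_power b B r n : majorized b B r -> 0 <= r -> majorized (cauchy_power b n) (B ^+ n) r.
Proof.
move=> h r0; elim: n => [|n IH] /=; last by rewrite exprS; exact: majorizedM.
by rewrite expr0 -(@cabs1 R); exact: majorized_const.
Qed.

Lemma power_sum_power b B r n w l : 0 < r -> majorized b B r -> cabs w < r -> power_sum b w l ->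
  power_sum (cauchy_power b n) w (l ^+ n).
Proof.
move=> r0 h wr hl; elim: n => [|n IH] /=; first by rewrite expr0; exact: power_sum_const.
rewrite exprS; apply: (power_sumM r0 h _ wr hl IH); exact: (majorized_power n h (ltW r0)).
Qed.

Lemma majorized_coef c B r k : 0 < r -> majorized c B r -> cabs (c k) <= B / r ^+ k.
Proof.
move=> r0 h; rewrite ler_pdivlMr ?exprn_gt0//; apply: le_trans (h k.+1).
by rewrite big_nat_recr//= ler_wpDl// sumr_ge0// => i _; rewrite mulr_ge0 ?cabs_ge0 ?exprn_ge0 ?(ltW r0).
Qed.

(** [D N k] is the coefficient of [w^k] in the first [N] terms of the outer series. The [n]-th power
    of the inner series is majorized by [rho^n], so every [D N] is majorized by [A] and Tannery's
    theorem applies. [d] depends on the coefficients alone and serves all [w]. *)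
Lemma power_sum_comp a A rho b r : 0 < r -> majorized a A rho -> majorized b rho r ->
  exists d, forall w v l, cabs w < r -> power_sum b w v -> power_sum a v l ->
    majorized d A r /\ power_sum d w l.
Proof.
move=> r0 ha hb.
have rho0 := majorized_ge0 hb.
pose D N k : R[i] := \sum_(0 <= n < N) a n * cauchy_power b n k.
have DS N : D N.+1 = fun k => D N k + a N * cauchy_power b N k.
  by apply/funext => k; rewrite /D big_nat_recr.
have mD N : majorized (D N) (\sum_(0 <= n < N) cabs (a n) * rho ^+ n) r.
  elim: N => [|N IH].
    move=> K; rewrite [leRHS]big_geq// big1// => k _; by rewrite /D big_geq// cabs0 mul0r.
  rewrite DS big_nat_recr//=; apply: majorizedD => //; last exact: ltW.
  by apply: majorizedZ; exact: (majorized_power N hb (ltW r0)).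
have mDA N : majorized (D N) A r.
  by apply: (majorized_mono _ (ha N) (mD N)); rewrite lexx andbT ltW.
have lim k : exists dk, ccvg \oo (D ^~ k) dk.
  apply: (@normal_series_cvg _ _ (fun n => cabs (a n) * (rho ^+ n / r ^+ k))).
    move=> n; rewrite cabsM ler_wpM2l ?cabs_ge0//.
    exact: majorized_coef r0 (majorized_power n hb (ltW r0)).
  apply: nondecreasing_is_cvgn.
    apply: nondecreasing_series => n _ _; rewrite mulr_ge0 ?cabs_ge0//.
    by rewrite divr_ge0 ?exprn_ge0// ltW.
  exists (A / r ^+ k) => _ [N _ <-].
  rewrite /series/=; under eq_bigr do rewrite mulrA.
  by rewrite -mulr_suml ler_wpM2r ?invr_ge0 ?exprn_ge0 ?(ltW r0)//; exact: ha.
have [d hd] := choice lim.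
exists d => w v l wr hv hl.
apply: (power_sum_limit r0 mDA hd wr _ hl) => N.
rewrite seriesE; elim: N => [|N IH].
  apply: (ccvg_near_eq _ (ccvg_cst (\sum_(0 <= k < 0) a k * v ^+ k))); apply: nearW => K.
  by rewrite seriesE [in LHS]big_geq// big1// => k _; rewrite /D big_geq// mul0r.
rewrite DS big_nat_recr//=; apply: power_sumD => //; apply: power_sumZ.
exact: power_sum_power r0 hb wr hv.
Qed.

Definition has_power_series (h : R[i] -> R[i]) z c B r :=
  [/\ 0 < r, majorized c B r & forall w, cabs w < r -> power_sum c w (h (z + w))].

Lemma has_power_series_shrink h z c B r r' : 0 < r' <= r -> has_power_series h z c B r ->
  has_power_series h z c B r'.
Proof.
move=> /andP[r0' rr] [r0 hc hs]; split => //; first by apply: (majorized_mono _ (lexx B) hc); rewrite ltW.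
by move=> w wr; apply: hs; exact: lt_le_trans wr rr.
Qed.

Lemma sum_half_powers K : \sum_(0 <= k < K) (2^-1 : R) ^+ k <= 2.
Proof.
suff -> : \sum_(0 <= k < K) (2^-1 : R) ^+ k = 2 - 2 * 2^-1 ^+ K.
  by rewrite gerBl mulr_ge0// exprn_ge0// invr_ge0.
elim: K => [|K IH]; first by rewrite big_geq// expr0 mulr1 subrr.
by rewrite big_nat_recr//= IH exprS mulrA divff ?mul1r ?pnatr_eq0//; ring.
Qed.

Lemma majorized_bounded c r M : 0 < r -> 0 <= M -> (forall n, cabs (c n) * r ^+ n <= M) ->
  majorized c (2 * M) (r / 2).
Proof.
move=> r0 M0 h K; apply: (@le_trans _ _ (\sum_(0 <= k < K) M * 2^-1 ^+ k)).
  by apply: ler_sum => k _; rewrite exprMn mulrA ler_wpM2r// exprn_ge0// invr_ge0.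
by rewrite -mulr_sumr mulrC ler_wpM2r// sum_half_powers.
Qed.

Lemma power_sum_bounded c w l : power_sum c w l -> exists2 M, 0 <= M & forall n, cabs (c n) * cabs w ^+ n <= M.
Proof.
move=> h; have [N _ HN] := h 1 ltr01.
exists (2 + \sum_(0 <= k < N) cabs (c k) * cabs w ^+ k).
  by rewrite addr_ge0// sumr_ge0// => k _; rewrite mulr_ge0 ?exprn_ge0 ?cabs_ge0.
have S0 : 0 <= \sum_(0 <= k < N) cabs (c k) * cabs w ^+ k.
  by rewrite sumr_ge0// => k _; rewrite mulr_ge0 ?exprn_ge0 ?cabs_ge0.
move=> n; have [nN|Nn] := ltnP n N.
  rewrite (bigD1_seq n) ?mem_index_iota ?iota_uniq//=.
  have : 0 <= \sum_(0 <= k < N | k != n) cabs (c k) * cabs w ^+ k.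
    by rewrite sumr_ge0// => k _; rewrite mulr_ge0 ?exprn_ge0 ?cabs_ge0.
  lra.
have h1 := HN n Nn; have h2 := HN n.+1 (leqW Nn).
rewrite /= seriesE big_nat_recr//= in h2; rewrite /= seriesE in h1.
rewrite -cabsX -cabsM; set S := \sum_(0 <= k < n) _ in h1 h2; set t := c n * w ^+ n in h2 *.
have := cdist_triangle l (S + t) S; rewrite (cdistC l S) addrAC subrr add0r; lra.
Qed.

(** Abel's lemma: [analytic_at] asks for pointwise convergence near [z], but convergence at one
    point bounds the terms, and at half its distance they are dominated by a geometric series. *)
Lemma power_series_near c h z :
  (\forall w \near z, series (fun n => c n * (w - z) ^+ n) @ \oo --> h w) ->
  exists B r, has_power_series h z c B r.
Proof.
move=> /nbhs_cabsP[e e0 H].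
have P w : cabs w < e -> power_sum c w (h (z + w)).
  move=> we; apply/ccvgP; have := H (z + w); rewrite [z + w]addrC addrK; exact.
have e20 : 0 < e / 2 by rewrite divr_gt0.
have ce : cabs (e / 2)%:C = e / 2 :> R by rewrite cabs_real gtr0_norm.
have [|M M0 HM] := @power_sum_bounded c (e / 2)%:C _ (P _ _); first by rewrite ce; lra.
rewrite ce in HM.
exists (2 * M), (e / 2 / 2); split; [by rewrite divr_gt0|exact: majorized_bounded|].
by move=> w we; apply: P; lra.
Qed.

Lemma analytic_atP h z : analytic_at h z <-> exists c B r, has_power_series h z c B r.
Proof.
split=> [[c /power_series_near H]|[c [B [r [r0 hc hs]]]]]; first by exists c.
exists c; apply/nbhs_cabsP; exists r => // w wr; apply/ccvgP.
by have := hs (w - z) wr; rewrite subrKC.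
Qed.

Lemma has_power_series0 h z c B r : has_power_series h z c B r -> h z = c 0%N.
Proof.
move=> [r0 hc hs]; have := hs 0; rewrite cabs0 addr0 => /(_ r0) h0.
apply: (power_sum_unique h0); apply: (ccvg_near_eq _ (ccvg_cst (c 0%N))); exists 1%N => // K /= K0.
rewrite seriesE sum_const_coef ?expr0 ?mulr1// => k k0.
by rewrite expr0n gtn_eqF// mulr0.
Qed.

Lemma analytic_cst v z : analytic_at (fun=> v) z.
Proof.
apply/analytic_atP; exists (const_coef v), (cabs v), 1; split => //.
  exact: majorized_const.
by move=> w _; exact: power_sum_const.
Qed.

Definition affine_coef v : nat -> R[i] := fun k => if k == 0 then v else if k == 1 then 1 else 0.

Lemma majorized_affine v r : 0 <= r -> majorized (affine_coef v) (cabs v + r) r.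
Proof.
move=> r0 [|[|K]].
- by rewrite big_geq// addr_ge0 ?cabs_ge0.
- by rewrite big_nat1 expr0 mulr1 lerDl.
rewrite big_nat_recl// sum_const_coef//; last first.
  by case=> // k _; rewrite /affine_coef cabs0 mul0r.
by rewrite /affine_coef eqxx expr0 expr1 mulr1 cabs1 mul1r.
Qed.

Lemma power_sum_affine v w : power_sum (affine_coef v) w (v + w).
Proof.
apply: (ccvg_near_eq _ (ccvg_cst (v + w))); exists 2 => // -[|[|K]]//= _.
rewrite seriesE big_nat_recl// sum_const_coef//=; last first.
  by move=> k k0; rewrite /affine_coef/= eqSS gtn_eqF// mul0r.
by rewrite /affine_coef/= expr0 expr1 mulr1 mul1r.
Qed.

Lemma analytic_id z : analytic_at id z.
Proof.
apply/analytic_atP; exists (affine_coef z), (cabs z + 1), 1; split => //.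
  exact: majorized_affine.
by move=> w _; exact: power_sum_affine.
Qed.

Lemma analyticD h g z : analytic_at h z -> analytic_at g z -> analytic_at (fun w => h w + g w) z.
Proof.
move=> /analytic_atP[c [B [r Hc]]] /analytic_atP[d [B' [r' Hd]]].
have [[r0 _ _] [r0' _ _]] := (Hc, Hd).
have [h1 h2] : 0 < Num.min r r' <= r /\ 0 < Num.min r r' <= r'.
  by rewrite lt_min r0 r0' !ge_min !lexx orbT.
have [m0 mc sc] := has_power_series_shrink h1 Hc; have [_ md sd] := has_power_series_shrink h2 Hd.
apply/analytic_atP; exists (fun n => c n + d n), (B + B'), (Num.min r r'); split => //.
  exact: majorizedD mc md (ltW m0).
by move=> w wr; apply: power_sumD; [exact: sc|exact: sd].
Qed.

Lemma analyticM h g z : analytic_at h z -> analytic_at g z -> analytic_at (fun w => h w * g w) z.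
Proof.
move=> /analytic_atP[c [B [r Hc]]] /analytic_atP[d [B' [r' Hd]]].
have [[r0 _ _] [r0' _ _]] := (Hc, Hd).
have [h1 h2] : 0 < Num.min r r' <= r /\ 0 < Num.min r r' <= r'.
  by rewrite lt_min r0 r0' !ge_min !lexx orbT.
have [m0 mc sc] := has_power_series_shrink h1 Hc; have [_ md sd] := has_power_series_shrink h2 Hd.
apply/analytic_atP; exists (cauchy_product c d), (B * B'), (Num.min r r'); split => //.
  exact: majorizedM mc md (ltW m0).
by move=> w wr; apply: (power_sumM m0 mc md wr); [exact: sc|exact: sd].
Qed.

Lemma analytic_near_eq h g z : (\forall w \near z, h w = g w) -> analytic_at h z -> analytic_at g z.
Proof. by move=> E [c H]; exists c; apply: filterS2 E H => w ->. Qed.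

Lemma analyticN h z : analytic_at h z -> analytic_at (fun w => - h w) z.
Proof.
move=> hh; rewrite (_ : (fun w => - h w) = (fun w => -1 * h w)); first exact: analyticM (analytic_cst (-1) z) hh.
by apply/funext => w; rewrite mulN1r.
Qed.

Lemma analyticB h g z : analytic_at h z -> analytic_at g z -> analytic_at (fun w => h w - g w) z.
Proof. by move=> hh hg; exact: analyticD hh (analyticN hg). Qed.

(** Without constant term, scaling the radius by [q <= 1] scales the bound by at least the same
    factor. *)
Lemma majorized_small_tail c B r eps : 0 < r -> majorized c B r -> c 0%N = 0 -> 0 < eps ->
  exists2 r', 0 < r' <= r & majorized c eps r'.
Proof.
move=> r0 hc c0 e0; have B0 := majorized_ge0 hc.
pose q := Num.min 1 (eps / (B + 1)).
have q0 : 0 < q by rewrite lt_min ltr01 divr_gt0// ltr_wpDl.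
have q1 : q <= 1 by rewrite ge_min lexx.
have qe : q * B <= eps.
  apply: (@le_trans _ _ (eps / (B + 1) * B)); first by rewrite ler_wpM2r// ge_min lexx orbT.
  by rewrite mulrAC ler_pdivrMr ?ltr_wpDl// ler_pM2l// lerDl.
exists (q * r); first by rewrite mulr_gt0//= ger_pMl.
move=> K; apply: le_trans qe; apply: le_trans (ler_wpM2l (ltW q0) (hc K)).
rewrite mulr_sumr; apply: ler_sum => -[|k] _; first by rewrite c0 cabs0 !mul0r mulr0.
rewrite mulrCA ler_wpM2l ?cabs_ge0// exprMn ler_wpM2r ?exprn_ge0 ?(ltW r0)//.
by rewrite exprS ger_pMr// exprn_ile1// ltW.
Qed.

Lemma analytic_comp h g z : analytic_at g z -> analytic_at h (g z) -> analytic_at (fun w => h (g w)) z.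
Proof.
move=> /analytic_atP[b [B [r Hb]]] /analytic_atP[a [A [rho [rho0 ma sa]]]].
have b0 := has_power_series0 Hb; have [r0 mb sb] := Hb.
(* Removing the constant term lets the majorant of the inner series shrink below the radius of the
   outer one. *)
pose b' n := b n + const_coef (- g z) n.
have mb' : majorized b' (B + cabs (- g z)) r.
  by apply: majorizedD => //; [exact: majorized_const (ltW r0)|exact: ltW].
have b'0 : b' 0%N = 0 by rewrite /b' /const_coef/= -b0 subrr.
have sb' w : cabs w < r -> power_sum b' w (g (z + w) - g z).
  by move=> wr; apply: power_sumD; [exact: sb|exact: power_sum_const].
have rho2 : 0 < rho / 2 by rewrite divr_gt0.
have [r' /andP[r'0 rr] mb2] := majorized_small_tail r0 mb' b'0 rho2.
have ma2 : majorized a A (rho / 2) by apply: (majorized_mono _ (lexx A) ma); lra.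
have [d Hd] := power_sum_comp r'0 ma2 mb2.
have H w : cabs w < r' -> majorized d A r' /\ power_sum d w (h (g (z + w))).
  move=> wr; have sw := sb' w (lt_le_trans wr rr).
  have gw : cabs (g (z + w) - g z) < rho.
    by have := power_sum_le mb2 (ltW wr) sw; lra.
  apply: (Hd w _ _ wr sw); have := sa _ gw; by rewrite subrKC.
apply/analytic_atP; exists d, A, r'; split => //; last by move=> w /H[].
by have [] := H 0; rewrite ?cabs0.
Qed.

(** Recentering at [z1] is composition with the affine series [(z1 - z) + w]. *)
Lemma analytic_near h z : analytic_at h z -> \forall w \near z, analytic_at h w.
Proof.
move=> /analytic_atP[a [A [rho [rho0 ma sa]]]]; apply/nbhs_cabsP.
have rho2 : 0 < rho / 2 by rewrite divr_gt0.
have rho4 : 0 < rho / 4 by rewrite divr_gt0.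
exists (rho / 4) => // z1 hz1.
have ma2 : majorized a A (rho / 2) by apply: (majorized_mono _ (lexx A) ma); lra.
have mb : majorized (affine_coef (z1 - z)) (rho / 2) (rho / 4).
  apply: (majorized_mono _ _ (majorized_affine (z1 - z) (ltW rho4))); lra.
have [d Hd] := power_sum_comp rho4 ma2 mb.
have H w : cabs w < rho / 4 -> majorized d A (rho / 4) /\ power_sum d w (h (z1 + w)).
  move=> wr; have sw := power_sum_affine (z1 - z) w.
  have gw : cabs (z1 - z + w) < rho by have := cabsD (z1 - z) w; lra.
  apply: (Hd w _ _ wr sw); have := sa _ gw; by rewrite addrA [z + _]subrKC.
apply/analytic_atP; exists d, A, (rho / 4); split => //; last by move=> w /H[].
by have [] := H 0; rewrite ?cabs0.
Qed.

Lemma analytic_ccvg h z : analytic_at h z -> ccvg (nbhs z) h (h z).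
Proof.
move=> /analytic_atP[c [B [r Hc]]] e e0; have c0 := has_power_series0 Hc; have [r0 mc sc] := Hc.
have B0 := majorized_ge0 mc.
apply/nbhs_cabsP; exists (Num.min r (e * r / (B + 1))).
  by rewrite lt_min r0 divr_gt0 ?mulr_gt0// ltr_wpDl.
move=> w; rewrite lt_min => /andP[w1 w2].
have := power_sum_tail 1 r0 mc (ltW w1) (sc _ w1); rewrite big_nat1 expr0 mulr1 -c0 expr1.
rewrite subrKC => /le_lt_trans; apply.
rewrite ltr_pdivlMr ?ltr_wpDl// in w2.
rewrite mulrA ltr_pdivrMr//; apply: le_lt_trans w2.
by rewrite mulrC ler_wpM2l ?cabs_ge0// lerDl.
Qed.

Lemma analytic_leading h z c B r m : has_power_series h z c B r -> (forall k, (k < m)%N -> c k = 0) ->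
  forall w, cabs w < r -> cabs (h (z + w) - c m * w ^+ m) <= B * (cabs w / r) ^+ m.+1.
Proof.
move=> [r0 mc sc] cm w wr; have := power_sum_tail m.+1 r0 mc (ltW wr) (sc w wr).
rewrite big_nat_recr//= big_nat_cond big1 ?add0r// => k /andP[/andP[_ km] _].
by rewrite cm// mul0r.
Qed.

(** If [c m] were the first nonzero coefficient, then at zeros arbitrarily close to [z] the term of
    degree [m] would be bounded by a remainder of order [m + 1]. *)
Lemma isolated_zeros h z : analytic_at h z ->
  (forall e, 0 < e -> exists w, [/\ w != z, cabs (w - z) < e & h w = 0]) -> \forall w \near z, h w = 0.
Proof.
move=> /analytic_atP[c [B [r Hc]]] H; have [r0 mc sc] := Hc; have B0 := majorized_ge0 mc.
suff c0 n : c n = 0.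
  apply/nbhs_cabsP; exists r => // w wr; have := sc _ wr; rewrite subrKC => h1.
  apply: (power_sum_unique h1); apply: (ccvg_near_eq _ (ccvg_cst 0)); apply: nearW => K.
  by rewrite seriesE big1// => k _; rewrite c0 mul0r.
elim/ltn_ind: n => m IH.
have lead := analytic_leading Hc IH.
apply/eqP; rewrite -cabs_eq0; apply/negP => /negP cm.
have cm0 : 0 < cabs (c m) by rewrite lt_neqAle cabs_ge0 eq_sym cm.
have min0 : 0 < Num.min r (cabs (c m) * r ^+ m.+1 / (B + 1)).
  by rewrite lt_min r0 divr_gt0 ?mulr_gt0 ?exprn_gt0// ltr_wpDl.
have [w [wz we hw]] := H _ min0.
have [w1 w2] : cabs (w - z) < r /\ cabs (w - z) < cabs (c m) * r ^+ m.+1 / (B + 1).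
  by move: we; rewrite lt_min => /andP.
have := lead _ w1; rewrite subrKC hw sub0r cabsN cabsM cabsX.
have wp : 0 < cabs (w - z) by rewrite cabs_gt0 subr_eq0.
rewrite exprMn exprVn [cabs (w - z) ^+ m.+1]exprS.
have -> : B * (cabs (w - z) * cabs (w - z) ^+ m / r ^+ m.+1) = B * cabs (w - z) / r ^+ m.+1 * cabs (w - z) ^+ m by ring.
rewrite ler_pM2r ?exprn_gt0// ler_pdivlMr ?exprn_gt0// leNgt => /negP; apply.
rewrite ltr_pdivlMr ?ltr_wpDl// in w2; apply: le_lt_trans w2.
by rewrite mulrC ler_wpM2l ?cabs_ge0// lerDl.
Qed.

End Composition.

(** * Open mapping *)
Section OpenMapping.
Context {R : realType}.
Implicit Types (h f : R[i] -> R[i]) (z w v y : R[i]) (e : R) (D : set R[i]).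

(** D'Alembert's argument: with [c m] the first nonzero coefficient of positive degree and [u] a
    root of [c m * u^m = - h z], the step [t u] changes [h z] into [(1 - t^m) h z] up to
    [O(t^(m+1))], which lowers the modulus for small [t]. *)
Lemma min_modulus h z : analytic_at h z -> h z != 0 -> ~ (\forall w \near z, h w = h z) ->
  forall e, 0 < e -> exists w, cabs (w - z) < e /\ cabs (h w) < cabs (h z).
Proof.
move=> /analytic_atP[c [B [r Hc]]] hz0 ncst e e0.
have c0 := has_power_series0 Hc; have [r0 mc sc] := Hc.
pose c' n := c n + const_coef (- c 0%N) n.
have Hc' : has_power_series (fun w => h w - h z) z c' (B + cabs (- c 0%N)) r.
  split => //; first exact: majorizedD mc (majorized_const _ (ltW r0)) (ltW r0).
  by move=> w wr; rewrite c0; apply: power_sumD; [exact: sc|exact: power_sum_const].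
have c'0 : c' 0%N = 0 by rewrite /c' /const_coef/= subrr.
have [n cn] : exists n, c' n != 0.
  apply: contrapT => H; apply: ncst; apply/nbhs_cabsP; exists r => // w wr.
  have [_ _ sc'] := Hc'; have := sc' _ wr; rewrite subrKC => h1.
  apply/eqP; rewrite -subr_eq0; apply/eqP; apply: (power_sum_unique h1).
  apply: (ccvg_near_eq _ (ccvg_cst 0)); apply: nearW => K.
  rewrite seriesE big1// => k _; have [->|ck] := eqVneq (c' k) 0; first by rewrite mul0r.
  by exfalso; apply: H; exists k.
have [m cm mmin] := ex_minnP (ex_intro (fun n => c' n != 0) n cn).
have m0 : (0 < m)%N by rewrite lt0n; apply: contra cm => /eqP ->; rewrite c'0.
have lt_m k : (k < m)%N -> c' k = 0.
  by move=> km; apply/eqP; apply: contraLR km => /mmin; rewrite -leqNgt.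
have lead := analytic_leading Hc' lt_m.
set B' := B + _ in lead; have B'0 : 0 <= B' by rewrite addr_ge0 ?cabs_ge0 ?(majorized_ge0 mc).
pose u : R[i] := m.-root (- h z / c' m).
have um : u ^+ m = - h z / c' m by exact: rootCK.
have hz : 0 < cabs (h z) by rewrite cabs_gt0.
pose C := B' * (cabs u / r) ^+ m.+1.
have C0 : 0 <= C by rewrite mulr_ge0// exprn_ge0// divr_ge0 ?cabs_ge0// ltW.
pose t := Num.min 1 (Num.min (Num.min r e / (cabs u + 1)) (cabs (h z) / (C + 1))).
have u1 : 0 < cabs u + 1 by rewrite ltr_wpDl ?cabs_ge0.
have t0 : 0 < t by rewrite !lt_min ltr01 !divr_gt0 ?lt_min ?r0 ?e0// ltr_wpDl.
have t1 : t <= 1 by rewrite ge_min lexx.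
have t2 : t * (cabs u + 1) <= Num.min r e by rewrite -ler_pdivlMr// !ge_min lexx orbT.
have t3 : t * (C + 1) <= cabs (h z) by rewrite -ler_pdivlMr ?ltr_wpDl// !ge_min lexx !orbT.
have wb : cabs (t%:C * u) < Num.min r e.
  rewrite cabsM cabs_real gtr0_norm//; apply: lt_le_trans t2.
  by rewrite ltr_pM2l// ltrDl.
move: (wb); rewrite lt_min => /andP[wr we].
exists (z + t%:C * u); split; first by rewrite addrAC subrr add0r.
have := lead _ wr; rewrite exprMn um mulrCA [c' m * _]mulrC divfK//.
rewrite cabsM cabs_real (gtr0_norm t0).
have -> : B' * (t * cabs u / r) ^+ m.+1 = C * t ^+ m.+1.
  by rewrite /C (_ : t * cabs u / r = cabs u / r * t) ?exprMn ?mulrA//; ring.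
rewrite mulrN opprK => h1.
have tm1 : t ^+ m <= 1 by rewrite exprn_ile1// ltW.
have tm0 : 0 < t ^+ m by rewrite exprn_gt0.
have h2 : cabs (h z - t%:C ^+ m * h z) = cabs (h z) * (1 - t ^+ m).
  have -> : h z - t%:C ^+ m * h z = h z * (1 - t ^+ m)%:C by rewrite rmorphB rmorph1 rmorphXn/=; ring.
  by rewrite cabsM cabs_real ger0_norm// subr_ge0.
have h3 := cabsD (h (z + t%:C * u) - h z + t%:C ^+ m * h z) (h z - t%:C ^+ m * h z).
have h4 : h (z + t%:C * u) - h z + t%:C ^+ m * h z + (h z - t%:C ^+ m * h z) = h (z + t%:C * u) by ring.
rewrite h4 h2 in h3; apply: le_lt_trans h3 _.
have h5 : C * t ^+ m.+1 < t ^+ m * cabs (h z).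
  rewrite exprS mulrA mulrC ltr_pM2l//; apply: lt_le_trans t3.
  by rewrite mulrC ltr_pM2l// ltrDl.
lra.
Qed.

Lemma open_ball D y : open D -> D y -> exists2 e : R, 0 < e & forall w, cabs (w - y) < e -> D w.
Proof. by move=> oD Dy; apply/nbhs_cabsP; exact: open_nbhs_nbhs. Qed.

(** On a compact square around [y] the modulus of [f - v] attains its minimum. By injectivity
    [f - f y] has modulus at least [mu > 0] on the boundary, so for [v] within [mu / 2] of [f y] the
    minimum is interior; by [min_modulus] it is then a zero. *)
Lemma injective_open f D y : open D -> analytic_on f D -> set_inj D f -> D y ->
  forall e, 0 < e -> exists2 eta : R, 0 < eta & forall v, cabs (v - f y) < eta ->
    exists w, [/\ cabs (w - y) < e, D w & f w = v].
Proof.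
move=> oD fan finj Dy e e0.
have [e1 e10 HD] := open_ball oD Dy.
pose d := Num.min e e1 / 3.
have d0 : 0 < d by rewrite divr_gt0// lt_min e0.
pose pt (p : R * R) : R[i] := y + (p.1 +i* p.2).
pose Q : set (R * R) := `[- d, d]%classic `*` `[- d, d]%classic.
have QP p : Q p <-> `|p.1| <= d /\ `|p.2| <= d by rewrite /Q/= !in_itv/= !ler_norml.
have ptd p : cabs (pt p - y) <= `|p.1| + `|p.2|.
  by rewrite /pt addrAC subrr add0r; exact: cabs_le_sum.
have d3 : 3 * d = Num.min e e1 by rewrite /d; field.
have QD p : Q p -> cabs (pt p - y) < e /\ D (pt p).
  move=> /QP[p1 p2]; have h : cabs (pt p - y) < Num.min e e1 by have := ptd p; lra.
  by move: h; rewrite lt_min => /andP[he he1]; split => //; exact: HD.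
have cQ : compact Q by apply: compact_setX; exact: segment_compact.
have cF v : {within Q, continuous (fun p => cabs (f (pt p) - v))}.
  apply: continuous_in_subspaceT => p0 /set_mem/QD[_ Dp].
  have cf : cabs (f w - v) @[w --> pt p0] --> cabs (f (pt p0) - v).
    have hB : ccvg (nbhs (pt p0)) (fun w => f w - v) (f (pt p0) - v).
      exact: (ccvgB (analytic_ccvg (fan _ Dp)) (ccvg_cst v)).
    exact: (ccvg_cabs hB).
  apply/cvgrPdist_lt => eps eps0.
  move/cvgrPdist_lt : cf => /(_ eps eps0)/nbhs_cabsP[r r0 Hr].
  have nb : nbhs p0 (fun p : R * R => cabs (pt p - pt p0) < r).
    apply/nbhs_ballP; exists (r / 2); first by rewrite /= divr_gt0.
    move=> p [h1 h2]; rewrite /ball/= in h1 h2.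
    rewrite /pt opprD addrACA subrr add0r; apply: le_lt_trans (cabs_le_sum _) _.
    by rewrite /= (distrC p.1) (distrC p.2); lra.
  by apply: (filterS _ nb) => p; exact: Hr.
pose bd : set (R * R) := Q `&` ([set p | d <= `|p.1|] `|` [set p | d <= `|p.2|]).
have cbd : compact bd.
  apply: compact_closedI => //; apply: closedU.
    apply: (@closed_comp _ _ (fun p : R * R => `|p.1|) [set x | d <= x]); last exact: closed_ge.
    by move=> p _; apply: (@continuous_comp _ _ _ fst); [exact: cvg_fst|exact: norm_continuous].
  apply: (@closed_comp _ _ (fun p : R * R => `|p.2|) [set x | d <= x]); last exact: closed_ge.
  by move=> p _; apply: (@continuous_comp _ _ _ snd); [exact: cvg_snd|exact: norm_continuous].
have [pb pbd pbmin] : exists2 p, p \in bd & forall q, q \in bd -> cabs (f (pt p) - f y) <= cabs (f (pt q) - f y).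
  apply: compact_EVT_min => //.
    by exists (d, d); split; [apply/QP; rewrite /= gtr0_norm|left; rewrite /= gtr0_norm].
  by apply: continuous_subspaceW (cF (f y)) => p [].
pose mu := cabs (f (pt pb) - f y).
have mu0 : 0 < mu.
  have /set_mem[Qb hb] := pbd; have [_ Db] := QD _ Qb.
  rewrite cabs_gt0 subr_eq0; apply/eqP => E.
  have E2 : pt pb = y by apply: finj; rewrite ?inE.
  have E3 : pb.1 +i* pb.2 = 0 :> R[i] by move/eqP: E2; rewrite /pt -subr_eq0 addrAC subrr add0r => /eqP.
  case: E3 => p1 p2; case: hb => /=; rewrite ?p1 ?p2 normr0 leNgt d0//.
exists (mu / 2); first by rewrite divr_gt0.
move=> v hv.
have Q0 : Q (0, 0) by apply/QP; rewrite /= normr0 ltW.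
have [p pQ pmin] : exists2 p, p \in Q & forall q, q \in Q -> cabs (f (pt p) - v) <= cabs (f (pt q) - v).
  by apply: compact_EVT_min => //; exists (0, 0).
have pt0 : pt (0, 0) = y by rewrite /pt/=; apply/eqP; rewrite eq_complex /= !addr0 !eqxx.
have hp : cabs (f (pt p) - v) < mu / 2.
  have := pmin (0, 0); rewrite inE pt0 => /(_ Q0) h; apply: le_lt_trans h _.
  by rewrite cdistC.
have [pe Dp] := QD _ (set_mem pQ).
exists (pt p); split => //.
apply/eqP; rewrite -subr_eq0; apply/negP => /negP fv.
have pint : `|p.1| < d /\ `|p.2| < d.
  have nb : ~ bd p.
    move=> hb; have := pbmin p; rewrite inE => /(_ hb); rewrite -/mu => h.
    have := cdist_triangle v (f (pt p)) (f y); lra.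
  by split; rewrite ltNge; apply/negP => h; apply: nb; split; [exact: set_mem|left|exact: set_mem|right].
pose eps := Num.min (d - `|p.1|) (d - `|p.2|).
have eps0 : 0 < eps by case: pint => p1 p2; rewrite lt_min !subr_gt0 p1.
have han : analytic_at (fun w => f w - v) (pt p) by exact: analyticB (fan _ Dp) (analytic_cst v (pt p)).
have ncst : ~ (\forall w \near pt p, f w - v = f (pt p) - v).
  move=> /nbhs_cabsP[r r0 Hr]; have [r1 r10 Hr1] := open_ball oD Dp.
  pose w := pt p + (Num.min r r1 / 2)%:C.
  have wp : cabs (w - pt p) = Num.min r r1 / 2.
    by rewrite /w addrAC subrr add0r cabs_real gtr0_norm// divr_gt0// lt_min r0.
  have m0 : 0 < Num.min r r1 by rewrite lt_min r0.
  have : cabs (w - pt p) < Num.min r r1 by rewrite wp; lra.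
  rewrite lt_min => /andP[w1 w2].
  have /(addIr (- v)) E := Hr _ w1.
  have E2 : w = pt p by apply: finj => //; rewrite inE//; exact: Hr1.
  by move: wp; rewrite E2 subrr cabs0; lra.
have [w [wp hw]] := min_modulus han fv ncst eps0.
pose q : R * R := (complex.Re (w - y), complex.Im (w - y)).
have ptq : pt q = w.
  by rewrite /pt /q; case E: (w - y) => [a b]; rewrite [fst _]/= [snd _]/= -E subrKC.
have Qq : Q q.
  have [E1 E2] : complex.Re (w - y) = complex.Re (w - pt p) + p.1 /\ complex.Im (w - y) = complex.Im (w - pt p) + p.2.
    rewrite /pt !raddfB/= !raddfD/=; split; ring.
  move: wp; rewrite lt_min => /andP[wp1 wp2].
  apply/QP; rewrite /q/= E1 E2; split.
    by apply: le_trans (ler_normD _ _) _; have := Re_le_cabs (w - pt p); lra.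
  by apply: le_trans (ler_normD _ _) _; have := Im_le_cabs (w - pt p); lra.
by have := pmin q; rewrite inE ptq leNgt hw => /(_ Qq).
Qed.

End OpenMapping.

(** * Exponential and logarithm *)
Section ExpLog.
Context {R : realType}.
Implicit Types (z w u l : R[i]) (a x y t : R) (L : R[i] -> R[i]).

Lemma cisD x y : cis (x + y) = cis x * cis y :> R[i].
Proof. by rewrite /cis cosD sinD; apply/eqP; rewrite eq_complex /= eqxx/= addrC. Qed.

Lemma cis0 : cis 0 = 1 :> R[i].
Proof. by rewrite /cis cos0 sin0. Qed.

Lemma cabs_cis x : cabs (cis x : R[i]) = 1.
Proof. by rewrite /cis /= cos2Dsin2 sqrtr1. Qed.

Lemma cexpD z w : cexp (z + w) = cexp z * cexp w.
Proof. by rewrite /cexp !raddfD/= expRD cisD rmorphM/= mulrACA. Qed.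

Lemma cexp0 : cexp 0 = 1 :> R[i].
Proof. by rewrite /cexp /= expR0 cis0 mulr1. Qed.

Lemma cabs_cexp z : cabs (cexp z) = expR (complex.Re z).
Proof. by rewrite /cexp cabsM cabs_cis mulr1 cabs_real ger0_norm// expR_ge0. Qed.

Lemma cexp_neq0 z : cexp z != 0.
Proof. by rewrite -cabs_gt0 cabs_cexp expR_gt0. Qed.

Lemma cexpN z : cexp (- z) = (cexp z)^-1.
Proof. by apply: (mulfI (cexp_neq0 z)); rewrite -cexpD subrr cexp0 divff// cexp_neq0. Qed.

Lemma cexp_polar x t : 0 < x -> x%:C * cis t = cexp (ln x +i* t).
Proof. by move=> x0; rewrite /cexp /= lnK. Qed.

(** [cos (t - t') = 1] forces the sine of the half difference to vanish, and that half difference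
    lies strictly between [- pi] and [pi]. *)
Lemma cis_inj a t t' : a < t < a + 2 * pi -> a < t' < a + 2 * pi -> cis t = cis t' :> R[i] -> t = t'.
Proof.
move=> /andP[t1 t2] /andP[t1' t2'] E.
have c1 : cis (t - t') = 1 :> R[i].
  apply: (mulIf (_ : cis t' != 0)); first by rewrite -cabs_gt0 cabs_cis.
  by rewrite -cisD subrK mul1r.
have : cos ((t - t') / 2 *+ 2) = 1.
  by rewrite -mulr_natr divfK//; case: c1.
rewrite cos_mulr2n => c2.
have : sin ((t - t') / 2) ^+ 2 = 0 by rewrite sin2cos2; lra.
move/eqP; rewrite sqrf_eq0 => /eqP s0.
have [h|h|h] := ltrgtP t t'; last exact: h.
- have : 0 < sin ((t' - t) / 2) by apply: sin_gt0_pi; lra.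
  by rewrite (_ : (t' - t) / 2 = - ((t - t') / 2)) ?sinN ?s0 ?oppr0 ?ltxx//; ring.
- have : 0 < sin ((t - t') / 2) by apply: sin_gt0_pi; lra.
  by rewrite s0 ltxx.
Qed.

Lemma Log_cexp a l : a < complex.Im l < a + 2 * pi -> Log a (cexp l) = l.
Proof.
move=> la; rewrite /Log normrE_cabs (_ : forall x : R, complex.Re x%:C = x)// cabs_cexp expRK.
suff : arg a (cexp l) = complex.Im l by move=> ->; case: (l).
rewrite /arg; apply: xget_unique.
  by split => //; rewrite normrE_cabs cabs_cexp.
move=> t [ta]; rewrite normrE_cabs cabs_cexp {1}/cexp => E.
apply: (cis_inj ta la); apply/esym; apply: (mulfI _ E).
by rewrite -cabs_gt0 cabs_real gtr0_norm expR_gt0.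
Qed.

Definition exp_coefs n : R[i] := (n`!%:R)^-1.

Lemma majorized_exp x : 0 <= x -> majorized exp_coefs (expR x) x.
Proof.
move=> x0 K; apply: (@le_trans _ _ (series (exp_coeff x) K)).
  rewrite /series/=; apply: ler_sum => k _.
  by rewrite /exp_coefs cabsV cabs_nat /exp_coeff/= mulrC.
rewrite /expR; apply: (nondecreasing_cvgn_le _ (is_cvg_series_exp_coeff x)).
by apply: nondecreasing_series => k _ _; rewrite exp_coeff_ge0.
Qed.

Lemma realC_X x n : (x%:C ^+ n : R[i]) = (x ^+ n)%:C.
Proof. by rewrite rmorphXn. Qed.

Lemma realC_V x : (x%:C^-1 : R[i]) = x^-1%:C.
Proof. by rewrite fmorphV. Qed.

Lemma realC_nat n : (n%:R : R[i]) = n%:R%:C.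
Proof. by rewrite rmorph_nat. Qed.

Lemma power_sum_real x : power_sum exp_coefs x%:C (expR x)%:C.
Proof.
have := is_cvg_series_exp_coeff x => /ccvg_real h.
apply: ccvg_near_eq h; apply: nearW => K.
rewrite /series/= realC_sum; apply: eq_bigr => k _.
by rewrite /exp_coefs /exp_coeff/= realC_nat realC_V realC_X -rmorphM mulrC.
Qed.

Lemma expr_im y n : ('i%C * y%:C) ^+ n = ((~~ odd n)%:R * (-1) ^+ n./2 * y ^+ n) +i* ((odd n)%:R * (-1) ^+ n.-1./2 * y ^+ n) :> R[i].
Proof.
rewrite exprMn realC_X.
have -> : 'i%C ^+ n = ((~~ odd n)%:R * (-1) ^+ n./2) +i* ((odd n)%:R * (-1) ^+ n.-1./2) :> R[i].
  rewrite -{1}(odd_double_half n) -mul2n exprD exprM sqr_i.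
  rewrite -[-1]/(-1%:C) -(rmorphN1 (real_complex R)) realC_X.
  case: (boolP (odd n)) => o.
    have -> : n.-1./2 = n./2 by case: n o => // n /=; rewrite uphalf_half => /negbTE ->.
    by apply/eqP; rewrite expr1 eq_complex /=; apply/andP; split; apply/eqP; ring.
  by apply/eqP; rewrite expr0 eq_complex /=; apply/andP; split; apply/eqP; ring.
by apply/eqP; rewrite eq_complex /=; apply/andP; split; apply/eqP; ring.
Qed.

Lemma power_sum_imaginary y : power_sum exp_coefs ('i%C * y%:C) (cis y).
Proof.
have E n : exp_coefs n * ('i%C * y%:C) ^+ n = cos_coeff y n +i* sin_coeff y n.
  rewrite expr_im /exp_coefs realC_nat realC_V /cos_coeff /sin_coeff /=.
  by apply/eqP; rewrite eq_complex /=; apply/andP; split; apply/eqP; rewrite -?exprnP; ring.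
apply: ccvg_ReIm.
  rewrite /= unlock.
  suff -> : (fun n => complex.Re (series (fun n => exp_coefs n * ('i%C * y%:C) ^+ n) n)) = series (cos_coeff y).
    exact: is_cvg_series_cos_coeff.
  by apply/funext => n; rewrite /series/= Re_sum; apply: eq_bigr => k _; rewrite E.
rewrite /= unlock.
suff -> : (fun n => complex.Im (series (fun n => exp_coefs n * ('i%C * y%:C) ^+ n) n)) = series (sin_coeff y).
  exact: is_cvg_series_sin_coeff.
by apply/funext => n; rewrite /series/= Im_sum; apply: eq_bigr => k _; rewrite E.
Qed.

(** Moving the argument into the coefficients allows a Cauchy product of two series taken at
    different points, both now evaluated at 1. *)
Lemma power_sum_scale (c : nat -> R[i]) z l : power_sum c z l <-> power_sum (fun n => c n * z ^+ n) 1 l.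
Proof.
rewrite /power_sum (_ : (fun n => c n * z ^+ n * 1 ^+ n) = (fun n => c n * z ^+ n))//.
by apply/funext => n; rewrite expr1n mulr1.
Qed.

Lemma majorized_scale (c : nat -> R[i]) B z x : majorized c B (cabs z * x) -> majorized (fun n => c n * z ^+ n) B x.
Proof. by move=> h K; have := h K; under eq_bigr do rewrite exprMn mulrA -cabsX -cabsM. Qed.

(** The real and the imaginary part of the exponent are handled by the real series of [expR], [cos]
    and [sin]; the binomial theorem identifies the Cauchy product of the two. *)
Lemma power_sum_exp z : power_sum exp_coefs z (cexp z).
Proof.
set x := complex.Re z; set y := complex.Im z.
have zE : z = x%:C + 'i%C * y%:C by rewrite /x /y -complexE.
have M w : majorized (fun n => exp_coefs n * w ^+ n) (expR (cabs w * 2)) 2.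
  by apply: majorized_scale; apply: majorized_exp; rewrite mulr_ge0// cabs_ge0.
have lt12 : cabs (1 : R[i]) < 2 by rewrite cabs1 ltr1n.
have h1 : power_sum (fun n => exp_coefs n * x%:C ^+ n) 1 (expR x)%:C.
  exact: (power_sum_scale _ _ _).1 (power_sum_real x).
have h2 : power_sum (fun n => exp_coefs n * ('i%C * y%:C) ^+ n) 1 (cis y).
  exact: (power_sum_scale _ _ _).1 (power_sum_imaginary y).
have h := power_sumM (ltr0n _ 2) (M _) (M _) lt12 h1 h2.
apply/power_sum_scale; move: h; rewrite /cexp -/x -/y.
suff -> : cauchy_product (fun n => exp_coefs n * x%:C ^+ n) (fun n => exp_coefs n * ('i%C * y%:C) ^+ n) = (fun n => exp_coefs n * z ^+ n) by [].
apply/funext => n; rewrite /cauchy_product zE addrC exprDn mulr_sumr; apply: eq_bigr => k _.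
have kn : (k <= n)%N by rewrite -ltnS.
have F m : (m`!%:R : R[i]) != 0 by rewrite pnatr_eq0 -lt0n fact_gt0.
rewrite -mulr_natr /exp_coefs -(bin_fact kn) !natrM.
have B : ('C(n, k)%:R : R[i]) != 0 by rewrite pnatr_eq0 -lt0n bin_gt0.
by field; rewrite !F B.
Qed.

Lemma analytic_exp z : analytic_at (@cexp R) z.
Proof.
apply/analytic_atP; exists (fun n => cexp z * exp_coefs n), (cabs (cexp z) * expR 1), 1; split => //.
  by apply: majorizedZ; exact: majorized_exp.
by move=> w _; rewrite cexpD; apply: power_sumZ; exact: power_sum_exp.
Qed.

Lemma power_series_fun (c : nat -> R[i]) B r : 0 < r -> majorized c B r ->
  exists h, has_power_series h 0 c B r.
Proof.
move=> r0 hc; have H w : exists l, cabs w < r -> power_sum c w l.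
  have [wr|wr] := ltP (cabs w) r; last by exists 0.
  by have [l hl] := power_sum_exists r0 hc (ltW wr); exists l.
have [h hh] := choice H; exists h; split => // w wr; rewrite add0r; exact: hh.
Qed.

(** Mercator's series; at [n = 0] the convention [0^-1 = 0] supplies the right constant term. *)
Definition log1p_coefs n : R[i] := (- (-1) ^+ n * n%:R^-1 : R)%:C.

Lemma majorized_log1p : majorized log1p_coefs 2 2^-1.
Proof.
have := @majorized_bounded R log1p_coefs 1 1 ltr01 ler01; rewrite mulr1 mul1r; apply => n.
rewrite expr1n mulr1 /log1p_coefs cabs_real normrM normrN normrX normrN1 expr1n mul1r.
case: n => [|n]; first by rewrite invr0 normr0.
by rewrite ger0_norm ?invr_ge0// invf_le1// ler1n.
Qed.

Lemma is_derive_log1p_partial N x : is_derive x 1 (fun x => \sum_(0 <= k < N) - (-1) ^+ k.+1 * k.+1%:R^-1 * x ^+ k.+1)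
  (\sum_(0 <= k < N) (- x) ^+ k).
Proof.
elim: N => [|N IH].
  rewrite big_geq// (_ : (fun _ => _) = cst 0); first exact: is_derive_cst.
  by apply/funext => y; rewrite big_geq.
rewrite big_nat_recr//=.
rewrite (_ : (fun x => _) = (fun x => \sum_(0 <= k < N) - (-1) ^+ k.+1 * k.+1%:R^-1 * x ^+ k.+1) + (- (-1) ^+ N.+1 * N.+1%:R^-1) *: (id : R -> R) ^+ N.+1); last first.
  by apply/funext => y; rewrite big_nat_recr//= -[RHS]/(_ + _ *: _) /= exprfctE.
apply: is_deriveD.
have hX : is_derive x 1 ((id : R -> R) ^+ N.+1) ((N.+1%:R * id x ^+ N) *: 1) by apply: is_deriveX.
have := is_deriveZ (- (-1) ^+ N.+1 * N.+1%:R^-1) hX.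
rewrite (_ : _ *: (_ *: _) = (- x) ^+ N)// /GRing.scale/= mulr1 (exprNn x) exprS.
have n0 : N.+1%:R != 0 :> R by rewrite pnatr_eq0.
by move: (N.+1%:R) n0 => q q0; field.
Qed.

(** The derivative of the remainder is [(- y)^N / (1 + y)], by the geometric sum, and the mean value
    theorem concludes. *)
Lemma log1p_partial N x : 0 < x < 1 ->
  `|ln (1 + x) - \sum_(0 <= k < N) - (-1) ^+ k.+1 * k.+1%:R^-1 * x ^+ k.+1| <= x ^+ N.
Proof.
move=> /andP[x0 x1].
pose g x := ln (1 + x) - \sum_(0 <= k < N) - (-1) ^+ k.+1 * k.+1%:R^-1 * x ^+ k.+1.
have gd y : 0 <= y <= x -> is_derive y 1 g ((- y) ^+ N / (1 + y)).
  move=> /andP[y0 _]; have y1 : 0 < 1 + y by lra.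
  have hl : is_derive y 1 (fun y => ln (1 + y)) ((1 + y)^-1).
    have h1 : is_derive y 1 (fun y : R => 1 + y) 1.
      have := is_deriveD (is_derive_cst (1 : R) y 1) (is_derive_id y (1 : R)); rewrite add0r; exact.
    have h2 : is_derive (1 + y) 1 (@ln R) ((1 + y)^-1) by exact: is_derive1_ln.
    by have := is_derive1_comp h2 h1; rewrite mulr1; exact.
  have := is_deriveB hl (is_derive_log1p_partial N y).
  suff -> : (1 + y)^-1 - \sum_(0 <= k < N) (- y) ^+ k = (- y) ^+ N / (1 + y) by [].
  have y1' : 1 + y != 0 by rewrite gt_eqF.
  apply: (mulIf y1'); rewrite mulrBl mulVf// divfK//.
  elim: (N) => [|n IH]; first by rewrite big_geq// mul0r expr0 subr0.
  by rewrite big_nat_recr//= mulrDl opprD addrA IH exprS; ring.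
have [c /andP[c0 cx]] := mvt_closed (ltW x0) gd.
have -> : g 0 = 0.
  rewrite /g addr0 ln1 big1 ?subr0// => k _; by rewrite expr0n mulr0.
rewrite !subr0 => gx; rewrite -/(g x) gx normrM normrM normrX normrN (ger0_norm c0) (gtr0_norm x0).
have c1 : 0 < 1 + c by lra.
rewrite normfV (gtr0_norm c1) mulrAC ler_pdivrMr//.
apply: ler_pM; rewrite ?exprn_ge0//; last by lra.
  by rewrite ltW.
by rewrite lerXn2r// nnegrE ltW.
Qed.

Lemma power_sum_log1p x : 0 < x < 1 -> power_sum log1p_coefs x%:C (ln (1 + x))%:C.
Proof.
move=> x01; have /andP[x0 x1] := x01.
apply: (@ccvg_squeeze _ _ _ _ _ _ (fun N => x ^+ N.-1)).
  exists 1%N => // -[|N]//= _.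
  rewrite seriesE big_nat_recl// {1}/log1p_coefs invr0 mulr0 mul0r add0r.
  rewrite (_ : \sum_(_ <= _ < _) _ = (\sum_(0 <= k < N) - (-1) ^+ k.+1 * k.+1%:R^-1 * x ^+ k.+1)%:C).
    by rewrite -rmorphB cabs_real distrC; exact: log1p_partial.
  by rewrite realC_sum; apply: eq_bigr => k _; rewrite /log1p_coefs realC_X -rmorphM.
rewrite -cvg_shiftS; apply: cvg_expr; by rewrite gtr0_norm.
Qed.

(** The identity [cexp (L u) = 1 + u] is known at small positive reals from the real logarithm;
    isolation of zeros extends it to a neighborhood. *)
Lemma log1p_exists : exists2 L, has_power_series L 0 log1p_coefs 2 2^-1 &
  \forall u \near (0 : R[i]), cexp (L u) = 1 + u.
Proof.
have h20 : 0 < 2^-1 :> R by rewrite invr_gt0.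
have [L HL] := power_series_fun h20 majorized_log1p.
exists L => //.
have aL : analytic_at L 0 by apply/analytic_atP; exists log1p_coefs, 2, 2^-1.
have aE : analytic_at (fun u => cexp (L u) - (1 + u)) 0.
  apply: analyticB; last exact: analyticD (analytic_cst _ _) (analytic_id _).
  exact: (analytic_comp aL (analytic_exp _)).
have : \forall u \near (0 : R[i]), cexp (L u) - (1 + u) = 0.
  apply: (isolated_zeros aE) => e e0.
  pose x := Num.min e 2^-1 / 2.
  have m0 : 0 < Num.min e 2^-1 by rewrite lt_min e0 h20.
  have x0 : 0 < x by rewrite divr_gt0.
  have xm : x < Num.min e 2^-1 by rewrite /x; lra.
  move: xm; rewrite lt_min => /andP[xe x2].
  have cx : cabs x%:C = x :> R by rewrite cabs_real gtr0_norm.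
  exists x%:C; split; [by rewrite -cabs_gt0 cx|by rewrite subr0 cx|].
  have [_ _ /(_ x%:C)] := HL; rewrite cx add0r => /(_ x2) h1.
  have h2 : power_sum log1p_coefs x%:C (ln (1 + x))%:C by apply: power_sum_log1p; lra.
  rewrite (power_sum_unique h1 h2) /cexp /= cis0 mulr1 lnK ?posrE; last by lra.
  by rewrite rmorphD rmorph1 subrr.
by apply: filterS => u /subr0_eq.
Qed.

Definition log1p : R[i] -> R[i] := projT1 (cid2 log1p_exists).

Lemma log1p_power_series : has_power_series log1p 0 log1p_coefs 2 2^-1.
Proof. by rewrite /log1p; case: cid2. Qed.

Lemma cexp_log1p : \forall u \near (0 : R[i]), cexp (log1p u) = 1 + u.
Proof. by rewrite /log1p; case: cid2. Qed.

Lemma analytic_log1p : analytic_at log1p 0.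
Proof. by apply/analytic_atP; exists log1p_coefs, 2, 2^-1; exact: log1p_power_series. Qed.

Lemma log1p0 : log1p 0 = 0.
Proof. by rewrite (has_power_series0 log1p_power_series) /log1p_coefs invr0 mulr0. Qed.

Lemma log1p_small e : 0 < e -> \forall u \near (0 : R[i]), cabs (log1p u) < e.
Proof.
move=> e0; have := analytic_ccvg analytic_log1p e0.
by apply: filterS => u; rewrite log1p0 subr0.
Qed.

Lemma log1p_quadratic u : cabs u < 2^-1 -> cabs (log1p u - u) <= 8 * cabs u ^+ 2.
Proof.
move=> u1; have [r0 mc sc] := log1p_power_series.
have := power_sum_tail 2 r0 mc (ltW u1) (sc u u1).
rewrite add0r big_nat_recr//= big_nat1 /log1p_coefs invr0 mulr0 mul0r add0r expr1 invr1 mulr1 opprK mul1r.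
by rewrite expr1 invrK exprMn (_ : 2 * (_ * _) = 8 * cabs u ^+ 2)//; ring.
Qed.

(** The neighborhood is fixed before [a] and [l], so it serves all branches and all points at once;
    only the condition on the imaginary part sees the cut. *)
Lemma Log_mul1p : \forall u \near (0 : R[i]), forall a l,
  a < complex.Im (l + log1p u) < a + 2 * pi -> Log a (cexp l * (1 + u)) = l + log1p u.
Proof. by apply: filterS cexp_log1p => u <- a l h; rewrite -cexpD Log_cexp. Qed.

Lemma Log1p : \forall u \near (0 : R[i]), Log (- pi) (1 + u) = log1p u.
Proof.
have p0 := @pi_gt0 R.
apply: filterS2 Log_mul1p (log1p_small p0) => u /(_ (- pi) 0); rewrite cexp0 mul1r add0r => h hu.
by apply: h; have := Im_le_cabs (log1p u); rewrite ler_norml; lra.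
Qed.

(** Near [cexp l] the branch is [l + log1p (cexp (- l) * w - 1)], as long as the perturbation does
    not reach the cut. *)
Lemma analytic_Log a l : a < complex.Im l < a + 2 * pi -> analytic_at (Log a) (cexp l).
Proof.
move=> /andP[l1 l2].
have aq : analytic_at (fun w => cexp (- l) * w - 1) (cexp l).
  apply: analyticB (analytic_cst _ _); exact: analyticM (analytic_cst _ _) (analytic_id _).
have q0 : cexp (- l) * cexp l - 1 = 0 by rewrite cexpN mulVf ?cexp_neq0// subrr.
have aL : analytic_at (fun w => l + log1p (cexp (- l) * w - 1)) (cexp l).
  apply: analyticD; first exact: analytic_cst.
  apply: (analytic_comp aq); rewrite q0; exact: analytic_log1p.
apply: analytic_near_eq aL.
pose e := Num.min (complex.Im l - a) (a + 2 * pi - complex.Im l).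
have e0 : 0 < e by rewrite lt_min !subr_gt0 l1.
have [d d0 H] := (nbhs_cabsP _ _).1 (filterI Log_mul1p (log1p_small e0)).
have := analytic_ccvg aq d0; apply: filterS => w; rewrite q0 subr0 => hw.
have := H _ _; rewrite /= => /(_ (cexp (- l) * w - 1)); rewrite subr0 => /(_ hw)[/(_ a l) h1 h2].
rewrite -h1; first by rewrite subrKC mulrA -cexpD subrr cexp0 mul1r.
move: h2; rewrite lt_min => /andP[h2 h3]; have := Im_le_cabs (log1p (cexp (- l) * w - 1)).
by rewrite raddfD/= ler_norml; lra.
Qed.

Lemma half_plane_polar w : 0 < complex.Re w -> exists2 t, - (pi / 2) < t < pi / 2 & w = (cabs w)%:C * cis t.
Proof.
move=> w0; pose t := atan (complex.Im w / complex.Re w).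
have tb : - (pi / 2) < t < pi / 2 by rewrite atan_gtNpi2 atan_ltpi2.
exists t => //.
have c0 : 0 < cos t by apply: cos_gt0_pihalf.
have s0 : sin t = cos t * (complex.Im w / complex.Re w).
  by have := atanK (complex.Im w / complex.Re w); rewrite -/t /tan => <-; field; rewrite gt_eqF.
have E : w = (complex.Re w / cos t)%:C * cis t.
  apply/eqP; rewrite eq_complex /= s0; apply/andP; split; apply/eqP; field; rewrite ?gt_eqF//.
suff -> : cabs w = complex.Re w / cos t by [].
by rewrite {1}E cabsM cabs_cis mulr1 cabs_real gtr0_norm// divr_gt0.
Qed.

End ExpLog.

(** * Maps tangent to the identity and their orbits *)
Section Vanishing.
Context {R : realType}.
Implicit Types (f g h : R[i] -> R[i]) (z w c : R[i]) (k l : nat).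

Definition bigOX k g := exists2 C : R, 0 <= C & \forall z \near (0 : R[i]), cabs (g z) <= C * cabs z ^+ k.

Lemma bigOX_le k l g : (k <= l)%N -> bigOX l g -> bigOX k g.
Proof.
move=> kl [C C0 H]; exists C => //; apply: filterS2 H (nbhs_cabs ltr01) => z h z1.
by apply: le_trans h _; rewrite ler_wpM2l// ler_wiXn2l ?cabs_ge0// ltW.
Qed.

Lemma bigOXD k f g : bigOX k f -> bigOX k g -> bigOX k (fun z => f z + g z).
Proof.
move=> [C C0 H] [C' C0' H']; exists (C + C'); first exact: addr_ge0.
by apply: filterS2 H H' => z h h'; rewrite mulrDl; apply: le_trans (cabsD _ _) _; exact: lerD.
Qed.

Lemma bigOXN k f : bigOX k f -> bigOX k (fun z => - f z).
Proof. by move=> [C C0 H]; exists C => //; apply: filterS H => z; rewrite cabsN. Qed.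

Lemma bigOXB k f g : bigOX k f -> bigOX k g -> bigOX k (fun z => f z - g z).
Proof. by move=> hf hg; exact: bigOXD hf (bigOXN hg). Qed.

Lemma bigOXM k l f g : bigOX k f -> bigOX l g -> bigOX (k + l) (fun z => f z * g z).
Proof.
move=> [C C0 H] [C' C0' H']; exists (C * C'); first exact: mulr_ge0.
apply: filterS2 H H' => z h h'; rewrite cabsM exprD mulrACA.
by apply: ler_pM; rewrite ?cabs_ge0.
Qed.

Lemma bigOX_id : bigOX 1 id.
Proof. by exists 1 => //; apply: filterS (nbhs_cabs ltr01) => z _; rewrite mul1r expr1. Qed.

Lemma bigOX_cst c : bigOX 0 (fun=> c).
Proof. by exists (cabs c); [exact: cabs_ge0|apply: filterS (nbhs_cabs ltr01) => z _; rewrite expr0 mulr1]. Qed.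

Lemma bigOX_exp k : bigOX k (fun z => z ^+ k).
Proof. by exists 1 => //; apply: filterS (nbhs_cabs ltr01) => z _; rewrite mul1r cabsX. Qed.

Lemma bigOX_near_eq k f g : (\forall z \near 0, f z = g z) -> bigOX k f -> bigOX k g.
Proof. by move=> E [C C0 H]; exists C => //; apply: filterS2 E H => z ->. Qed.

Lemma bigOX_small k g : bigOX k.+1 g -> forall e : R, 0 < e ->
  \forall z \near (0 : R[i]), cabs (g z) <= e * cabs z ^+ k.
Proof.
move=> [C C0 H] e e0; have C1 : 0 < C + 1 by lra.
have d0 : 0 < e / (C + 1) by rewrite divr_gt0.
apply: filterS2 H (nbhs_cabs d0) => z h; rewrite ltr_pdivlMr// => hz.
apply: le_trans h _; rewrite exprS mulrA ler_wpM2r ?exprn_ge0 ?cabs_ge0//.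
by have := cabs_ge0 z; lra.
Qed.

Lemma bigOX_comp k g h : bigOX k g -> bigOX 1 h -> bigOX k (fun z => g (h z)).
Proof.
move=> [C C0 H] [C' C0' H']; exists (C * C' ^+ k); first by rewrite mulr_ge0// exprn_ge0.
have [d d0 hd] := (nbhs_cabsP _ _).1 H.
have d1 : 0 < d / (C' + 1) by rewrite divr_gt0//; lra.
apply: filterS2 H' (nbhs_cabs d1) => z; rewrite expr1 ltr_pdivlMr ?ltr_wpDl// => h' hz.
have hh : cabs (h z - 0) < d by rewrite subr0; have := cabs_ge0 z; nra.
apply: le_trans (hd _ hh) _; rewrite -mulrA -exprMn ler_wpM2l//.
by rewrite lerXn2r// nnegrE ?mulr_ge0 ?cabs_ge0.
Qed.

Lemma bigOX_analytic f : analytic_at f 0 -> f 0 = 0 -> bigOX 1 f.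
Proof.
move=> /analytic_atP[c [B [r Hc]]] f0; have [r0 mc sc] := Hc.
exists (B / r); first by rewrite divr_ge0 ?(majorized_ge0 mc) ?ltW.
apply: filterS (nbhs_cabs r0) => z zr; have := power_sum_tail 1 r0 mc (ltW zr) (sc z zr).
rewrite big_nat1 expr0 mulr1 -(has_power_series0 Hc) f0 subr0 add0r !expr1.
by rewrite mulrA mulrAC.
Qed.

(** All coefficients up to degree [k] vanish, which gains a full order; the Abel coordinate needs
    [O(z^4)], not just [o(z^3)]. *)
Lemma littleo_bigOX f k : analytic_at f 0 -> f =o_ (0 : R[i]) (fun z => z ^+ k) -> bigOX k.+1 f.
Proof.
move=> /analytic_atP[c [B [r Hc]]] fo; have [r0 mc sc] := Hc.
have B0 := majorized_ge0 mc.
have fs (e : R) : 0 < e -> \forall z \near (0 : R[i]), cabs (f z) <= e * cabs z ^+ k.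
  move=> e0; move/eqoP : fo => /(_ e%:C); rewrite ltcR => /(_ e0).
  apply: filterS => z; rewrite !normrE_cabs -rmorphM/= lecR cabsX; exact.
have c0 m : (m <= k)%N -> c m = 0.
  elim/ltn_ind: m => m IH mk.
  apply/eqP; rewrite -cabs_eq0 eq_le cabs_ge0 andbT; apply/ler_addgt0Pl => e e0.
  have lead := analytic_leading Hc (fun k' (h : (k' < m)%N) => IH k' h (ltnW (leq_trans h mk))).
  have e2 : 0 < e / 2 by rewrite divr_gt0.
  pose C := B / r ^+ m.+1; have C0 : 0 <= C by rewrite divr_ge0// exprn_ge0// ltW.
  have [d d0 hd] := (nbhs_cabsP _ _).1 (fs _ e2).
  pose x := Num.min (Num.min 1 d) (Num.min r (e / 2 / (C + 1))) / 2.
  have m0 : 0 < Num.min (Num.min 1 d) (Num.min r (e / 2 / (C + 1))).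
    by rewrite !lt_min ltr01 d0 r0 !divr_gt0//; lra.
  have x0 : 0 < x by rewrite divr_gt0.
  have : x < Num.min (Num.min 1 d) (Num.min r (e / 2 / (C + 1))) by rewrite /x; lra.
  rewrite !lt_min => /andP[/andP[x1 xd] /andP[xr]].
  rewrite ltr_pdivlMr ?ltr_wpDl// => xC.
  have cx : cabs x%:C = x :> R by rewrite cabs_real gtr0_norm.
  have h1 := hd x%:C; rewrite subr0 cx in h1; have {}h1 := h1 xd.
  have h2 := lead x%:C; rewrite cx add0r in h2; have {}h2 := h2 xr.
  have h3 : cabs (c m) * x ^+ m <= e * x ^+ m.
    have -> : cabs (c m) * x ^+ m = cabs (c m * x%:C ^+ m) by rewrite cabsM cabsX cx.
    have h4 := cdist_triangle (f x%:C) (c m * x%:C ^+ m) 0.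
    rewrite !subr0 cdistC in h4; apply: le_trans h4 _.
    have xk : x ^+ k <= x ^+ m by rewrite ler_wiXn2l// ltW.
    have xm : 0 < x ^+ m by rewrite exprn_gt0.
    have h5 : B * (x / r) ^+ m.+1 = C * x * x ^+ m by rewrite expr_div_n /C exprS; ring.
    rewrite h5 in h2; nra.
  by rewrite addr0; move: h3; rewrite ler_pM2r// exprn_gt0.
exists (B / r ^+ k.+1); first by rewrite divr_ge0// exprn_ge0// ltW.
apply: filterS (nbhs_cabs r0) => z zr; have := power_sum_tail k.+1 r0 mc (ltW zr) (sc z zr).
rewrite add0r big_nat_cond big1 ?subr0 => [|m /andP[/andP[_ mk] _]]; last by rewrite c0// mul0r.
by rewrite expr_div_n mulrA mulrAC.
Qed.

End Vanishing.

(** * Parabolic germs and the Abel coordinate *)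

Section Parabolic.
Context {R : realType}.
Implicit Types (F f g : R[i] -> R[i]) (z w : R[i]) (s a : R).

(** One notion for [f] ([s = 1]) and its inverse ([s = -1]): inversion changes the cubic coefficient
    from [c] to [2 s^2 - c], which fixes the value 1. *)
Definition parabolic s F := bigOX 4 (fun z => F z - (z + s%:C * z ^+ 2 + z ^+ 3)).

Lemma parabolic_id s F : parabolic s F -> bigOX 2 (fun z => F z - z).
Proof.
move=> /(bigOX_le (isT : 2 <= 4)%N) h.
have h2 : bigOX 2 (fun z : R[i] => s%:C * z ^+ 2) by exact: (bigOXM (bigOX_cst _) (bigOX_exp 2)).
have h3 := bigOX_le (isT : 2 <= 3)%N (@bigOX_exp R 3).
apply: bigOX_near_eq (bigOXD (bigOXD h h2) h3).
by apply: filterS (nbhs_cabs ltr01) => z _; ring.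
Qed.

Lemma parabolic_half s F : parabolic s F -> \forall z \near (0 : R[i]), cabs (F z - z) <= cabs z / 2.
Proof.
move=> /parabolic_id/bigOX_small/(_ 2^-1); rewrite invr_gt0 => /(_ (ltr0n _ 2)).
by apply: filterS => z; rewrite expr1 mulrC.
Qed.

Lemma parabolic_fix0 s F : parabolic s F -> F 0 = 0.
Proof.
move=> /parabolic_half/nbhs_singleton; rewrite cabs0 mul0r subr0 => h.
by apply/eqP; rewrite -cabs_eq0 eq_le h cabs_ge0.
Qed.

Lemma parabolic_bigOX1 s F : parabolic s F -> bigOX 1 F.
Proof.
move=> /parabolic_id/(bigOX_le (isT : 1 <= 2)%N) h.
apply: bigOX_near_eq (bigOXD h bigOX_id).
by apply: filterS (nbhs_cabs ltr01) => z _; rewrite /= subrK.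
Qed.

(** In the numerator [s F - s z - z F] the terms of degree 2 cancel because [s^2 = 1] and those of
    degree 3 because the cubic coefficient of [F] is 1; [O(z^4)] divided by [z F] leaves
    [O(z^2)]. *)
Lemma abel_coordinate s F : s * s = 1 -> parabolic s F ->
  exists2 C : R, 0 <= C & \forall z \near (0 : R[i]), z != 0 ->
    F z != 0 /\ cabs (- s%:C / F z - (- s%:C / z + 1)) <= C * cabs z ^+ 2.
Proof.
move=> s2 hF.
have hN : bigOX 4 (fun z => s%:C * F z - s%:C * z - z * F z).
  have h1 := bigOXM (bigOX_cst s%:C) hF.
  have h2 := bigOX_le (isT : 4 <= 1 + 4)%N (bigOXM bigOX_id hF).
  have h3 := @bigOX_exp R 4.
  apply: bigOX_near_eq (bigOXB (bigOXB h1 h3) h2).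
  apply: filterS (nbhs_cabs ltr01) => z _.
  have S2 : s%:C * s%:C = 1 :> R[i] by rewrite -rmorphM s2.
  apply/eqP; rewrite -subr_eq0; apply/eqP.
  rewrite (_ : _ - _ = (1 - s%:C * s%:C) * z ^+ 2); last by ring.
  by rewrite S2 subrr mul0r.
case: hN => C C0 H; exists (2 * C); first by rewrite mulr_ge0.
apply: filterS2 H (parabolic_half hF) => z h1 h2 z0.
have cz : 0 < cabs z by rewrite cabs_gt0.
have h3 : cabs z / 2 <= cabs (F z).
  by have := cabsB_ge z (F z); rewrite cdistC; lra.
have cF : 0 < cabs (F z) by lra.
have F0 : F z != 0 by rewrite -cabs_gt0.
split => //.
have -> : - s%:C / F z - (- s%:C / z + 1) = (s%:C * F z - s%:C * z - z * F z) / (z * F z).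
  by field; rewrite z0 F0.
rewrite cabsM cabsV cabsM ler_pdivrMr ?mulr_gt0//; apply: le_trans h1 _.
have h4 : 0 <= C * cabs z ^+ 3 by rewrite mulr_ge0// exprn_ge0 ?ltW.
have -> : 2 * C * cabs z ^+ 2 * (cabs z * cabs (F z)) = C * cabs z ^+ 3 * (2 * cabs (F z)) by ring.
by rewrite exprSr mulrA ler_wpM2l//; lra.
Qed.

Lemma parabolic_inverse f g : parabolic 1 f -> (\forall z \near (0 : R[i]), f (g z) = z) ->
  (forall e : R, 0 < e -> \forall z \near (0 : R[i]), cabs (g z) < e) -> parabolic (-1) g.
Proof.
move=> hf fg gs.
have g1 : bigOX 1 g.
  exists 2 => //; have [d d0 hd] := (nbhs_cabsP _ _).1 (parabolic_half hf).
  apply: filterS2 fg (gs _ d0) => z E gz; have := hd (g z); rewrite subr0 => /(_ gz).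
  by rewrite E expr1; have := cabsB_ge (g z) z; rewrite cdistC; lra.
(* The polynomial [x - x^2 + x^3] is a left inverse of [f] to order 4; substituting [g] afterwards
   gives the expansion of [g]. *)
have hh : bigOX 4 (fun z => f z - f z ^+ 2 + f z ^+ 3 - z).
  have hf' := hf; rewrite /parabolic in hf'.
  have f1 := parabolic_bigOX1 hf.
  pose p z : R[i] := z + 1%:C * z ^+ 2 + z ^+ 3.
  have id1 := @bigOX_id R.
  have c0 := @bigOX_cst R.
  have p0 : bigOX 0 p.
    have h1 := bigOX_le (leq0n 1) id1; have h2 := bigOX_le (leq0n _) (bigOXM (c0 1%:C) (@bigOX_exp R 2)).
    exact: bigOXD (bigOXD h1 h2) (bigOX_le (leq0n _) (@bigOX_exp R 3)).
  have f0 : bigOX 0 f := bigOX_le (leq0n 1) f1.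
  (* The divided difference of [x - x^2 + x^3] between [f z] and the cubic model [p z]; [r0] is the
     value of this polynomial at [p z], minus [z]. *)
  have q0 : bigOX 0 (fun z => 1 - (f z + p z) + (f z * f z + f z * p z + p z * p z)).
    apply: bigOXD; first exact: bigOXB (c0 1) (bigOXD f0 p0).
    exact: bigOXD (bigOXD (bigOXM f0 f0) (bigOXM f0 p0)) (bigOXM p0 p0).
  have r0 : bigOX 4 (fun z => z ^+ 4 * (4%:R * z + 6%:R * z ^+ 2 + 6%:R * z ^+ 3 + 3%:R * z ^+ 4 + z ^+ 5)).
    have X n c : bigOX 0 (fun z : R[i] => c * z ^+ n) := bigOX_le (leq0n _) (bigOXM (c0 c) (@bigOX_exp R n)).
    have X1 := bigOX_le (leq0n _) (bigOXM (c0 4%:R) id1).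
    apply: (bigOXM (@bigOX_exp R 4) (l := 0)).
    exact: bigOXD (bigOXD (bigOXD (bigOXD X1 (X 2%N _)) (X 3%N _)) (X 4%N _)) (bigOX_le (leq0n _) (@bigOX_exp R 5)).
  apply: bigOX_near_eq (bigOXD (bigOXM hf' q0) r0).
  by apply: filterS (nbhs_cabs ltr01) => z _; rewrite /p !rmorph1; ring.
rewrite /parabolic; apply: bigOX_near_eq (bigOXN (bigOX_comp hh g1)).
by apply: filterS fg => z ->; rewrite rmorphN1; ring.
Qed.

End Parabolic.

(** * Asymptotics of an orbit converging to 0 *)

Section Orbit.
Context {R : realType}.
Variables (F : R[i] -> R[i]) (s : R) (z : nat -> R[i]).
Hypotheses (s2 : s * s = 1) (hF : parabolic s F).
Hypotheses (zS : forall n, z n.+1 = F (z n)) (z_neq0 : forall n, z n != 0) (z_to0 : ccvg \oo z 0).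

Let S2 : s%:C * s%:C = 1 :> R[i].
Proof. by rewrite -rmorphM s2. Qed.

Lemma orbit_near (P : set R[i]) : (\forall x \near (0 : R[i]), P x) -> \forall n \near \oo, P (z n).
Proof.
by move=> /nbhs_cabsP[e e0 H]; apply: filterS (z_to0 e0) => n; exact: H.
Qed.

Lemma ccvg_shift (u : nat -> R[i]) l N : ccvg \oo (fun n => u (n + N)%N) l -> ccvg \oo u l.
Proof.
move=> h e e0; have /near_infty_ge[M HM] := h e e0; apply/near_infty_ge.
exists (M + N)%N => n Mn; rewrite -(subnK (leq_trans (leq_addl M N) Mn)); apply: HM.
by rewrite -(leq_add2r N) subnK// (leq_trans (leq_addl M N) Mn).
Qed.

Lemma ccvg_unshift (u : nat -> R[i]) l N : ccvg \oo u l -> ccvg \oo (fun n => u (n + N)%N) l.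
Proof.
move=> h e e0; have /near_infty_ge[M HM] := h e e0; apply/near_infty_ge.
by exists M => n Mn; apply: HM; rewrite (leq_trans Mn)// leq_addr.
Qed.

Let w n := - s%:C / z n.

Lemma abel_step : ccvg \oo (fun n => w n.+1 - w n) 1.
Proof.
have [C C0 H] := abel_coordinate s2 hF.
move=> e e0; have d0 : 0 < Num.min 1 (e / (C + 1)) by rewrite lt_min ltr01 divr_gt0//; lra.
apply: filterS2 (orbit_near H) (z_to0 d0) => n /(_ (z_neq0 n))[_ h].
rewrite subr0 lt_min ltr_pdivlMr ?ltr_wpDl// => /andP[z1 ze].
rewrite /w zS (_ : _ - _ - 1 = - s%:C / F (z n) - (- s%:C / z n + 1)); last by ring.
apply: le_lt_trans h _; rewrite expr2; have := cabs_ge0 (z n); nra.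
Qed.

Lemma ccvg_cesaro (u : nat -> R[i]) l : ccvg \oo (fun n => u n.+1 - u n) l ->
  ccvg \oo (fun n => u n / n%:R) l.
Proof.
move=> h; apply: (@ccvg_shift _ _ 1%N).
have E n : \sum_(0 <= k < n) (u k.+1 - u k) = u n - u 0%N by rewrite telescope_sumr.
have h2 : ccvg \oo (fun n => n.+1%:R^-1%:C * (u n.+1 - u 0%N)) l.
  apply: ccvg_ReIm.
    rewrite (_ : (fun n => _) = arithmetic_mean (fun n => complex.Re (u n.+1 - u n))).
      exact: cesaro (ccvg_Re h).
    by apply/funext => n; rewrite /arithmetic_mean /series/= -Re_sum E mulrC Re_mulr mulrC.
  rewrite (_ : (fun n => _) = arithmetic_mean (fun n => complex.Im (u n.+1 - u n))).
    exact: cesaro (ccvg_Im h).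
  by apply/funext => n; rewrite /arithmetic_mean /series/= -Im_sum E mulrC Im_mulr mulrC.
have h3 : ccvg \oo (fun n => n.+1%:R^-1%:C * u 0%N) 0.
  rewrite -(mul0r (u 0%N)); apply: (ccvgM _ (ccvg_cst _)).
  by apply: (ccvg_real (x := 0)); exact: cvg_harmonic.
rewrite -(addr0 l); apply: (ccvg_near_eq _ (ccvgD h2 h3)); apply: nearW => n.
by rewrite mulrBr subrK addn1 realC_nat realC_V mulrC.
Qed.

Lemma orbit_asymptotics : ccvg \oo (fun n => n%:R * z n) (- s)%:C.
Proof.
rewrite -(mulr1 (- s)%:C) -[X in _ * X]invr1.
apply: (ccvg_near_eq _ (ccvgM (ccvg_cst (- s)%:C) (ccvgV (oner_neq0 _) (ccvg_cesaro abel_step)))).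
apply: nearW => n.
have S0 : s%:C != 0 :> R[i] by apply/eqP => E; move: S2; rewrite E mul0r => /eqP; rewrite eq_sym oner_eq0.
by rewrite invf_div /w rmorphN/= invf_div; field; rewrite S0.
Qed.

Lemma ccvg_ratio : ccvg \oo (fun n : nat => n.+1%:R / n%:R : R[i]) 1.
Proof.
have h : ccvg \oo (fun n : nat => n.+1%:R - n%:R : R[i]) 1.
  by apply: (ccvg_near_eq _ (ccvg_cst 1)); apply: nearW => n; rewrite -natr1 addrAC subrr add0r.
have h2 : ccvg \oo (fun n : nat => n%:R / n%:R : R[i]) 1 := ccvg_cesaro h.
have h3 : ccvg \oo (fun n : nat => (n%:R^-1 : R)%:C) 0 by apply: (ccvg_real (x := 0)); exact: cvg_nat_inv.
have h4 : ccvg \oo (fun n : nat => n%:R / n%:R + (n%:R^-1 : R)%:C) (1 + 0 : R[i]) by exact: (ccvgD h2 h3).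
rewrite addr0 in h4; apply: (ccvg_near_eq _ h4); apply: nearW => n.
by rewrite -realC_V -realC_nat -natr1 mulrDl mul1r.
Qed.

(** The increment is [s (w (n+1) - w n) z n z (n+1)], where the Abel step tends to 1 and each point
    is equivalent to [- s / n]. *)
Lemma orbit_increments : ccvg \oo (fun n => n.+1%:R ^+ 2 * (z n.+1 - z n)) s%:C.
Proof.
have h1 : ccvg \oo (fun n => n.+1%:R * z n.+1) (- s)%:C.
  apply: (ccvg_near_eq _ (ccvg_unshift 1 orbit_asymptotics)).
  by apply: nearW => n; rewrite addn1.
have h2 : ccvg \oo (fun n => n.+1%:R * z n) (- s)%:C.
  rewrite -(mul1r (- s)%:C); apply: (ccvg_near_eq _ (ccvgM ccvg_ratio orbit_asymptotics)).
  exists 1%N => // n /= n0; rewrite mulrA divfK// pnatr_eq0 -lt0n//.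
have -> : s%:C = s%:C * (1 * ((- s)%:C * (- s)%:C)) :> R[i] by rewrite mul1r rmorphN/= mulrNN S2 mulr1.
apply: (ccvg_near_eq _ (ccvgM (ccvg_cst s%:C) (ccvgM abel_step (ccvgM h1 h2)))); apply: nearW => n.
have -> : s%:C * ((w n.+1 - w n) * (n.+1%:R * z n.+1 * (n.+1%:R * z n))) =
  (s%:C * s%:C) * (n.+1%:R ^+ 2 * (z n.+1 - z n)); last by rewrite S2 mul1r.
by rewrite /w; field; rewrite !z_neq0.
Qed.

(** A repetition would make the orbit return to the nonzero value [z m] infinitely often, against
    convergence to 0. *)
Lemma orbit_distinct m k : k != m -> z k != z m.
Proof.
wlog : m k / (m < k)%N.
  move=> H km; have := km; rewrite neq_ltn => /orP[lt|lt]; last exact: H.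
  by rewrite eq_sym; apply: H; rewrite // eq_sym.
move=> mk _; apply/eqP => E.
have per j : z (m + j * (k - m))%N = z m.
  have iter_eq i i' j' : z i = z i' -> z (i + j')%N = z (i' + j')%N.
    by move=> Ei; elim: j' => [|j' IH]; rewrite ?addn0// !addnS !zS IH.
  elim: j => [|j IH]; first by rewrite mul0n addn0.
  by rewrite mulSn addnA subnKC ?(ltnW mk)// (iter_eq _ _ _ E).
have cz : 0 < cabs (z m) by rewrite cabs_gt0.
have /near_infty_ge[N HN] := z_to0 cz.
have := HN (m + N * (k - m))%N; rewrite per subr0 ltxx => H; have : false; last by [].
by apply: H; rewrite (leq_trans _ (leq_addl _ _))// leq_pmulr// subn_gt0.
Qed.

Lemma orbit_abel_large (K : R) : \forall n \near \oo, K < complex.Re (w n).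
Proof.
have h0 : 0 < 2^-1 :> R by rewrite invr_gt0.
have /near_infty_ge[N HN] := ccvg_cesaro abel_step h0.
have [b hb] := nat_gt (2 * K).
apply/near_infty_ge; exists (N + b).+1 => n hn.
have n0 : 0 < n%:R :> R by rewrite ltr0n (leq_trans _ hn).
have := HN n (leq_trans (leq_trans (leq_addr b N) (leqnSn _)) hn).
move=> /(le_lt_trans (Re_le_cabs _)); rewrite raddfB/= realC_nat realC_V Re_mulr => h.
have h2 : 2^-1 < complex.Re (w n) / n%:R.
  by move: h; rewrite ltr_norml /=; lra.
rewrite ltr_pdivlMr// in h2.
have h3 : b%:R < n%:R :> R by rewrite ltr_nat (leq_trans _ hn)// ltnS leq_addl.
lra.
Qed.

Lemma orbit_inverse_bound : \forall n \near \oo, cabs (z n) <= 2 / n%:R.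
Proof.
have as1 : `|s| = 1 by apply/eqP; rewrite -(@eqrXn2 _ 2)// ?normr_ge0// expr1n real_normK ?num_real// expr2 s2.
have /near_infty_ge[N HN] := orbit_asymptotics ltr01.
apply/near_infty_ge; exists N.+1 => n Nn; have n0 : 0 < n%:R :> R by rewrite ltr0n (leq_trans _ Nn).
have := HN n (ltnW Nn) => h; rewrite ler_pdivlMr//.
have := cabsB_ge (n%:R * z n) (- s)%:C; rewrite cabsM cabs_nat cabs_real normrN as1; lra.
Qed.

End Orbit.

(** * Logarithmic correction of orbit sums and the principal part *)

Section LogOrbit.
Context {R : realType}.
Variables (F : R[i] -> R[i]) (s a : R).
Hypotheses (s2 : s * s = 1) (cis_a : cis (a + pi) = (- s)%:C :> R[i]) (hF : parabolic s F).
Implicit Types (z w : R[i]) (K : R).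


Let S2 : s%:C * s%:C = 1 :> R[i].
Proof. by rewrite -rmorphM s2. Qed.

Let as1 : `|s| = 1.
Proof. by apply/eqP; rewrite -(@eqrXn2 _ 2)// ?normr_ge0// expr1n real_normK ?num_real// expr2 s2. Qed.

Let cS : cabs s%:C = 1 :> R.
Proof. by rewrite cabs_real. Qed.

(** A right half-plane in the Abel coordinate; for [K > 0], a disc tangent at 0 to the imaginary
    axis on the attracting side of [F]. For [K >= 0] the convention [0^-1 = 0] keeps 0 out. *)
Definition horodisc K : set R[i] := [set z | K < complex.Re (- s%:C / z)].

Lemma Re_div_real (c : R) z : complex.Re (c%:C / z) = c * complex.Re z / cabs z ^+ 2.
Proof. by case: z => x y; rewrite sqr_cabs /=; ring. Qed.

Lemma horodisc_neq0 K z : 0 <= K -> horodisc K z -> z != 0.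
Proof. by move=> K0; rewrite /horodisc/=; case: eqVneq => // ->; rewrite invr0 mulr0 ltNge K0. Qed.

Lemma horodisc_small K z : 0 < K -> horodisc K z -> cabs z < K^-1.
Proof.
move=> K0 zK; have z0 := horodisc_neq0 (ltW K0) zK.
have cz : 0 < cabs z by rewrite cabs_gt0.
have := lt_le_trans zK (le_trans (ler_norm _) (Re_le_cabs _)).
rewrite cabsM cabsN cS mul1r cabsV => h.
by rewrite -[cabs z]invrK ltf_pV2 ?posrE ?invr_gt0.
Qed.

Lemma horodisc_half_plane K z : 0 <= K -> horodisc K z -> 0 < complex.Re (- s%:C * z).
Proof.
move=> K0 zK; have z0 := horodisc_neq0 K0 zK; have cz : 0 < cabs z by rewrite cabs_gt0.
have := le_lt_trans K0 zK; rewrite -rmorphN/= Re_div_real pmulr_lgt0 ?invr_gt0 ?exprn_gt0// => h.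
by rewrite mulrC Re_mulr mulrC.
Qed.

(** The horodisc stays within the half-plane around the direction [a + pi], so the argument keeps a
    distance [pi / 2] from the cut, and small relative perturbations cannot change the branch. *)
Lemma horodisc_Log K z : 0 <= K -> horodisc K z ->
  exists l, [/\ z = cexp l, Log a z = l & a + pi / 2 < complex.Im l < a + 3 * pi / 2].
Proof.
move=> K0 zK; have z0 := horodisc_neq0 K0 zK.
have [t /andP[t1 t2] E] := half_plane_polar (horodisc_half_plane K0 zK).
have cz : 0 < cabs z by rewrite cabs_gt0.
have zE : z = cexp (ln (cabs z) +i* (t + (a + pi))).
  rewrite -cexp_polar// cisD cis_a mulrA rmorphN/= -[LHS]mul1r -S2.
  by rewrite -(mulrA s%:C) -[s%:C * z]opprK -mulNr E cabsM cabsN cS mul1r mulrN mulrC mulrN.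
exists (ln (cabs z) +i* (t + (a + pi))); split => //; last by rewrite /=; lra.
by rewrite {1}zE Log_cexp//=; lra.
Qed.

(** For large [K] the error of the Abel coordinate is at most 1 in modulus, so the translation by 1
    cannot decrease the real part. *)
Lemma horodisc_invariant : exists2 K0, 0 < K0 & forall K, K0 <= K -> forall z, horodisc K z -> horodisc K (F z).
Proof.
have [C C0 /nbhs_cabsP[d d0 H]] := abel_coordinate s2 hF.
have di : 0 < d^-1 by rewrite invr_gt0.
exists (d^-1 + C + 1); first by lra.
move=> K hK z zK; have K0 : 0 < K by lra.
have zs := horodisc_small K0 zK; have z0 := horodisc_neq0 (ltW K0) zK.
have Ki : K^-1 < d by rewrite -[d]invrK ltf_pV2 ?posrE//; lra.
have := H z; rewrite subr0 => /(_ (lt_trans zs Ki) z0)[_ h].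
have KK : K * K^-1 = 1 by rewrite divff// gt_eqF.
have h1 : C * cabs z ^+ 2 <= 1.
  have cz := cabs_ge0 z; have Kz : K * cabs z <= 1 by rewrite mulrC -ler_pdivlMr// div1r ltW.
  have K1 : 1 <= K by lra.
  have z1 : cabs z <= 1 by nra.
  by rewrite expr2; nra.
move: zK; rewrite /horodisc/= => zK.
have := le_trans (Re_le_cabs _) (le_trans h h1).
rewrite raddfB/= (raddfD (@complex.Re R))/= ler_norml; lra.
Qed.

Lemma parabolic_ratio_bound : exists2 C : R, 0 <= C & \forall z \near (0 : R[i]), z != 0 ->
  cabs (F z / z - 1) <= C * cabs z /\ cabs (F z / z - 1 - s%:C * z) <= C * cabs z ^+ 2.
Proof.
have [B B0 HB] := parabolic_id hF.
have [A A0 HA] : bigOX 3 (fun z => F z - z - s%:C * z ^+ 2).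
  apply: bigOX_near_eq (bigOXD (bigOX_le (isT : 3 <= 4)%N hF) (@bigOX_exp R 3)).
  by apply: filterS (nbhs_cabs ltr01) => z _; ring.
exists (A + B); first exact: addr_ge0.
apply: filterS2 HA HB => z hA hB z0.
have cz : 0 < cabs z by rewrite cabs_gt0.
split.
  have -> : F z / z - 1 = (F z - z) / z by rewrite mulrBl divff.
  rewrite cabsM cabsV ler_pdivrMr//; apply: le_trans hB _.
  by rewrite expr2 mulrA !(ler_wpM2r (ltW cz))// lerDr.
have -> : F z / z - 1 - s%:C * z = (F z - z - s%:C * z ^+ 2) / z by field.
rewrite cabsM cabsV ler_pdivrMr//; apply: le_trans hA _.
by rewrite exprSr mulrA ler_wpM2r ?(ltW cz)// ler_wpM2r ?exprn_ge0 ?(ltW cz)// lerDl.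
Qed.

Lemma ratio_small (P : set R[i]) : (\forall u \near (0 : R[i]), P u) ->
  \forall z \near (0 : R[i]), z != 0 -> P (F z / z - 1).
Proof.
move=> /nbhs_cabsP[d d0 HP]; have [C C0 HC] := parabolic_ratio_bound.
have d1 : 0 < d / (C + 1) by rewrite divr_gt0// ltr_wpDl.
apply: filterS2 HC (nbhs_cabs d1) => z h; rewrite ltr_pdivlMr ?ltr_wpDl// => zd z0.
by apply: HP; rewrite subr0; have [h1 _] := h z0; have := cabs_ge0 z; lra.
Qed.

(** From [F z / z = 1 + s z + O(z^2)]: a point of the orbit equals [s] times the next increment of
    the logarithm up to a square, and the squares are summable along an orbit. *)
Lemma log_ratio_bound : exists2 C : R, 0 <= C & \forall z \near (0 : R[i]), z != 0 ->
  cabs (z - s%:C * log1p (F z / z - 1)) <= C * cabs z ^+ 2.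
Proof.
have [C C0 HC] := parabolic_ratio_bound.
exists (8 * C ^+ 2 + C); first by rewrite addr_ge0// mulr_ge0// exprn_ge0.
have h20 : 0 < 2^-1 :> R by rewrite invr_gt0.
apply: filterS2 HC (ratio_small (nbhs_cabs h20)) => z hC hu z0.
have [h1 h2] := hC z0; have h3 := log1p_quadratic (hu z0).
set u := F z / z - 1 in h1 h2 h3 *.
have -> : z - s%:C * log1p u = - s%:C * ((log1p u - u) + (u - s%:C * z)).
  apply/eqP; rewrite -subr_eq0; apply/eqP.
  rewrite (_ : _ - _ = (1 - s%:C * s%:C) * z); last by ring.
  by rewrite S2 subrr mul0r.
rewrite cabsM cabsN cS mul1r; apply: le_trans (cabsD _ _) _.
rewrite mulrDl; apply: lerD => //; apply: le_trans h3 _.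
by rewrite -mulrA -exprMn ler_wpM2l// lerXn2r// nnegrE ?cabs_ge0// mulr_ge0// cabs_ge0.
Qed.

Lemma horodisc_near (P : set R[i]) : (\forall z \near (0 : R[i]), P z) ->
  exists2 K0, 0 < K0 & forall K, K0 <= K -> forall z, horodisc K z -> P z.
Proof.
move=> /nbhs_cabsP[d d0 H]; exists d^-1; first by rewrite invr_gt0.
move=> K dK z zK; have K0 : 0 < K by apply: lt_le_trans dK; rewrite invr_gt0.
apply: H; rewrite subr0; apply: lt_le_trans (horodisc_small K0 zK) _.
by rewrite -[d]invrK lef_pV2 ?posrE ?invr_gt0.
Qed.

Lemma Log_step : exists2 K0, 0 < K0 & forall K, K0 <= K -> forall z, horodisc K z ->
  Log a (F z) = Log a z + log1p (F z / z - 1).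
Proof.
have p20 : 0 < pi / 2 :> R by rewrite divr_gt0// pi_gt0.
have [K0 K00 H] := horodisc_near (ratio_small (filterI Log_mul1p (log1p_small p20))).
exists K0 => // K hK z zK; have K1 : 0 <= K by rewrite ltW// (lt_le_trans K00).
have z0 := horodisc_neq0 K1 zK; have [h1 h2] := H K hK z zK z0.
have [l [E -> /andP[l1 l2]]] := horodisc_Log K1 zK.
have h3 := le_lt_trans (Im_le_cabs _) h2; rewrite ltr_norml in h3.
have EF : F z = cexp l * (1 + (F z / z - 1)) by rewrite -E subrKC mulrC divfK.
rewrite {1}EF; move: h1 h2 h3 => /=; set u := F z / z - 1 => h1 h2 h3.
by apply: h1; rewrite raddfD/=; lra.
Qed.

Lemma summable_increments (u : nat -> R[i]) (C : R) : 0 <= C ->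
  (\forall n \near \oo, cabs (u n.+1 - u n) <= C / n%:R ^+ 2) -> exists l, ccvg \oo u l.
Proof.
move=> C0 /near_infty_ge[N HN].
pose v n := u (n + N.+1)%N; pose q (n : nat) : R := n.+1%:R^-1.
have hq n : cabs (v n.+1 - v n) <= 2 * C * (q n - q n.+1).
  rewrite /v addSn; apply: le_trans (HN _ _) _; first by rewrite addnS ltnW// ltnS leq_addl.
  have n1 : 0 < n.+1%:R :> R by []. have n2 : 0 < n.+2%:R :> R by [].
  have -> : q n - q n.+1 = (n.+1%:R * n.+2%:R)^-1.
    have h (x : R) : 0 < x -> x^-1 - (x + 1)^-1 = (x * (x + 1))^-1.
      move=> x0; have [x1 x2] : x != 0 /\ x + 1 != 0 by split; apply: lt0r_neq0; lra.
      by field; rewrite x1 x2.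
    by rewrite /q -[n.+2]addn1 natrD h.
  rewrite (mulrC 2) -mulrA ler_wpM2l// -[leLHS]mul1r ler_pdivrMr ?exprn_gt0// ?ltr0n ?addnS//.
  rewrite mulrAC ler_pdivlMr ?mulr_gt0// mul1r.
  have h1 : n.+1%:R <= (n + N).+1%:R :> R by rewrite ler_nat ltnS leq_addr.
  have h2 : n.+2%:R = n.+1%:R + 1 :> R by rewrite natr1.
  have h3 : 1 <= n.+1%:R :> R by rewrite ler1n.
  by rewrite h2; nra.
have cq : cvgn (series (fun n => 2 * C * (q n - q n.+1))).
  have -> : series (fun n => 2 * C * (q n - q n.+1)) = (fun n => 2 * C * (q 0%N - q n)).
    apply/funext => n; rewrite /series/= -mulr_sumr; congr (_ * _).
    by rewrite -[LHS]opprK -sumrN; under eq_bigr do rewrite opprB; rewrite telescope_sumr// opprB.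
  apply: is_cvgM; first exact: is_cvg_cst.
  by apply: is_cvgB; [exact: is_cvg_cst|apply: (cvgP 0); exact: cvg_harmonic].
have [l hl] := normal_series_cvg hq cq.
exists (l + v 0%N); apply: (@ccvg_shift _ _ _ N.+1).
apply: (ccvg_near_eq _ (ccvgD hl (ccvg_cst (v 0%N)))); apply: nearW => n.
by rewrite seriesE telescope_sumr// subrK.
Qed.

Lemma ccvg_analytic (T : Type) (G : set_system T) (FG : Filter G) (u : T -> R[i]) l h :
  analytic_at h l -> ccvg G u l -> ccvg G (fun n => h (u n)) (h l).
Proof.
move=> /analytic_ccvg hl ul e e0; have /nbhs_cabsP[d d0 H] := hl e e0.
by apply: filterS (ul d d0) => n; exact: H.
Qed.

Section OneOrbit.
Variable z : nat -> R[i].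
Hypotheses (zS : forall n, z n.+1 = F (z n)) (z_neq0 : forall n, z n != 0) (z_to0 : ccvg \oo z 0).

Definition log_defect n : R[i] := \sum_(0 <= k < n) z k - s%:C * Log a (z n).

Lemma orbit_horodisc K : \forall n \near \oo, horodisc K (z n).
Proof. exact: (orbit_abel_large s2 hF zS z_neq0 z_to0). Qed.

Lemma log_defect_cvg : exists C1, ccvg \oo log_defect C1.
Proof.
have [C C0 HC] := log_ratio_bound; have [K K0 HK] := Log_step.
apply: (@summable_increments _ (4 * C)); first by rewrite mulr_ge0.
have [N1 H1] := (near_infty_ge _).1 (orbit_near z_to0 HC).
have [N2 H2] := (near_infty_ge _).1 (orbit_horodisc K).
have [N3 H3] := (near_infty_ge _).1 (orbit_inverse_bound s2 hF zS z_neq0 z_to0).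
apply/near_infty_ge; exists (maxn N1 (maxn N2 N3)).+1 => n Nn.
have := ltnW Nn; rewrite !geq_max => /and3P[n1 n2 n3].
have {}H1 := H1 n n1; have {}H2 := H2 n n2; have {}H3 := H3 n n3.
have n0 : 0 < n%:R :> R by rewrite ltr0n (leq_trans _ Nn).
rewrite /log_defect big_nat_recr//= zS (HK K (lexx K) _ H2)//.
rewrite (_ : _ - _ = z n - s%:C * log1p (F (z n) / z n - 1)); last by ring.
apply: le_trans (H1 (z_neq0 n)) _.
have -> : 4 * C / n%:R ^+ 2 = C * (2 / n%:R) ^+ 2 by rewrite expr_div_n; ring.
by rewrite ler_wpM2l// lerXn2r// nnegrE ?cabs_ge0// divr_ge0// ltW.
Qed.

Lemma Log_neg_s : Log a (- s)%:C = 0 +i* (a + pi).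
Proof.
have E : (- s)%:C = cexp (0 +i* (a + pi)) :> R[i] by rewrite /cexp/= expR0 mul1r cis_a.
have p0 := @pi_gt0 R; by rewrite E Log_cexp//=; lra.
Qed.

(** As [n z_n] tends to [- s], trading [- Log a (z_n)] for [ln n] adds [s Log a (- s)], that is
    [s i (a + pi)]. *)
Lemma log_corrected_sum C1 : ccvg \oo log_defect C1 ->
  ccvg \oo (fun N => \sum_(0 <= n < N) z n + (s * ln N%:R)%:C) (C1 + s%:C * (0 +i* (a + pi))).
Proof.
move=> h1.
have aL : analytic_at (Log a) (- s)%:C.
  have E : (- s)%:C = cexp (0 +i* (a + pi)) :> R[i] by rewrite /cexp/= expR0 mul1r cis_a.
  have p0 := @pi_gt0 R; by rewrite E; apply: analytic_Log => /=; lra.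
have h2 : ccvg \oo (fun n => Log a (n%:R * z n)) (0 +i* (a + pi)).
  rewrite -Log_neg_s; exact: (ccvg_analytic _ aL (orbit_asymptotics s2 hF zS z_neq0 z_to0)).
have h3 : ccvg \oo (fun n => s%:C * Log a (n%:R * z n)) (s%:C * (0 +i* (a + pi))).
  exact: (ccvgM (ccvg_cst s%:C) h2).
apply: (ccvg_near_eq _ (ccvgD h1 h3)).
have /near_infty_ge[N HN] := orbit_horodisc 0.
apply/near_infty_ge; exists N.+1 => n Nn; have n0 : 0 < n%:R :> R by rewrite ltr0n (leq_trans _ Nn).
have [l [E El /andP[l1 l2]]] := horodisc_Log (lexx 0) (HN n (ltnW Nn)).
have -> : n%:R * z n = cexp ((ln n%:R)%:C + l).
  by rewrite cexpD -E {1}/cexp/= cis0 mulr1 lnK// realC_nat.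
rewrite Log_cexp; last by rewrite raddfD/= add0r; lra.
by rewrite /log_defect El rmorphM/=; ring.
Qed.

(** It equals [i pi^2 - pi / 4] on the attracting petal ([s = 1], [a = 0]) and [pi / 4] on the
    repelling one ([s = -1], [a = - pi]). *)
Definition petal_constant : R[i] := s%:C * (pi%:C * (0 +i* (a + pi)) - (pi / 4)%:C).

Lemma principal_value_log (q1 q2 H C1 : R[i]) : ccvg \oo log_defect C1 ->
  (fun e : R => complex_measure (eps_nbhd (range z) e)
      - (q1 * (e ^+ 2 * ln e)%:C + H * (e ^+ 2)%:C + q2 * (e `^ (5 / 2) * ln e)%:C))
    =O_ (0^'+) (fun e : R => (e `^ (5 / 2))%:C) ->
  H = pi%:C * C1 + petal_constant.
Proof.
move=> h1 hO.
have s1 : s = 1 \/ s = -1.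
  have : (s - 1) * (s + 1) = 0 by rewrite mulrDr mulr1 mulrBl mul1r s2; ring.
  by move/eqP; rewrite mulf_eq0 subr_eq0 addr_eq0 => /orP[/eqP|/eqP]; [left|right].
have := principal_value s1 (orbit_distinct zS z_neq0 z_to0) z_neq0
  (orbit_asymptotics s2 hF zS z_neq0 z_to0) (orbit_increments s2 hF zS z_neq0 z_to0)
  (log_corrected_sum h1) hO.
by move=> ->; rewrite /petal_constant rmorphM/=; ring.
Qed.

End OneOrbit.

Variables (V : set R[i]) (H : R[i] -> R[i]).
Hypotheses (petalV : petal F a V) (ppH : principal_part F V H).

Lemma petal_neq0 z : V z -> z != 0.
Proof.
have [_ _ _ [_ hV _]] := petalV.
by move=> /hV[r [t [r0 _ ->]]]; rewrite -cabs_gt0 cabsM cabs_cis mulr1 cabs_real gtr0_norm.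
Qed.

Lemma petal_iter z n : V z -> V (iter n F z).
Proof. by have [_ hV _ _] := petalV => zV; elim: n => //= n; exact: hV. Qed.

Lemma petal_to0 z : V z -> ccvg \oo (fun n => iter n F z) 0.
Proof. by have [_ _ hV _] := petalV => zV; apply/ccvgP; exact: hV. Qed.

Lemma petal_value z : V z -> exists2 C1, ccvg \oo (log_defect (fun n => iter n F z)) C1 &
  H z = pi%:C * C1 + petal_constant.
Proof.
move=> zV; have z0 n := petal_neq0 (petal_iter n zV).
have [C1 h1] := log_defect_cvg (fun n => iterS n F z) z0 (petal_to0 zV).
have [q1 [q2 hO]] := ppH.
exists C1 => //; exact: (principal_value_log (fun n => iterS n F z) z0 (petal_to0 zV) h1 (hO z zV)).
Qed.

(** The orbit of [F z] is that of [z] without its first point, so the limit of the corrected sums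
    drops by [z]. *)
Lemma petal_shift z : V z -> H (F z) = H z - pi%:C * z.
Proof.
move=> zV; have [C1 h1 ->] := petal_value zV.
have [C1' h1' ->] := petal_value (petal_iter 1 zV).
suff -> : C1' = C1 - z by ring.
have h2 : ccvg \oo (fun n => log_defect (fun n => iter n F z) (n + 1)%N - z) (C1 - z).
  exact: (ccvgB (ccvg_unshift 1 h1) (ccvg_cst z)).
apply: (ccvg_unique h1'); apply: (ccvg_near_eq _ h2); apply: nearW => n.
rewrite /log_defect addn1 big_nat_recl//= -iterSr addrC !addrA addNr add0r.
by congr (_ - _); apply: eq_bigr => k _; rewrite -iterSr.
Qed.

(** By iterated shifts the expression is [H z] minus [pi] times the corrected sum of length [n],
    with limit [H z - pi C1]; the dependence on the orbit disappears. *)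
Lemma petal_limit z : V z ->
  ccvg \oo (fun n => H (iter n F z) + (s * pi)%:C * Log a (iter n F z)) petal_constant.
Proof.
move=> zV; have [C1 h1 E] := petal_value zV.
have Hn n : H (iter n F z) = H z - pi%:C * \sum_(0 <= k < n) iter k F z.
  elim: n => [|n IH]; first by rewrite big_geq// mulr0 subr0.
  by rewrite iterS petal_shift ?IH ?big_nat_recr//=; [ring|exact: petal_iter].
have -> : petal_constant = H z - pi%:C * C1 by rewrite E addrAC subrr add0r.
apply: (ccvg_near_eq _ (ccvgB (ccvg_cst (H z)) (ccvgM (ccvg_cst pi%:C) h1))).
by apply: nearW => n; rewrite Hn /log_defect rmorphM/=; ring.
Qed.

End LogOrbit.

(** * Uniqueness of the principal part on a petal *)
Section PetalIdentity.
Context {R : realType}.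
Variables (F : R[i] -> R[i]) (s a : R).
Hypotheses (s2 : s * s = 1) (cis_a : cis (a + pi) = (- s)%:C :> R[i]) (hF : parabolic s F).
Variables (V : set R[i]) (H : R[i] -> R[i]).
Hypotheses (petalV : petal F a V) (ppH : principal_part F V H).
(** The conjugating germ is written [z * cexp (ell z)]: it is [phi] for [f], and [e^z phi] for the
    inverse of [f]. *)
Variable ell : R[i] -> R[i].
Hypotheses (ell_an : analytic_at ell 0) (ell0 : ell 0 = 0).
Hypothesis conj : \forall z \near (0 : R[i]),
  F z * cexp (ell (F z)) = cexp (s%:C * z) * (z * cexp (ell z)).

Implicit Types (z w : R[i]) (K : R).

(* The analyticity of the inverse of f is not used: for F = finv the coordinate g is an iterate of f. *)
Definition uniformizable n z := exists g sec : R[i] -> R[i],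
  [/\ ccvg (nbhs z) sec (sec z), \forall w \near z, g (sec w) = w &
      forall k, (k <= n)%N -> analytic_at (fun x => iter k F (g x)) (sec z)].

Hypothesis unif : forall n z, V z -> uniformizable n z.

Definition model z := petal_constant s a - (s * pi)%:C * (Log a z + ell z).

Lemma ell_small (e : R) : 0 < e -> \forall z \near (0 : R[i]), cabs (ell z) < e.
Proof. by move=> e0; have := analytic_ccvg ell_an e0; apply: filterS => z; rewrite ell0 subr0. Qed.

Lemma ellF_small (e : R) : 0 < e -> \forall z \near (0 : R[i]), cabs (ell (F z)) < e.
Proof.
move=> e0; have h := bigOX_comp (bigOX_analytic ell_an ell0) (parabolic_bigOX1 hF).
have e2 : 0 < e / 2 by rewrite divr_gt0.
by apply: filterS (bigOX_small h e2) => z; rewrite expr0; lra.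
Qed.

Lemma cexp_eq1_small d : cexp d = 1 -> cabs d < pi -> d = 0 :> R[i].
Proof.
move=> E /(le_lt_trans (Im_le_cabs _)); rewrite ltr_norml => /andP[d1 d2].
have p0 := @pi_gt0 R.
have <- : Log (- pi) (cexp d) = d by apply: Log_cexp; lra.
by rewrite E -cexp0 Log_cexp//=; lra.
Qed.

(** The functional equation determines the logarithms only up to multiples of [2 pi i]. In a small
    horodisc the four terms of the discrepancy are each below [pi / 4], so it vanishes. *)
Lemma model_shift : exists2 K0, 0 < K0 & forall K, K0 <= K -> forall z, horodisc s K z ->
  model (F z) = model z - pi%:C * z.
Proof.
have p0 : 0 < pi / 4 :> R by rewrite divr_gt0// pi_gt0.
have S2 : s%:C * s%:C = 1 :> R[i] by rewrite -rmorphM s2.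
have cs : cabs s%:C = 1 :> R by apply/eqP; rewrite -(@eqrXn2 _ 2)// ?cabs_ge0// expr1n -cabsX expr2 S2 cabs1.
have [K1 K10 H1] := horodisc_near s2 (ratio_small hF (filterI (@cexp_log1p R) (log1p_small p0))).
have [K2 K20 H2] := horodisc_near s2 (filterI (filterI (ell_small p0) (ellF_small p0)) (filterI (nbhs_cabs p0) conj)).
have [K3 K30 H3] := Log_step s2 cis_a hF.
exists (Num.max K1 (Num.max K2 K3)); first by rewrite lt_max K10.
move=> K; rewrite !ge_max => /and3P[k1 k2 k3] z zK.
have K0 : 0 <= K by apply: le_trans k1; exact: ltW.
have z0 := horodisc_neq0 K0 zK.
have [h1 h2] := H1 K k1 z zK z0; have [[h3 h4] [h5 h6]] := H2 K k2 z zK.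
move: h1 h2 (H3 K k3 z zK); rewrite /model.
set u := F z / z - 1 => h1 h2 ->.
have d0 : log1p u + ell (F z) - ell z - s%:C * z = 0.
  apply: cexp_eq1_small; last first.
    have := cabsB (log1p u + ell (F z) - ell z) (s%:C * z).
    have := cabsB (log1p u + ell (F z)) (ell z).
    by have := cabsD (log1p u) (ell (F z)); rewrite (cabsM s%:C) cs mul1r; lra.
  rewrite !cexpD !cexpN h1 /u subrKC.
  have e1 := cexp_neq0 (ell z); have e2 := cexp_neq0 (s%:C * z).
  have nz : cexp (s%:C * z) * (z * cexp (ell z)) != 0 by exact: mulf_neq0 e2 (mulf_neq0 z0 e1).
  apply: (mulIf nz).
  by rewrite mul1r -[RHS]h6; field; rewrite z0 e1 e2.
have -> : Log a z + log1p u + ell (F z) = Log a z + ell z + s%:C * z.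
  by apply/eqP; rewrite -subr_eq0 -d0; apply/eqP; ring.
by rewrite (rmorphM (real_complex R))/= -[pi%:C * z in RHS]mul1r -S2; ring.
Qed.

Lemma principal_part_on_horodisc : exists2 K0, 0 < K0 & forall K, K0 <= K -> forall z, V z -> horodisc s K z ->
  H z = model z.
Proof.
have [K1 K10 H1] := model_shift; have [K2 K20 H2] := horodisc_invariant s2 hF.
exists (Num.max K1 K2); first by rewrite lt_max K10.
move=> K; rewrite ge_max => /andP[k1 k2] z zV zK.
have inv n : horodisc s K (iter n F z) by elim: n => //= n; exact: H2.
have E n : H (iter n F z) - model (iter n F z) = H z - model z.
  elim: n => //= n <-; rewrite (petal_shift s2 cis_a hF petalV ppH) ?(H1 K k1)//; first by ring.
  exact: petal_iter petalV _ _ zV.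
have lim0 : ccvg \oo (fun n => H (iter n F z) - model (iter n F z)) 0.
  have h1 := petal_limit s2 cis_a hF petalV ppH zV.
  have h2 : ccvg \oo (fun n => ell (iter n F z)) (ell 0).
    exact: (ccvg_analytic _ ell_an (petal_to0 petalV zV)).
  have h3 : ccvg \oo (fun n => (s * pi)%:C * ell (iter n F z)) ((s * pi)%:C * ell 0).
    exact: (ccvgM (ccvg_cst _) h2).
  have h4 : ccvg \oo (fun n => H (iter n F z) + (s * pi)%:C * Log a (iter n F z) - petal_constant s a
      + (s * pi)%:C * ell (iter n F z)) (petal_constant s a - petal_constant s a + (s * pi)%:C * ell 0).
    exact: (ccvgD (ccvgB h1 (ccvg_cst _)) h3).
  rewrite ell0 mulr0 addr0 subrr in h4; apply: (ccvg_near_eq _ h4); apply: nearW => n.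
  by rewrite /model; ring.
apply/eqP; rewrite -subr_eq0; apply/eqP.
apply: (ccvg_unique _ lim0); apply: (ccvg_near_eq _ (ccvg_cst _)); apply: nearW => n.
by rewrite E.
Qed.

Lemma horodisc_open K z : 0 <= K -> horodisc s K z -> \forall w \near z, horodisc s K w.
Proof.
move=> K0 zK; have z0 := horodisc_neq0 K0 zK.
have hid : ccvg (nbhs z) (fun w => w) z by move=> e e0; exact: nbhs_cdist.
have h : ccvg (nbhs z) (fun w => - s%:C / w) (- s%:C / z).
  exact: (ccvgM (ccvg_cst _) (ccvgV z0 hid)).
have d0 : 0 < complex.Re (- s%:C / z) - K by rewrite subr_gt0.
apply: filterS (h _ d0) => w /(le_lt_trans (Re_le_cabs _)).
by rewrite raddfB/= ltr_norml /horodisc/=; lra.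
Qed.

Lemma analytic_sum (h : nat -> R[i] -> R[i]) n z : (forall k, (k < n)%N -> analytic_at (h k) z) ->
  analytic_at (fun w => \sum_(0 <= k < n) h k w) z.
Proof.
elim: n => [|n IH] hh.
  rewrite (_ : (fun w => _) = fun=> 0); first exact: analytic_cst.
  by apply/funext => w; rewrite big_geq.
rewrite (_ : (fun w => _) = fun w => \sum_(0 <= k < n) h k w + h n w); last first.
  by apply/funext => w; rewrite big_nat_recr.
by apply: analyticD; [apply: IH => k kn; apply: hh; exact: ltnW|exact: hh].
Qed.

Lemma analytic_model z : V z -> analytic_at ell z -> analytic_at model z.
Proof.
move=> zV ez; have [_ _ _ [_ hV _]] := petalV.
have [r [t [r0 /andP[t1 t2] zE]]] := hV z zV.
have ht : a < complex.Im (ln r +i* t) < a + 2 * pi by rewrite /= t1.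
have Lz : analytic_at (Log a) z by rewrite zE (cexp_polar t r0); exact: analytic_Log ht.
exact: (analyticB (analytic_cst _ _) (analyticM (analytic_cst _ _) (analyticD Lz ez))).
Qed.

Lemma continuation z : V z -> analytic_at ell z ->
  (forall e, 0 < e -> exists w, [/\ w != z, cabs (w - z) < e & H w = model w]) ->
  \forall w \near z, H w = model w.
Proof.
move=> zV ez zeros; have [Vo _ _ _] := petalV.
have [K1 K10 H1] := principal_part_on_horodisc.
have [K2 K20 H2] := horodisc_near s2 (analytic_near ell_an).
pose K := Num.max K1 K2.
have [k1 k2] : K1 <= K /\ K2 <= K by rewrite !le_max !lexx orbT.
have K0 : 0 <= K by apply: le_trans k1; exact: ltW.
have z0 n := petal_neq0 petalV (petal_iter petalV n zV).
have [n hn] : exists n, horodisc s K (iter n F z).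
  have [N HN] := (near_infty_ge _).1 (orbit_horodisc s2 hF (fun n => iterS n F z) z0 (petal_to0 petalV zV) K).
  by exists N; exact: HN.
have [g [sec [sc gs an]]] := unif n zV.
have gz := nbhs_singleton gs.
(* [H - model] read in the coordinate [x], with [H] expressed through its values in the horodisc by
   the shift relation. Every ingredient is analytic at [sec z], and zeros [w] of the difference
   become zeros [sec w]. *)
pose E x := model (iter n F (g x)) + pi%:C * \sum_(0 <= k < n) iter k F (g x) - model (g x).
have aE : analytic_at E (sec z).
  have a0 : analytic_at (fun x => model (g x)) (sec z).
    by apply: (analytic_comp (an 0%N (leq0n n))); rewrite /= gz; exact: analytic_model.
  have a1 : analytic_at (fun x => model (iter n F (g x))) (sec z).
    apply: (analytic_comp (an n (leqnn n))); rewrite gz.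
    exact: (analytic_model (petal_iter petalV n zV) (H2 K k2 _ hn)).
  have a2 : analytic_at (fun x => \sum_(0 <= k < n) iter k F (g x)) (sec z).
    by apply: analytic_sum => k kn; apply: an; exact: ltnW.
  exact: (analyticB (analyticD a1 (analyticM (analytic_cst _ _) a2)) a0).
have HE : \forall w \near z, H w - model w = E (sec w).
  have nV : \forall w \near z, V w by exact: open_nbhs_nbhs.
  have nh : \forall w \near z, horodisc s K (iter n F w).
    have c : ccvg (nbhs z) (fun w => iter n F (g (sec w))) (iter n F (g (sec z))).
      exact: (ccvg_analytic _ (an n (leqnn n)) sc).
    have [d d0 hd] := (nbhs_cabsP _ _).1 (horodisc_open K0 hn).
    by apply: filterS2 gs (c d d0) => w -> h; apply: hd; rewrite -{1}gz.
  apply: filterS3 nV nh gs => w wV wh gw.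
  have Hn m : H (iter m F w) = H w - pi%:C * \sum_(0 <= k < m) iter k F w.
    elim: m => [|m IH]; first by rewrite big_geq// mulr0 subr0.
    rewrite iterS (petal_shift s2 cis_a hF petalV ppH); last exact: (petal_iter petalV).
    by rewrite IH big_nat_recr//=; ring.
  rewrite /E gw -(H1 K k1 _ (petal_iter petalV n wV) wh) Hn; ring.
have E0 : \forall x \near sec z, E x = 0.
  apply: (isolated_zeros aE) => e e0.
  have [d d0 hd] := (nbhs_cabsP _ _).1 (filterI (sc e e0) (filterI gs HE)).
  have [w [wz wd hw]] := zeros d d0; have [h1 [h2 h3]] := hd w wd.
  exists (sec w); split => //; last by rewrite -h3 hw subrr.
  by apply: contra wz => /eqP Ew; rewrite -h2 Ew gz.
have [d d0 hd] := (nbhs_cabsP _ _).1 E0.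
apply: filterS2 HE (sc d d0) => w h1 h2.
by apply/eqP; rewrite -subr_eq0 h1 hd.
Qed.

Lemma petal_identity : \forall z \near (0 : R[i]), V z -> H z = model z.
Proof.
have [Vo _ _ [hsec _ hconn]] := petalV.
have [N [N0 Nan Nconn]] := hconn _ (analytic_near ell_an).
(* Agreement is asked on a whole neighborhood, which makes [A] open; a limit point of [A] in the
   petal is a limit of points of agreement, so [continuation] makes [A] relatively closed. *)
pose A : set R[i] := [set z : R[i] | nbhs z (fun w => H w = model w)].
have [K1 K10 H1] := principal_part_on_horodisc.
have VA : V `&` N `&` A = V `&` N.
  apply: Nconn.
  - have p20 : 0 < (pi / 2 : R) < pi by have := @pi_gt0 R; lra.
    have [d d0 hd] := hsec _ p20; have [e e0 he] := (nbhs_cabsP _ _).1 N0.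
    (* The point of modulus [r] on the axis of the petal is [- s r], with Abel coordinate
       [1 / r > K1]: it lies in the petal, in [N] and in the horodisc. *)
    pose r := Num.min d (Num.min e K1^-1) / 2.
    have m0 : 0 < Num.min d (Num.min e K1^-1) by rewrite !lt_min d0 e0 invr_gt0.
    have r0 : 0 < r by rewrite divr_gt0.
    have : r < Num.min d (Num.min e K1^-1) by rewrite /r; lra.
    rewrite !lt_min => /and3P[rd re rK].
    exists (r%:C * cis (a + pi)).
    have zV : V (r%:C * cis (a + pi)).
      by apply: hd; [rewrite r0|rewrite subrr normr0; case/andP: p20].
    have zK : horodisc s K1 (r%:C * cis (a + pi)).
      have zE : r%:C * cis (a + pi) = - s%:C * r%:C by rewrite cis_a rmorphN mulrC.
      rewrite /horodisc /mkset zE (_ : _ / _ = r^-1%:C).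
        by rewrite /= -[K1]invrK ltf_pV2 ?posrE ?invr_gt0.
      have s0 : s%:C != 0 :> R[i].
        apply/eqP => E; have : s%:C * s%:C = 1 :> R[i] by rewrite -rmorphM s2.
        by rewrite E mul0r => /eqP; rewrite eq_sym oner_eq0.
      have r0' : r%:C != 0 :> R[i] by rewrite -cabs_gt0 cabs_real gtr0_norm.
      by rewrite fmorphV; field; rewrite r0' s0.
    split.
      by split => //; apply: he; rewrite subr0 cabsM cabs_cis mulr1 cabs_real gtr0_norm.
    rewrite /A/=; have nV : \forall w \near r%:C * cis (a + pi), V w by exact: open_nbhs_nbhs.
    apply: filterS2 nV (horodisc_open (ltW K10) zK) => w; exact: H1 (lexx _) _.
  - exists A => //; rewrite openE => z Az.
    by rewrite /interior; exact: (nbhs_interior Az).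
  - exists (closure A); first exact: closed_closure.
    apply/seteqP; split => z [zVN Az]; split; [exact: zVN|exact: subset_closure Az|exact: zVN|].
    have [zA|nA] := pselect (A z); first exact: zA.
    have [zV zN] := zVN; apply: (continuation zV (Nan z zN)) => e e0.
    have [p [Ap pe]] := Az _ (nbhs_cdist z e0).
    exists p; split; [|exact: pe|exact: nbhs_singleton Ap].
    by apply/eqP => E; apply: nA; rewrite -E.
apply: filterS N0 => z zN zV.
have : (V `&` N) z by [].
by rewrite -VA => -[_ Az]; exact: nbhs_singleton Az.
Qed.

End PetalIdentity.

(** * Germs in z + z^2 C{z} *)
Section TangentToIdentity.
Context {R : realType}.
Implicit Types (phi f : R[i] -> R[i]) (c : nat -> R[i]) (z w : R[i]).

Lemma has_power_series_div h c B r : has_power_series h 0 c B r -> c 0%N = 0 ->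
  has_power_series (fun z => if z == 0 then c 1%N else h z / z) 0 (fun n => c n.+1) (B / r) r.
Proof.
move=> [r0 mc sc] c0; split => //.
  move=> K; rewrite ler_pdivlMr// mulr_suml; apply: le_trans (mc K.+1).
  rewrite big_nat_recl// c0 cabs0 mul0r add0r.
  by apply: ler_sum => k _; rewrite -mulrA -exprSr.
move=> w wr; rewrite add0r; have := sc w wr; rewrite add0r => h1.
case: eqVneq => [->|w0].
  apply: (ccvg_near_eq _ (ccvg_cst (c 1%N))); exists 1%N => // K /= K0.
  rewrite seriesE sum_const_coef ?expr0 ?mulr1// => k k0.
  by rewrite expr0n gtn_eqF// mulr0.
have h2 : ccvg \oo (fun K => series (fun n => c n * w ^+ n) (K + 1)%N / w) (h w / w).
  exact: (ccvgM (ccvg_unshift 1 h1) (ccvg_cst w^-1)).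
apply: (ccvg_near_eq _ h2); apply: nearW => K.
rewrite addn1 !seriesE big_nat_recl// c0 mul0r add0r mulr_suml; apply: eq_bigr => k _.
by rewrite exprSr mulrA mulfK.
Qed.

Lemma has_power_series_mul h c B r : has_power_series h 0 c B r ->
  has_power_series (fun z => z * h z) 0 (fun n => if n is n'.+1 then c n' else 0) (B * r) r.
Proof.
move=> [r0 mc sc]; split => //.
  case=> [|K]; first by rewrite big_geq// mulr_ge0 ?(majorized_ge0 mc) ?ltW.
  rewrite big_nat_recl// cabs0 mul0r add0r; apply: le_trans (ler_wpM2r (ltW r0) (mc K)).
  by rewrite mulr_suml; apply: ler_sum => k _; rewrite exprSr mulrA.
move=> w wr; have := sc w wr; rewrite add0r => h1; apply: (@ccvg_shift _ _ _ 1).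
apply: (ccvg_near_eq _ (ccvgM (ccvg_cst w) h1)); apply: nearW => K.
rewrite addn1 !seriesE big_nat_recl// mul0r add0r mulr_sumr; apply: eq_bigr => k _.
by rewrite exprS mulrCA.
Qed.

Lemma tangent_to_id_series phi : tangent_to_id phi ->
  exists c B r, [/\ has_power_series phi 0 c B r, c 0%N = 0 & c 1%N = 1].
Proof.
move=> [c [c0 c1 H]]; exists c.
have [|B [r Hc]] := @power_series_near R c phi 0; last by exists B, r.
apply: filterS H => z; rewrite (_ : (fun n => c n * (z - 0) ^+ n) = (fun n => c n * z ^+ n))//.
by apply/funext => n; rewrite subr0.
Qed.

(** The factor [2^n] in place of the sharper [n] makes the bound a power of the radius [2 rho], at
    which the coefficients are already majorized. *)
Lemma expr_diff_bound (rho : R) z w n : 0 < rho -> cabs z <= rho -> cabs w <= rho ->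
  cabs (z ^+ n - w ^+ n) * rho <= (2 * rho) ^+ n * cabs (z - w).
Proof.
move=> r0 zr wr; have d0 := cabs_ge0 (z - w).
elim: n => [|n IH]; first by rewrite !expr0 subrr cabs0 mul0r mul1r.
have E : z ^+ n.+1 - w ^+ n.+1 = z * (z ^+ n - w ^+ n) + w ^+ n * (z - w) by rewrite !exprS; ring.
have h1 : cabs (z * (z ^+ n - w ^+ n)) * rho <= rho * ((2 * rho) ^+ n * cabs (z - w)).
  by rewrite cabsM -mulrA; apply: ler_pM => //; rewrite ?cabs_ge0// mulr_ge0 ?cabs_ge0 ?ltW.
have h2 : cabs (w ^+ n * (z - w)) * rho <= rho * ((2 * rho) ^+ n * cabs (z - w)).
  rewrite cabsM cabsX mulrC ler_wpM2l ?(ltW r0)// ler_wpM2r//.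
  by rewrite lerXn2r// ?nnegrE ?cabs_ge0// ?mulr_ge0 ?ltW//; lra.
have h3 : cabs (z ^+ n.+1 - w ^+ n.+1) * rho <= cabs (z * (z ^+ n - w ^+ n)) * rho + cabs (w ^+ n * (z - w)) * rho.
  by rewrite -mulrDl ler_wpM2r ?(ltW r0)// E cabsD.
by rewrite [(2 * rho) ^+ n.+1]exprS; lra.
Qed.

Lemma tangent_to_id_injective phi : tangent_to_id phi ->
  exists2 rho : R, 0 < rho & forall z w, cabs z < rho -> cabs w < rho -> phi z = phi w -> z = w.
Proof.
move=> /tangent_to_id_series[c [B [r [[r0 mc sc] c0 c1]]]]; have B0 := majorized_ge0 mc.
(* The first bound keeps [2 rho] inside the disc of convergence; the second makes
   [4 B rho / r^2 <= 1 / 2], so [phi] minus the identity is a contraction. *)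
pose rho := Num.min (r / 2) (r ^+ 2 / (8 * B + 1)).
have b1 : 0 < 8 * B + 1 by lra.
have h0 : 0 < rho by rewrite lt_min !divr_gt0// exprn_gt0.
have rho2 : rho <= r / 2 by rewrite ge_min lexx.
have hr : 2 * rho <= r by lra.
have hB : rho * (8 * B + 1) <= r ^+ 2 by rewrite -ler_pdivlMr// ge_min lexx orbT.
exists rho => // z w zr wr E.
have cr2 : cabs (2 * rho)%:C = 2 * rho :> R by rewrite cabs_real gtr0_norm// mulr_gt0.
have tail K : cabs (\sum_(2 <= k < K) c k * (z ^+ k - w ^+ k)) * rho <= B * (2 * rho / r) ^+ 2 * cabs (z - w).
  pose c' k : R[i] := (cabs (c k))%:C.
  have mc' : majorized c' B r by move=> n; under eq_bigr do rewrite /c' cabs_real ger0_norm ?cabs_ge0//; exact: mc.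
  have h1 : \sum_(2 <= k < K) cabs (c k) * (2 * rho) ^+ k <= B * (2 * rho / r) ^+ 2.
    have := @majorized_tail _ c' B r (2 * rho)%:C 2 K r0 mc'; rewrite cr2 => /(_ hr).
    rewrite (_ : \sum_(_ <= _ < _) _ = (\sum_(2 <= k < K) cabs (c k) * (2 * rho) ^+ k)%:C).
      by rewrite cabs_real => h; apply: le_trans h; exact: ler_norm.
    by rewrite realC_sum; apply: eq_bigr => k _; rewrite /c' realC_X -rmorphM.
  apply: le_trans (ler_wpM2r (cabs_ge0 _) h1); rewrite mulr_suml.
  apply: le_trans (ler_wpM2r (ltW h0) (cabs_sum _ _ _)) _; rewrite mulr_suml.
  by apply: ler_sum => k _; rewrite cabsM -!mulrA ler_wpM2l ?cabs_ge0// expr_diff_bound// ltW.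
have lim : ccvg \oo (fun K => series (fun n => c n * z ^+ n) K - series (fun n => c n * w ^+ n) K - (z - w)) (phi z - phi w - (z - w)).
  have rr : rho < r by lra.
  have hz := sc z (lt_trans zr rr); have hw := sc w (lt_trans wr rr).
  rewrite !add0r in hz hw; exact: (ccvgB (ccvgB hz hw) (ccvg_cst (z - w))).
have h : cabs (phi z - phi w - (z - w)) <= B * (2 * rho / r) ^+ 2 * cabs (z - w) / rho.
  apply: (ccvg_le lim); exists 2 => // -[|[|K]]//= _.
  rewrite ler_pdivlMr//; apply: le_trans (tail K.+2); rewrite ler_wpM2r ?(ltW h0)//.
  rewrite le_eqVlt; apply/orP; left; apply/eqP; congr cabs.
  rewrite !seriesE -sumrB big_nat_recl// big_nat_recl//= !expr0 !expr1 c1 !mul1r subrr add0r.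
  rewrite addrAC subrr add0r [RHS]big_add1 [RHS]big_add1 /=; apply: eq_bigr => k _.
  by rewrite mulrBr.
move: h; rewrite E subrr sub0r cabsN => h.
apply/eqP; rewrite -subr_eq0 -cabs_eq0; apply/negP => /negP d0.
have {}d0 : 0 < cabs (z - w) by rewrite lt_neqAle cabs_ge0 eq_sym d0.
move: h; have -> : B * (2 * rho / r) ^+ 2 * cabs (z - w) / rho = (4 * B * rho / r ^+ 2) * cabs (z - w).
  by field; rewrite !gt_eqF.
rewrite -[leLHS]mul1r ler_pM2r// => h.
have h2 : 4 * B * rho / r ^+ 2 <= 1 / 2 by rewrite ler_pdivrMr ?exprn_gt0//; nra.
lra.
Qed.

Lemma open_cabs_ball (rho : R) : open [set z : R[i] | cabs z < rho].
Proof.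
rewrite openE => z /= zr; apply/nbhs_cabsP; exists (rho - cabs z); first by rewrite subr_gt0.
by move=> w wz /=; have := cdist_triangle z w 0; rewrite !subr0; lra.
Qed.

Lemma tangent_to_id_analytic phi : tangent_to_id phi -> analytic_at phi 0.
Proof.
by move=> /tangent_to_id_series[c [B [r [Hc _ _]]]]; apply/analytic_atP; exists c, B, r.
Qed.

Lemma tangent_to_id0 phi : tangent_to_id phi -> phi 0 = 0.
Proof. by move=> /tangent_to_id_series[c [B [r [Hc c0 _]]]]; rewrite (has_power_series0 Hc). Qed.

(** The preimage is chosen in a ball where [phi] is injective; it exists by open mapping, and
    injectivity makes the choice a left inverse as well. *)
Lemma tangent_to_id_inverse phi : tangent_to_id phi -> exists psi, inverse_germ phi psi.
Proof.
move=> tphi; have [rho r0 inj] := tangent_to_id_injective tphi.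
have [e e0 he] := (nbhs_cabsP _ _).1 (analytic_near (tangent_to_id_analytic tphi)).
pose m := Num.min rho e; have m0 : 0 < m by rewrite lt_min r0.
pose B : set R[i] := [set z | cabs z < m].
have Bo : open B := @open_cabs_ball m.
have B0 : B 0 by rewrite /B /mkset cabs0.
have Ban : analytic_on phi B.
  by move=> z; rewrite /B/= lt_min => /andP[_ ze]; apply: he; rewrite subr0.
have Binj : set_inj B phi.
  by move=> z w /set_mem + /set_mem; rewrite /B/= !lt_min => /andP[zr _] /andP[wr _]; exact: inj.
have [eta eta0 hpsi] := injective_open Bo Ban Binj B0 m0.
pose psi v := xget 0 [set z | B z /\ phi z = v].
have psiP v : cabs v < eta -> B (psi v) /\ phi (psi v) = v.
  move=> hv; have := hpsi v; rewrite (tangent_to_id0 tphi) subr0 => /(_ hv)[w [_ Bw pw]].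
  by rewrite /psi; case: xgetP => [y -> //|/(_ w)]; case.
exists psi; rewrite /inverse_germ.
have hphi : \forall z \near (0 : R[i]), cabs (phi z) < eta.
  have := analytic_ccvg (tangent_to_id_analytic tphi) eta0.
  by apply: filterS => z; rewrite (tangent_to_id0 tphi) subr0.
apply: filterS3 (nbhs_cabs m0) (nbhs_cabs eta0) hphi => z zm ze pz.
have [h1 h2] := psiP _ ze; have [h3 h4] := psiP _ pz; split => //.
by apply: Binj; rewrite ?inE.
Qed.

(** [phi z / z], completed by 1 at 0, is analytic and close to 1, so the series [log1p] supplies its
    logarithm, which agrees with the principal branch used in [Log_germ]. *)
Lemma log_quotient_germ phi : tangent_to_id phi ->
  exists ell, [/\ analytic_at ell 0, ell 0 = 0,
    \forall z \near (0 : R[i]), z * cexp (ell z) = phi z &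
    \forall z \near (0 : R[i]), z != 0 -> Log (- pi) (phi z / z) = ell z].
Proof.
move=> tphi; have [c [B [r [Hc c0 c1]]]] := tangent_to_id_series tphi.
have Hu := has_power_series_div Hc c0; set u := fun z => _ in Hu.
have au : analytic_at u 0 by apply/analytic_atP; exists (fun n => c n.+1), (B / r), r.
have u0 : u 0 = 1 by rewrite /u eqxx.
have au1 : analytic_at (fun z => u z - 1) 0 by exact: (analyticB au (analytic_cst 1 0)).
have near1 (P : set R[i]) : (\forall v \near (0 : R[i]), P v) -> \forall z \near (0 : R[i]), P (u z - 1).
  move=> /nbhs_cabsP[e e0 hP]; have := analytic_ccvg au1 e0; apply: filterS => z; rewrite u0 subrr => hz.
  by apply: hP.
exists (fun z => log1p (u z - 1)); split.
- apply: (analytic_comp au1); rewrite u0 subrr; exact: analytic_log1p.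
- by rewrite u0 subrr log1p0.
- apply: filterS (near1 _ (@cexp_log1p R)) => z ->; rewrite subrKC /u.
  by case: eqVneq => [->|z0]; [rewrite mul0r tangent_to_id0|rewrite mulrC divfK].
apply: filterS (near1 _ (@Log1p R)) => z h z0.
by rewrite -h subrKC /u (negbTE z0).
Qed.

Lemma exp_conjugate_functional f phi : analytic_at f 0 -> f 0 = 0 -> tangent_to_id phi ->
  exp_conjugate f phi -> \forall z \near (0 : R[i]), phi (f z) = cexp z * phi z.
Proof.
move=> fan f0 tphi [psi inv E].
have [e e0 he] := (nbhs_cabsP _ _).1 inv.
have a : analytic_at (fun z => cexp z * phi z) 0 := analyticM (analytic_exp 0) (tangent_to_id_analytic tphi).
have := analytic_ccvg a e0; rewrite (tangent_to_id0 tphi) mulr0.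
apply: filterS2 E => z -> hz.
by have [_ ->] := he _ hz.
Qed.

Lemma functional_exp_conjugate f phi : analytic_at f 0 -> f 0 = 0 -> tangent_to_id phi ->
  (\forall z \near (0 : R[i]), phi (f z) = cexp z * phi z) -> exp_conjugate f phi.
Proof.
move=> fan f0 tphi E; have [psi inv] := tangent_to_id_inverse tphi.
exists psi => //; have [e e0 he] := (nbhs_cabsP _ _).1 inv.
have := analytic_ccvg fan e0; rewrite f0.
by apply: filterS2 E => z <- hz; have [-> _] := he _ hz.
Qed.

End TangentToIdentity.

(** * Gluing on the two petals *)
Section Germ.
Context {R : realType}.
Variables (f finv : R[i] -> R[i]) (D Vplus Vminus : set R[i]) (Hf Hfinv : R[i] -> R[i]).
Hypotheses (oD : open D) (D0 : D 0) (fan : analytic_on f D) (finj : set_inj D f).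
Hypothesis fo : (fun z => f z - (z + z ^+ 2 + z ^+ 3)) =o_ (0 : R[i]) (fun z => z ^+ 3).
Hypothesis finvK : forall z, D z -> finv (f z) = z.
Hypotheses (VpD : Vplus `<=` D) (petal_plus : petal f 0 Vplus).
Hypotheses (VmD : Vminus `<=` f @` D) (petal_minus : petal finv (- pi) Vminus).
Hypotheses (pp_plus : principal_part f Vplus Hf) (pp_minus : principal_part finv Vminus Hfinv).
Implicit Types (z w v : R[i]).

Lemma f_parabolic : parabolic 1 f.
Proof.
have af := fan D0; have id0 := @analytic_id R 0.
have aX (n : nat) : analytic_at (fun z : R[i] => z ^+ n) 0.
  elim: n => [|n IH]; first exact: analytic_cst.
  by rewrite (_ : (fun z : R[i] => z ^+ n.+1) = (fun z => z * z ^+ n)); [exact: analyticM id0 IH|apply/funext => z; rewrite exprS].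
have ah := analyticB af (analyticD (analyticD id0 (aX 2%N)) (aX 3%N)).
by apply: bigOX_near_eq (littleo_bigOX ah fo); apply: filterS (nbhs_cabs ltr01) => z _; rewrite mul1r.
Qed.

Lemma f0 : f 0 = 0.
Proof. exact: parabolic_fix0 f_parabolic. Qed.

(** [finv] is given as a left inverse of [f] on [D]; openness of [f] shows that near [f z] it is
    continuous at that point and a right inverse as well. *)
Lemma finv_near z (e : R) : D z -> 0 < e ->
  \forall v \near f z, [/\ cabs (finv v - z) < e, D (finv v) & f (finv v) = v].
Proof.
move=> Dz e0; have [eta eta0 H] := injective_open oD fan finj Dz e0.
by apply/nbhs_cabsP; exists eta => // v /H[w [we Dw <-]]; rewrite finvK.
Qed.

Lemma finv_near0 (e : R) : 0 < e -> \forall v \near (0 : R[i]), [/\ cabs (finv v) < e, D (finv v) & f (finv v) = v].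
Proof. by move=> e0; have := finv_near D0 e0; rewrite f0; apply: filterS => v; rewrite subr0. Qed.

Lemma finv_parabolic : parabolic (-1) finv.
Proof.
apply: (parabolic_inverse f_parabolic).
  by apply: filterS (finv_near0 ltr01) => v [].
by move=> e e0; apply: filterS (finv_near0 e0) => v [].
Qed.

Lemma cis_plus : cis (0 + pi) = (- 1)%:C :> R[i].
Proof. by rewrite add0r /cis cospi sinpi. Qed.

Lemma cis_minus : cis (- pi + pi) = (- (- 1))%:C :> R[i].
Proof. by rewrite addNr /cis cos0 sin0 opprK. Qed.

Lemma f_uniformizable n z : Vplus z -> uniformizable f n z.
Proof.
move=> zV; exists id, id; split.
- by move=> e e0; exact: nbhs_cdist.
- by apply: filterS (nbhs_cdist z ltr01).
elim=> [|k IH] kn; first exact: analytic_id.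
have h := IH (ltnW kn).
by apply: (analytic_comp h); apply: fan; apply: VpD; exact: petal_iter petal_plus _ _ zV.
Qed.

Lemma Vminus_backward n z : Vminus z -> D (iter n.+1 finv z) /\ f (iter n.+1 finv z) = iter n finv z.
Proof.
by move=> zV; have [x Dx E] := VmD (petal_iter petal_minus n zV); rewrite iterS -E finvK.
Qed.

(** The backward orbit stays in [D]. Near [iter n finv z], the composite of [iter k finv] with
    [iter n f] is [iter (n - k) f], by cancelling one step at a time, and its analyticity is that of
    [f]. *)
Lemma finv_uniformizable n z : Vminus z -> uniformizable finv n z.
Proof.
move=> zV; have back k := Vminus_backward k zV.
exists (iter n f), (iter n finv).
have cs m : ccvg (nbhs z) (iter m finv) (iter m finv z) /\ \forall w \near z, iter m f (iter m finv w) = w.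
  elim: m => [|m [IH1 IH2]].
    by split=> [e e0|]; [exact: nbhs_cdist|apply: filterS (nbhs_cdist z ltr01)].
  have [Dm Em] := back m.
  split=> [e e0|].
    have := finv_near Dm e0; rewrite Em => /nbhs_cabsP[d d0 hd].
    by apply: filterS (IH1 d d0) => w hw; have [] := hd _ hw.
  have := finv_near Dm ltr01; rewrite Em => /nbhs_cabsP[d d0 hd].
  apply: filterS2 IH2 (IH1 d d0) => w E hw.
  by have [_ _ h] := hd _ hw; rewrite iterSr iterS h.
have [c1 c2] := cs n; split => //.
have fy j : (j <= n)%N -> iter j f (iter n finv z) = iter (n - j) finv z.
  elim: j => [|j IH] jn; first by rewrite subn0.
  by rewrite iterS IH ?(ltnW jn)// -(subnSK jn) (back _).2.
have Dy j : (j < n)%N -> D (iter j f (iter n finv z)).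
  by move=> jn; rewrite fy ?(ltnW jn)// -(subnSK jn); have [] := back (n - j.+1)%N.
have aj j : (j <= n)%N -> analytic_at (iter j f) (iter n finv z).
  elim: j => [|j IH] jn; first exact: analytic_id.
  by apply: (analytic_comp (IH (ltnW jn))); apply: fan; exact: Dy.
have nD j : (j < n)%N -> \forall x \near iter n finv z, D (iter j f x).
  move=> jn; have [d d0 hd] := open_ball oD (Dy j jn).
  by apply: filterS (analytic_ccvg (aj j (ltnW jn)) d0) => x; exact: hd.
move=> k kn; apply: (analytic_near_eq _ (aj (n - k)%N (leq_subr _ _))).
elim: k kn => [|k IH] kn; first by apply: filterS (nbhs_cdist _ ltr01) => x _; rewrite subn0.
have lt : (n - k.+1 < n)%N by rewrite ltn_subrL//= (leq_ltn_trans _ kn).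
apply: filterS2 (IH (ltnW kn)) (nD _ lt) => x E Dx.
by rewrite iterS -E -(subnSK kn) iterS finvK.
Qed.

Section ConjugateFunctions.
Variables (phi ell : R[i] -> R[i]).
Hypotheses (ell_an : analytic_at ell 0) (ell0 : ell 0 = 0).
Hypothesis ellE : \forall z \near (0 : R[i]), z * cexp (ell z) = phi z.
Hypothesis phi_f : \forall z \near (0 : R[i]), phi (f z) = cexp z * phi z.

Lemma principal_part_plus : \forall z \near (0 : R[i]), Vplus z ->
  Hf z = 'i%C * (pi ^+ 2)%:C - (pi / 4)%:C - pi%:C * (Log 0 z + ell z).
Proof.
have conj : \forall z \near (0 : R[i]), f z * cexp (ell (f z)) = cexp (1%:C * z) * (z * cexp (ell z)).
  have [d d0 hd] := (nbhs_cabsP _ _).1 ellE.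
  have := analytic_ccvg (fan D0) d0; rewrite f0.
  by apply: filterS3 ellE phi_f => z -> h hz; rewrite hd// h mul1r.
have := petal_identity (mulr1 1) cis_plus f_parabolic petal_plus pp_plus ell_an ell0 conj f_uniformizable.
apply: filterS => z h zV; rewrite h// /model /petal_constant !mul1r.
congr (_ - _ - _); apply/eqP; rewrite eq_complex /= expr2; apply/andP; split; apply/eqP; ring.
Qed.

Lemma principal_part_minus : \forall z \near (0 : R[i]), Vminus z ->
  Hfinv z = pi%:C * z + pi%:C * (Log (- pi) z + ell z) + (pi / 4)%:C.
Proof.
(* From [phi (f w) = e^w phi w] at [w = finv z], the germ [e^z phi z] satisfies the relation with
   factor [e^(-z)]. *)
pose ell' z := ell z + z.
have ell'_an : analytic_at ell' 0 := analyticD ell_an (analytic_id 0).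
have ell'0 : ell' 0 = 0 by rewrite /ell' ell0 addr0.
have conj : \forall z \near (0 : R[i]), finv z * cexp (ell' (finv z)) = cexp ((-1)%:C * z) * (z * cexp (ell' z)).
  have [d d0 hd] := (nbhs_cabsP _ _).1 (filterI ellE phi_f).
  apply: filterS2 ellE (finv_near0 d0) => z Ez [hz _ fz].
  have {}h1 := hd (finv z); rewrite subr0 in h1; have [h3 h4] := h1 hz.
  rewrite fz in h4.
  rewrite /ell' !cexpD rmorphN1 mulN1r mulrA h3 mulrC -h4 (mulrA z) Ez mulrCA -cexpD addNr cexp0.
  by rewrite mulr1.
have N1 : -1 * -1 = 1 :> R by rewrite mulrNN mulr1.
have := petal_identity N1 cis_minus finv_parabolic petal_minus pp_minus ell'_an ell'0 conj finv_uniformizable.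
apply: filterS => z h zV; rewrite h// /model /petal_constant /ell' addNr mulN1r.
have -> : 0 +i* 0 = 0 :> R[i] by [].
by rewrite !rmorphN/= rmorph1; ring.
Qed.

End ConjugateFunctions.

Lemma principal_parts_of_conjugate phi : tangent_to_id phi -> exp_conjugate f phi ->
  \forall z \near (0 : R[i]),
    (Vplus z -> Hf z = - (pi%:C * Log_germ 0 phi z) + 'i%C * (pi ^+ 2)%:C - (pi / 4)%:C) /\
    (Vminus z -> Hfinv z = pi%:C * z + pi%:C * Log_germ (- pi) phi z + (pi / 4)%:C).
Proof.
move=> tphi cphi; have phi_f := exp_conjugate_functional (fan D0) f0 tphi cphi.
have [ell [ell_an ell0 ellE ellL]] := log_quotient_germ tphi.
have h1 := principal_part_plus ell_an ell0 ellE phi_f.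
have h2 := principal_part_minus ell_an ell0 ellE phi_f.
apply: filterS3 h1 h2 ellL => z h1 h2 h3; split => zV.
  by rewrite h1// /Log_germ h3 ?(petal_neq0 petal_plus zV)//; ring.
by rewrite h2// /Log_germ h3 ?(petal_neq0 petal_minus zV).
Qed.

Definition glues (N : set R[i]) (h : R[i] -> R[i]) := [/\ open N, N 0, analytic_on h N,
  (forall z, N z -> Vplus z -> Hf z - 'i%C * (pi ^+ 2)%:C + pi%:C * Log 0 z = h z) &
  (forall z, N z -> Vminus z -> pi%:C * z - Hfinv z + pi%:C * Log (- pi) z = h z)].

Lemma conjugate_glues phi : tangent_to_id phi -> exp_conjugate f phi -> exists N h, glues N h.
Proof.
move=> tphi cphi; have phi_f := exp_conjugate_functional (fan D0) f0 tphi cphi.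
have [ell [ell_an ell0 ellE _]] := log_quotient_germ tphi.
have h1 := principal_part_plus ell_an ell0 ellE phi_f.
have h2 := principal_part_minus ell_an ell0 ellE phi_f.
have [e e0 he] := (nbhs_cabsP _ _).1 (filterI (analytic_near ell_an) (filterI h1 h2)).
(* What both formulas leave once their logarithm of [z] is subtracted; the added [pi z] cancels the
   extra term of the inverse. *)
exists [set z | cabs z < e], (fun z => - pi%:C * ell z - (pi / 4)%:C).
split.
- exact: open_cabs_ball.
- by rewrite /mkset cabs0.
- move=> z ze; have [h _] := he z ltac:(by rewrite subr0).
  exact: (analyticB (analyticM (analytic_cst _ _) h) (analytic_cst _ _)).
- by move=> z ze zV; have [_ [h _]] := he z ltac:(by rewrite subr0); rewrite h//; ring.
by move=> z ze zV; have [_ [_ h]] := he z ltac:(by rewrite subr0); rewrite h//; ring.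
Qed.

Lemma glues_conjugate N h : glues N h -> exists phi, tangent_to_id phi /\ exp_conjugate f phi.
Proof.
move=> [No N0 hN hp _].
have [z1 z1V] : exists z, Vplus z.
  have [_ _ _ [hsec _ _]] := petal_plus.
  have p20 : 0 < (pi / 2 : R) < pi by have := @pi_gt0 R; lra.
  have [d d0 hd] := hsec _ p20; exists ((d / 2)%:C * cis (0 + pi)); apply: hd; first by lra.
  by rewrite subrr normr0; case/andP: p20.
pose z n := iter n f z1.
have zV n : Vplus (z n) := petal_iter petal_plus n z1V.
have z0 n : z n != 0 := petal_neq0 petal_plus (zV n).
have zl : ccvg \oo z 0 := petal_to0 petal_plus z1V.
have nN : \forall x \near (0 : R[i]), N x by exact: open_nbhs_nbhs.
(* The orbit limit of [petal_limit] minus [i pi^2]; this value is what normalizes [phi] to have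
   derivative 1 at 0. *)
have h0 : h 0 = - (pi / 4)%:C.
  have l1 : ccvg \oo (fun n => h (z n)) (h 0) by exact: (ccvg_analytic _ (hN _ N0) zl).
  have l2 := petal_limit (mulr1 1) cis_plus f_parabolic petal_plus pp_plus z1V.
  have l3 : ccvg \oo (fun n => h (z n)) (petal_constant 1 0 - 'i%C * (pi ^+ 2)%:C).
    apply: (ccvg_near_eq _ (ccvgB l2 (ccvg_cst ('i%C * (pi ^+ 2)%:C)))).
    by apply: filterS (orbit_near zl nN) => n zN; rewrite -hp// mul1r -/(z n); ring.
  rewrite (ccvg_unique l1 l3) /petal_constant.
  apply/eqP; rewrite eq_complex /= expr2; apply/andP; split; apply/eqP; ring.
have piV : (pi^-1)%:C * pi%:C = 1 :> R[i] by rewrite -rmorphM/= mulVf// gt_eqF// pi_gt0.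
(* Solving [h = - pi log (phi / z) - pi / 4] for [phi / z]. *)
pose k x := cexp (- (pi^-1)%:C * (h x + (pi / 4)%:C)).
pose phi x := x * k x.
have ak x : N x -> analytic_at k x.
  move=> xN; have a1 := analyticM (analytic_cst (- (pi^-1)%:C) x) (analyticD (hN _ xN) (analytic_cst (pi / 4)%:C x)).
  exact: (analytic_comp a1 (analytic_exp _)).
have k0 : k 0 = 1 by rewrite /k h0 addNr mulr0 cexp0.
have tphi : tangent_to_id phi.
  have /analytic_atP[c [B [r Hc]]] := ak _ N0.
  have [r0 _ sc] := has_power_series_mul Hc.
  exists (fun n => if n is n'.+1 then c n' else 0); split => //.
    by rewrite -(has_power_series0 Hc) k0.
  apply: filterS (nbhs_cabs r0) => x xr; apply/ccvgP; have := sc x xr; rewrite add0r; exact.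
have aphi := tangent_to_id_analytic tphi.
have shift n : N (z n) -> N (z n.+1) -> phi (f (z n)) = cexp (z n) * phi (z n).
  move=> n1 n2; have [_ _ _ [_ hV _]] := petal_plus.
  (* On the petal the factor [z] absorbs the logarithmic term, so [phi] is an exponential of [Hf],
     and the shift of [Hf] by [- pi z] becomes multiplication by [e^z]. *)
  have E m : N (z m) -> phi (z m) = cexp (- (pi^-1)%:C * (Hf (z m) - 'i%C * (pi ^+ 2)%:C + (pi / 4)%:C)).
    move=> mN; rewrite /phi /k -hp//.
    have [r [t [r0 /andP[t1 t2] zE]]] := hV _ (zV m).
    have lt : 0 < complex.Im (ln r +i* t) < 0 + 2 * pi by rewrite /= t1.
    rewrite {1 3}zE (cexp_polar t r0) (Log_cexp lt) -cexpD; congr cexp.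
    by rewrite -[X in X + _]mul1r -piV; ring.
  rewrite -[f (z n)]/(z n.+1) !E// -[z n.+1]/(f (z n)).
  rewrite (petal_shift (mulr1 1) cis_plus f_parabolic petal_plus pp_plus (zV n)) -cexpD.
  by congr cexp; rewrite -[X in _ = X + _]mul1r -piV; ring.
have phi_f : \forall x \near (0 : R[i]), phi (f x) = cexp x * phi x.
  have aE : analytic_at (fun x => phi (f x) - cexp x * phi x) 0.
    have a1 : analytic_at (fun x => phi (f x)) 0.
      by apply: (analytic_comp (fan D0)); rewrite f0.
    exact: (analyticB a1 (analyticM (analytic_exp 0) aphi)).
  have : \forall x \near (0 : R[i]), phi (f x) - cexp x * phi x = 0.
    apply: (isolated_zeros aE) => e e0.
    have [M1 H1] := (near_infty_ge _).1 (orbit_near zl nN).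
    have [M2 H2] := (near_infty_ge _).1 (zl e e0).
    exists (z (M1 + M2)%N); split => //; first exact: H2 (leq_addl _ _).
    rewrite shift ?subrr//; apply: H1; rewrite ?leq_addr//.
    by rewrite (leq_trans (leq_addr M2 M1)).
  by apply: filterS => x /subr0_eq.
exists phi; split => //; exact: functional_exp_conjugate (fan D0) f0 tphi phi_f.
Qed.

End Germ.

Theorem theorem4p7 (R : realType) (f finv : R[i] -> R[i])
    (D Vplus Vminus : set R[i]) (Hf Hfinv : R[i] -> R[i]) :
  open D -> D 0 -> analytic_on f D -> set_inj D f ->
  (fun z => f z - (z + z ^+ 2 + z ^+ 3)) =o_ (0 : R[i]) (fun z => z ^+ 3) ->
  (forall z, D z -> finv (f z) = z) ->
  Vplus `<=` D -> petal f 0 Vplus ->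
  Vminus `<=` f @` D -> petal finv (- pi) Vminus ->
  principal_part f Vplus Hf ->
  principal_part finv Vminus Hfinv ->
  ((exists (N : set R[i]) (h : R[i] -> R[i]),
      [/\ open N, N 0, analytic_on h N,
        (forall z, N z -> Vplus z ->
           Hf z - 'i%C * (pi ^+ 2)%:C + pi%:C * Log 0 z = h z) &
        (forall z, N z -> Vminus z ->
           pi%:C * z - Hfinv z + pi%:C * Log (- pi) z = h z)])
   <->
   (exists phi : R[i] -> R[i], tangent_to_id phi /\ exp_conjugate f phi))
  /\
  (forall phi : R[i] -> R[i], tangent_to_id phi -> exp_conjugate f phi ->
     \forall z \near (0 : R[i]),
       (Vplus z ->
          Hf z = - (pi%:C * Log_germ 0 phi z) + 'i%C * (pi ^+ 2)%:C
                 - (pi / 4)%:C) /\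
       (Vminus z ->
          Hfinv z = pi%:C * z + pi%:C * Log_germ (- pi) phi z
                    + (pi / 4)%:C)).
Proof.
move=> oD D0 fan finj fo finvK VpD petp VmD petm ppp ppm; split.
  split=> [[N [h g]]|[phi [tphi cphi]]].
    exact: (glues_conjugate D0 fan fo petp ppp g).
  exact: (conjugate_glues oD D0 fan finj fo finvK VpD petp VmD petm ppp ppm tphi cphi).
move=> phi tphi cphi.
exact: (principal_parts_of_conjugate oD D0 fan finj fo finvK VpD petp VmD petm ppp ppm tphi cphi).
Qed.
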